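(* Let $\mathcal L^W$ be the law of a $d'$-dimensional Brownian motion on $C^{\alpha,0}([0,T];\mathbb R^{d'})$ and let $\mathcal L^{W^N}$ be the law of the truncated Brownian motion. Choose $N=N(n)$ to satisfy $$N\approx\frac{\mathcal W\big(\ln(2^{2\alpha-1})\cdot(\log n)^{2\alpha-1}\big)}{\ln(2^{2\alpha-1})},$$ where $\mathcal W$ is the Lambert-W function, the inverse function of $y=xe^x$. Then for all $r>1$, the quantization $q_n$ (with truncation level $N$) defined in the context satisfies $$\Big(\int_{C^{\alpha,0}([0,T];\mathbb R^{d'})}\|x-q_n(x)\|_\alpha^r\,d\mathcal L^W(x)\Big)^{1/r}\lesssim d'\cdot\big(\log n\big)^{\alpha-1/2}\qquad\text{as }n\to\infty.$$
   Context: $T>0$, $d'\in\mathbb N$, $\alpha\in(0,1/2)$. $f_n\lesssim g_n$ means $\limsup_nf_n/g_n\le C$ for a constant $C>0$ independent of $n$; $f_n\approx g_n$ means $f_n\lesssim g_n$ and $g_n\lesssim f_n$. The branch of $\mathcal W$ is the one for which $N\to\infty$, i.e. the choice of $N$ amounts to $\sqrt N\,2^{(\alpha-1/2)N}\approx(\log n)^{\alpha-1/2}$. $\|\cdot\|_\alpha$ is the $\alpha$-H\''older norm; $C^{\alpha,0}([0,T];\mathbb R^{d'})$ is the $\|\cdot\|_\alpha$-closure of the $\beta$-H\''older paths from $0$ ($\alpha<\beta<1$). $\mathcal H$ is the RKHS of Brownian motion. Haar/Schauder functions: $\Lambda_N=\{(0,0)\}\cup\{(p,m):0\le p\le N,1\le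 m\le2^p\}$; $H_{00}=T^{-1/2}$; $H_{pm}=\sqrt{2^p/T}$ on $[\frac{(m-1)T}{2^p},\frac{(2m-1)T}{2^{p+1}})$, $-\sqrt{2^p/T}$ on $[\frac{(2m-1)T}{2^{p+1}},\frac{mT}{2^p})$, $0$ elsewhere; $G_{pm}(t)=\int_0^tH_{pm}$; $x_{pm}=\int H_{pm}\,dx\in\mathbb R^{d'}$. $W^N=\sum_{\Lambda_N}W_{pm}G_{pm}$; $\mathcal H_N=\{\sum_{\Lambda_N}a_{pm}G_{pm}:a_{pm}\in\mathbb R^{d'}\}$, $\mathcal H^{N,(1)}$ its scalar ($d'=1$) version. Quantization $q_n$. An $n$-stationary set of a law $\mu$ on a Banach space is a set of $n$ points each equal to the $\mu$-barycentre of its Voronoi cell. Let $\mathfrak C_n^{(1)}\subset\mathcal H^{N,(1)}$ be an $n$-stationary set for the law of $\langle W^N,e_1\rangle$ on $(\mathcal H^{N,(1)},\|\cdot\|_\alpha)$, obtained as a minimiser of the mean square error $(c_1,\dots,c_n)\mapsto\int\min_i\|y-c_i\|_\alpha^2$, with Voronoi partition $\hat{\mathfrak S}_n^{(1)}$. Put $\mathfrak C_n=(\mathfrak C_n^{(1)})^{\times d'}\subset\mathcal H_N$ (so $|\mathfrak C_n|=n^{d'}$), $\hat{\mathfrak S}_n=(\hat{\mathfrak S}_n^{(1)})^{\times d'}$, let $P_N[x]=\sum_{\Lambda_N}x_{pm}G_{pm}$ (the continuous extension of the orthogonal projection $\mathcal H\to\mathcal H_N$), $\mathfrak s_i=P_N^{-1}(\hat{\mathfrak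 s}_i)$, and $q_n(x)=\mathfrak c_i$ for $x\in\mathfrak s_i$. *)

(* Defs.v *)
From HB Require Import structures.
From mathcomp Require Import all_boot all_order all_algebra.
From mathcomp Require Import all_classical all_reals all_analysis.
From mathcomp Require Import measurable_realfun.
From mathcomp Require Import ring lra.
Set Implicit Arguments.
Unset Strict Implicit.
Unset Printing Implicit Defensive.
Import Order.TTheory GRing.Theory Num.Theory.
Import numFieldNormedType.Exports.
Local Open Scope classical_set_scope.
Local Open Scope ring_scope.

Section Euclidean.
Context {R : realType} {d : nat}.
Implicit Types u v : 'rV[R]_d.

(* The norm that MathComp-Analysis puts on ['rV_d] is the max norm. *)
Definition enorm u : R := Num.sqrt (\sum_j u 0 j ^+ 2).

Lemma sum_sqr_ge0 u : 0 <= \sum_j u 0 j ^+ 2.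
Proof. by apply: sumr_ge0 => j _; exact: sqr_ge0. Qed.

Lemma enorm_ge0 u : 0 <= enorm u.
Proof. exact: sqrtr_ge0. Qed.

Lemma enormE u : enorm u ^+ 2 = \sum_j u 0 j ^+ 2.
Proof. by rewrite sqr_sqrtr// sum_sqr_ge0. Qed.

Lemma enorm0 : enorm 0 = 0.
Proof. by rewrite /enorm big1 ?sqrtr0// => j _; rewrite mxE expr0n. Qed.

Lemma enorm_eq0 u : enorm u <= 0 -> u = 0.
Proof.
move=> u0; have {}u0 : enorm u ^+ 2 = 0.
  by rewrite (_ : enorm u = 0) ?expr0n//; apply/eqP; rewrite eq_le u0 enorm_ge0.
apply/rowP => j; rewrite mxE; apply/eqP; rewrite -sqrf_eq0.
move/eqP: u0; rewrite enormE psumr_eq0; last by move=> i _; exact: sqr_ge0.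
by move=> /allP /(_ j); apply; rewrite mem_index_enum.
Qed.

Lemma enormZ a u : enorm (a *: u) = `|a| * enorm u.
Proof.
rewrite -sqrtr_sqr /enorm -sqrtrM ?sqr_ge0//; congr Num.sqrt.
by rewrite mulr_sumr; apply: eq_bigr => j _; rewrite mxE exprMn.
Qed.

Lemma cauchy_schwarz u v :
  \sum_j u 0 j * v 0 j <= enorm u * enorm v.
Proof.
apply: (le_trans (ler_norm _)).
rewrite -ler_sqr ?nnegrE ?mulr_ge0 ?enorm_ge0 ?normr_ge0//.
rewrite real_normK ?num_real// exprMn !enormE.
rewrite expr2 !big_distrlr /= -subr_ge0 -(pmulr_rge0 _ (ltr0Sn R 1)).
rewrite mulrBr -[X in _ - X]/(2%:R * _) mulr2n mulrDl mul1r.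
rewrite [X in X + _ - _]exchange_big/= -big_split/= mulr_sumr -sumrB.
apply: sumr_ge0 => i _; rewrite -big_split/= mulr_sumr -sumrB.
apply: sumr_ge0 => j _.
rewrite (_ : _ - _ = (u 0 i * v 0 j - u 0 j * v 0 i) ^+ 2) ?sqr_ge0//.
by ring.
Qed.

Lemma enormD u v : enorm (u + v) <= enorm u + enorm v.
Proof.
rewrite -ler_sqr ?nnegrE ?addr_ge0 ?enorm_ge0// sqrrD !enormE.
rewrite (_ : \sum_j _ = \sum_j u 0 j ^+ 2 + (\sum_j u 0 j * v 0 j) *+ 2
    + \sum_j v 0 j ^+ 2); last first.
  rewrite -sumrMnl -!big_split/=; apply: eq_bigr => j _.
  by rewrite mxE sqrrD.
by rewrite lerD2r lerD2l lerMn2r/= cauchy_schwarz.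
Qed.

End Euclidean.

Record time (R : realType) (T : R) := Time {
  time_val :> R;
  time_valP : 0 <= time_val <= T }.

HB.instance Definition _ (R : realType) (T : R) := [isSub for @time_val R T].

Record exponent (R : realType) := Exponent {
  exponent_val :> R;
  exponent_valP : 0 < exponent_val < 1 / 2 }.

Definition time_dist {R : realType} {T : R} (s t : time T) : R :=
  `|time_val t - time_val s|.

Section HolderNorm.
Context {R : realType}.

Definition trajectory (T : R) (d : nat) := time T -> 'rV[R]_d.

Definition holder_quotients {T : R} {d : nat} (b : R) (x : trajectory T d) :
    set R :=
  [set h | exists s t : time T,
    s < t :> R /\ h = enorm (x t - x s) / time_dist s t `^ b].

(* This ignores additive constants; it is a norm on trajectories from 0. *)
Definition holder_norm {T : R} {d : nat} (b : R) (x : trajectory T d) : \bar R :=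
  ereal_sup [set h%:E | h in holder_quotients b x].

Definition from0 {T : R} {d : nat} (x : trajectory T d) :=
  forall t : time T, t = 0 :> R -> x t = 0.

Definition holder_closure (T : R) (d : nat) (alpha : exponent R) :
    {pred trajectory T d} :=
  mem [set x : trajectory T d | from0 x /\
    forall e : R, 0 < e -> exists y : trajectory T d,
      [/\ from0 y,
          exists2 b : R, (alpha : R) < b < 1 & (holder_norm b y < +oo)%E
        & (holder_norm alpha (x - y)%R < e%:E)%E]].

End HolderNorm.
Arguments holder_closure {R} T d alpha.

Section HolderNormTheory.
Context {R : realType} {T : R} {d : nat}.
Implicit Types (x y : trajectory T d) (b k : R) (s t : time T).

Lemma lt_time_diff s t : s < t :> R -> 0 < time_dist s t.
Proof. by move=> st; rewrite /time_dist normr_gt0 subr_eq0 gt_eqF. Qed.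

Lemma holder_norm_leP b x k : (holder_norm b x <= k%:E)%E <->
  forall s t, s < t :> R -> enorm (x t - x s) <= k * time_dist s t `^ b.
Proof.
split=> [xk s t st|xk].
- rewrite -ler_pdivrMr ?powR_gt0 ?lt_time_diff// -lee_fin.
  apply: le_trans xk; apply: ereal_sup_ubound.
  by exists (enorm (x t - x s) / time_dist s t `^ b) => //; exists s, t.
- apply: ge_ereal_sup => _ [_ [s [t [st ->]]] <-].
  by rewrite lee_fin ler_pdivrMr ?powR_gt0 ?lt_time_diff// xk.
Qed.

Definition hnorm b x : R := fine (holder_norm b x).

Lemma hnorm_ge0 b x : 0 <= hnorm b x.
Proof.
have [x0|/set0P[h xh]] := eqVneq (holder_quotients b x) set0.
  by rewrite /hnorm /holder_norm x0 image_set0 ereal_sup0.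
apply: fine_ge0; apply: (@le_trans _ _ h%:E); last first.
  by apply: ereal_sup_ubound; exists h.
by case: xh => s [t [_ ->]]; rewrite lee_fin divr_ge0 ?enorm_ge0 ?powR_ge0.
Qed.

Lemma hnorm_le b x k : 0 <= k -> (holder_norm b x <= k%:E)%E -> hnorm b x <= k.
Proof. by rewrite /hnorm; case: (holder_norm b x) => //= r _; rewrite lee_fin. Qed.

Lemma hnormP b x : (holder_norm b x < +oo)%E ->
  forall s t, s < t :> R ->
    enorm (x t - x s) <= hnorm b x * time_dist s t `^ b.
Proof.
move=> xoo; apply/holder_norm_leP; rewrite /hnorm.
by case: (holder_norm b x) xoo => //= _; rewrite leNye.
Qed.

Lemma holder_norm_fin b x k : (forall s t, s < t :> R ->
  enorm (x t - x s) <= k * time_dist s t `^ b) -> (holder_norm b x < +oo)%E.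
Proof. by move=> /holder_norm_leP/le_lt_trans; apply; rewrite ltry. Qed.

Lemma time_diff_le s t : s < t :> R -> time_dist s t <= T.
Proof.
move=> st; rewrite /time_dist ger0_norm ?subr_ge0 ?(ltW st)//.
have /andP[s0 _] := time_valP s; have /andP[_ tT] := time_valP t. lra.
Qed.

Lemma holder_norm_lt b c x : b < c -> (holder_norm c x < +oo)%E ->
  (holder_norm b x < +oo)%E.
Proof.
move=> bc /hnormP xc; apply: (@holder_norm_fin b x (hnorm c x * T `^ (c - b))).
move=> s t st; apply: (le_trans (xc s t st)).
rewrite -mulrA ler_wpM2l ?hnorm_ge0//.
have -> : time_dist s t `^ c = time_dist s t `^ (c - b) * time_dist s t `^ b.
  by rewrite -powRD ?subrK//; apply/implyP => _; rewrite gt_eqF ?lt_time_diff.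
rewrite ler_wpM2r ?powR_ge0// ge0_ler_powR ?nnegrE//.
- by rewrite subr_ge0 ltW.
- exact: normr_ge0.
- exact: (le_trans (normr_ge0 _) (time_diff_le st)).
- exact: time_diff_le.
Qed.

Lemma holder_normD b x y : (holder_norm b x < +oo)%E ->
  (holder_norm b y < +oo)%E ->
  (holder_norm b (x + y)%R <= (hnorm b x + hnorm b y)%:E)%E.
Proof.
move=> /hnormP bx /hnormP bY; apply/holder_norm_leP => s t st.
rewrite mulrDl (le_trans _ (lerD (bx s t st) (bY s t st)))//.
by rewrite (_ : (x + y) t - _ = (x t - x s) + (y t - y s)) ?enormD// addrACA -opprD.
Qed.

Lemma holder_normZ b a x : (holder_norm b x < +oo)%E ->
  (holder_norm b (a *: x)%R <= (`|a| * hnorm b x)%:E)%E.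
Proof.
move=> /hnormP bx; apply/holder_norm_leP => s t st.
by rewrite -mulrA -scalerBr enormZ ler_wpM2l ?bx.
Qed.

End HolderNormTheory.

Section HolderClosure.
Context {R : realType} (T : R) (d : nat) (alpha : exponent R).
Implicit Types x y : trajectory T d.
Local Notation a := (exponent_val alpha).

Lemma exponent_lt1 : a < 1.
Proof. by have /andP[_ a2] := exponent_valP alpha; lra. Qed.

Lemma holder_closure_fin x : x \in holder_closure T d alpha ->
  (holder_norm a x < +oo)%E.
Proof.
rewrite inE => -[_ /(_ _ ltr01)[y [_ [b /andP[ab _] yb] xy]]].
have := holder_normD (lt_trans xy (ltry _)) (holder_norm_lt ab yb).
by rewrite subrK => /le_lt_trans; apply; rewrite ltry.
Qed.

Lemma holder_closureW x : from0 x ->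
  (exists2 b, a < b < 1 & (holder_norm b x < +oo)%E) ->
  x \in holder_closure T d alpha.
Proof.
move=> x0 [b ab xb]; rewrite inE; split=> // e e0; exists x; split=> //.
  by exists b.
rewrite subrr; apply: le_lt_trans (_ : 0%:E < _)%E; last by rewrite lte_fin.
by apply/holder_norm_leP => s t _; rewrite subrr enorm0 mul0r.
Qed.

Lemma holder_closure_submod : submod_closed (holder_closure T d alpha).
Proof.
split.
  apply: holder_closureW => //; exists ((a + 1) / 2).
    by have := exponent_lt1; lra.
  by apply: (@holder_norm_fin _ _ _ _ _ 0) => s t _; rewrite subrr enorm0 mul0r.
move=> k x y /[!inE] -[x0 xcl] [y0 ycl]; split.
  by move=> t t0; rewrite -[_ t]/(k *: x t + y t) x0// y0// scaler0 addr0.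
move=> e e0.
have ek : 0 < e / (2 * (`|k| + 1)) by rewrite divr_gt0 ?mulr_gt0// ltr_wpDl.
have e2 : 0 < e / 4 by rewrite divr_gt0.
have [u [u0 [b /andP[ab b1] ub] xu]] := xcl _ ek.
have [v [v0 [c /andP[ac c1] vc] yv]] := ycl _ e2.
exists (k *: u + v); split.
- by move=> t t0; rewrite -[_ t]/(k *: u t + v t) u0// v0// scaler0 addr0.
- exists ((a + Num.min b c) / 2).
    have : a < Num.min b c by rewrite lt_min ab ac.
    have : Num.min b c <= b by rewrite ge_min lexx.
    by lra.
  have fu : (holder_norm ((a + Num.min b c) / 2) u < +oo)%E.
    apply: holder_norm_lt ub.
    have : Num.min b c <= b by rewrite ge_min lexx.
    by lra.
  have fv : (holder_norm ((a + Num.min b c) / 2) v < +oo)%E.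
    apply: holder_norm_lt vc.
    have : Num.min b c <= c by rewrite ge_min lexx orbT.
    by lra.
  apply: (le_lt_trans (holder_normD _ fv)); last by rewrite ltry.
  by apply: (le_lt_trans (holder_normZ k fu)); rewrite ltry.
- rewrite (_ : _ - _ = k *: (x - u) + (y - v)); last first.
    by rewrite scalerBr opprD addrACA.
  have fxu := lt_trans xu (ltry _); have fyv := lt_trans yv (ltry _).
  have fkxu : (holder_norm a (k *: (x - u))%R < +oo)%E.
    by apply: (le_lt_trans (holder_normZ k fxu)); rewrite ltry.
  apply: (le_lt_trans (holder_normD fkxu fyv)); rewrite lte_fin.
  have h1 : hnorm a (k *: (x - u)) <= `|k| * (e / (2 * (`|k| + 1))).
    apply: (le_trans (hnorm_le _ (holder_normZ k fxu))).
      by rewrite mulr_ge0 ?hnorm_ge0.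
    by rewrite ler_wpM2l// hnorm_le// ltW.
  have h2 : hnorm a (y - v) <= e / 4.
    by rewrite hnorm_le ?ltW// divr_ge0// ltW.
  have h3 : `|k| * (e / (2 * (`|k| + 1))) <= e / 2.
    rewrite mulrA ler_pdivrMr ?mulr_gt0 ?ltr_wpDl//.
    by have := normr_ge0 k; nra.
  by lra.
Qed.

End HolderClosure.

Section HolderSpace.
Context {R : realType} {T : R} {d : nat} {alpha : exponent R}.

HB.instance Definition _ :=
  GRing.isSubmodClosed.Build _ _ (@holder_closure R T d alpha)
    (@holder_closure_submod R T d alpha).

End HolderSpace.

(* The space $C^{\alpha,0}([0,T];\mathbb R^d)$. *)
Record holder0 (R : realType) (T : R) (d : nat) (alpha : exponent R) := Holder0 {
  holder0_val :> time T -> 'rV[R]_d;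
  holder0_valP : holder0_val \in holder_closure T d alpha }.

Section HolderSpaceNorm.
Context {R : realType} (T : R) (d : nat) (alpha : exponent R).
Local Notation C := (holder0 T d alpha).

HB.instance Definition _ := [isSub for @holder0_val R T d alpha].
HB.instance Definition _ := gen_eqMixin C.
HB.instance Definition _ := gen_choiceMixin C.
HB.instance Definition _ := [SubChoice_isSubLmodule of C by <:].

Definition holder0_norm (x : C) : R := fine (holder_norm alpha x).

Lemma holder0_normD x y :
  holder0_norm (x + y) <= holder0_norm x + holder0_norm y.
Proof.
have fx := holder_closure_fin (holder0_valP x).
have fy := holder_closure_fin (holder0_valP y).
rewrite /holder0_norm (_ : holder0_val (x + y) = holder0_val x + holder0_val y) //.
by apply: hnorm_le (holder_normD fx fy); rewrite addr_ge0 ?hnorm_ge0.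
Qed.

Lemma holder0_normZ (k : R) x : holder0_norm (k *: x) = `|k| * holder0_norm x.
Proof.
have le (l : R) z : holder0_norm (l *: z) <= `|l| * holder0_norm z.
  have fz := holder_closure_fin (holder0_valP z).
  rewrite /holder0_norm (_ : holder0_val (l *: z) = l *: holder0_val z) //.
  by apply: hnorm_le (holder_normZ l fz); rewrite mulr_ge0 ?hnorm_ge0.
apply/eqP; rewrite eq_le le/=; have [->|k0] := eqVneq k 0.
  by rewrite normr0 mul0r; exact: hnorm_ge0.
rewrite -ler_pdivlMl ?normr_gt0// -normfV.
by rewrite -{1}(scalerK k0 x) le.
Qed.

Lemma holder0_norm_eq0 x : holder0_norm x = 0 -> x = 0.
Proof.
have xc := holder0_valP x => x0; apply: val_inj; apply: funext => t.
have xs0 : from0 (holder0_val x) by move: xc; rewrite inE => -[].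
have [t0|t0] := eqVneq (time_val t) 0; first by rewrite [LHS]xs0.
have /andP[t_ge0 tT] := time_valP t.
have T0 : 0 <= (0 : R) <= T by rewrite lexx (le_trans t_ge0).
have st : Time T0 < t :> R by rewrite lt_def t0.
apply: enorm_eq0.
have := hnormP (holder_closure_fin xc) st.
by rewrite [hnorm _ _]x0 mul0r (xs0 (Time T0)) ?subr0.
Qed.

HB.instance Definition _ := Lmodule_isNormed.Build R C
  holder0_normD holder0_normZ holder0_norm_eq0.

Lemma holder0_normE (x : C) : `|x| = fine (holder_norm alpha x).
Proof. by []. Qed.

End HolderSpaceNorm.


Section Schauder.
Context {R : realType} (T : R).

(* [(0, 0)] and the pairs [(p, m)] with [0 <= p <= N] and [1 <= m <= 2 ^ p]. *)
Definition Lambda (N : nat) : seq (nat * nat) :=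
  (0, 0)%N :: [seq (p, m) | p <- iota 0 N.+1, m <- iota 1 (2 ^ p)].

Definition dyadic_left (pm : nat * nat) : R :=
  (pm.2%:R - 1) * T / 2 ^+ pm.1.
Definition dyadic_mid (pm : nat * nat) : R :=
  (2 * pm.2%:R - 1) * T / 2 ^+ pm.1.+1.
Definition dyadic_right (pm : nat * nat) : R := pm.2%:R * T / 2 ^+ pm.1.

Definition haar (pm : nat * nat) (t : R) : R :=
  if pm == (0, 0)%N then (Num.sqrt T)^-1 else
  Num.sqrt (2 ^+ pm.1 / T) *
    (\1_(`[dyadic_left pm, dyadic_mid pm[) t -
     \1_(`[dyadic_mid pm, dyadic_right pm[) t).

Definition schauder (pm : nat * nat) (t : R) : R :=
  \int[lebesgue_measure]_(s in `[0, t]) haar pm s.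

(* The value at a real time, 0 if that time is outside [0, T]. *)
Definition at_time {d : nat} (x : trajectory T d) (t : R) : 'rV[R]_d :=
  oapp x 0 (insub t).

(* The integral of the step function [haar pm] against [dx]. *)
Definition haar_coef {d : nat} (x : trajectory T d) (pm : nat * nat) :
    'rV[R]_d :=
  if pm == (0, 0)%N then (Num.sqrt T)^-1 *: (at_time x T - at_time x 0) else
  Num.sqrt (2 ^+ pm.1 / T) *:
    ((at_time x (dyadic_mid pm) - at_time x (dyadic_left pm)) -
     (at_time x (dyadic_right pm) - at_time x (dyadic_mid pm))).

Definition schauder_sum {d : nat} (N : nat) (a : nat * nat -> 'rV[R]_d) :
    trajectory T d :=
  fun t => \sum_(pm <- Lambda N) schauder pm t *: a pm.

Lemma measurable_haar pm D : measurable D -> measurable_fun D (haar pm).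
Proof.
move=> mD; apply: measurable_funTS.
rewrite /haar; case: (pm == (0, 0)%N); first exact: measurable_cst.
by apply: measurable_funM => //; apply: measurable_funB; exact: measurable_indic.
Qed.

Definition haar_bound (pm : nat * nat) : R :=
  `|(Num.sqrt T)^-1| + `|Num.sqrt (2 ^+ pm.1 / T)| * 2.

Lemma haar_le pm s : `|haar pm s| <= haar_bound pm.
Proof.
rewrite /haar /haar_bound; case: ifP => _.
  by rewrite lerDl mulr_ge0.
rewrite normrM ler_wpDl// ler_wpM2l// (le_trans (ler_normB _ _))//.
by rewrite !indicE -[2]/(1 + 1) lerD// ger0_norm ?ler0n// lern1 leq_b1.
Qed.

Lemma integrable_haar pm (a b : itv_bound R) :
  (lebesgue_measure [set` Interval a b] < +oo)%E ->
  lebesgue_measure.-integrable [set` Interval a b] (EFin \o haar pm).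
Proof.
move=> fin; apply: measurable_bounded_integrable => //.
- exact: measurable_haar.
- exists (haar_bound pm); split; first by rewrite num_real.
  by move=> y /ltW yb s _; exact: le_trans (haar_le pm s) yb.
Qed.

Lemma schauder_lip pm (s t : R) : 0 <= s -> s < t ->
  `|schauder pm t - schauder pm s| <= haar_bound pm * (t - s).
Proof.
move=> s0 st; rewrite /schauder Rintegral_itvB ?bnd_simp ?(ltW st)//; last first.
  apply: integrable_haar; rewrite lebesgue_measure_itv/= lte_fin.
  by case: ifP; rewrite ?ltry// -EFinB ltry.
have mst : (lebesgue_measure `]s, t] = (t - s)%:E)%E.
  by rewrite lebesgue_measure_itv/= lte_fin st -EFinB.
have ih : lebesgue_measure.-integrable `]s, t] (EFin \o haar pm).
  by apply: integrable_haar; rewrite mst ltry.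
apply: le_trans (le_normr_Rintegral _ ih) _ => //.
apply: le_trans (_ : \int[lebesgue_measure]_(x in `]s, t]) haar_bound pm <= _).
  apply: le_Rintegral => //.
  - exact: integrable_norm ih.
  - apply: (@measurable_bounded_integrable _ _ _ _ (cst (haar_bound pm))) => //.
      by rewrite [X in (X < _)%E]mst ltry.
    exact: bounded_cst.
  - by move=> x _; exact: haar_le.
by rewrite Rintegral_cst// [X in fine X]mst.
Qed.

Lemma schauder0 pm : schauder pm 0 = 0.
Proof. by rewrite /schauder set_itv1 Rintegral_set1. Qed.

Lemma schauder_sum_holder {d : nat} (alpha : exponent R) N
  (a : nat * nat -> 'rV[R]_d) : schauder_sum N a \in holder_closure T d alpha.
Proof.
rewrite (_ : schauder_sum N a =
    \sum_(pm <- Lambda N) (fun t : time T => schauder pm t *: a pm)); last first.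
  by apply/funext => t; rewrite fct_sumE.
apply: rpred_sum => pm _; apply: holder_closureW.
  by move=> t t0; rewrite t0 schauder0 scale0r.
exists (((alpha : R) + 1) / 2); first by have := exponent_lt1 alpha; lra.
apply: (@holder_norm_lt _ _ _ _ 1).
  by have := exponent_lt1 alpha; lra.
apply: (@holder_norm_fin _ _ _ _ _ (haar_bound pm * enorm (a pm))) => s t st.
rewrite -scalerBl enormZ mulrAC ler_wpM2r ?enorm_ge0// powRr1 ?normr_ge0//.
rewrite /time_dist (ger0_norm (_ : 0 <= time_val t - time_val s)) ?subr_ge0 ?(ltW st)//.
by apply: schauder_lip => //; have /andP[] := time_valP s.
Qed.

End Schauder.

Definition schauder_span {R : realType} (T : R) (d : nat) (alpha : exponent R)
    (N : nat) : {pred holder0 T d alpha} :=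
  mem [set x : holder0 T d alpha | exists a, x = schauder_sum N a :> (_ -> _)].
Arguments schauder_span {R} T d alpha N.

Section SchauderSpan.
Context {R : realType} (T : R) (d : nat) (alpha : exponent R) (N : nat).

Lemma schauder_span_submod : submod_closed (schauder_span T d alpha N).
Proof.
split.
  rewrite inE; exists (fun=> 0); apply/funext => t.
  by rewrite /schauder_sum big1// => pm _; rewrite scaler0.
move=> k x y; rewrite !inE => -[a xa] [b yb].
exists (fun pm => k *: a pm + b pm); apply/funext => t.
rewrite -[LHS]/(k *: holder0_val x t + holder0_val y t) xa yb /schauder_sum.
rewrite scaler_sumr -big_split/=; apply: eq_bigr => pm _.
by rewrite scalerDr !scalerA mulrC.
Qed.

HB.instance Definition _ := GRing.isSubmodClosed.Build _ _
  (schauder_span T d alpha N) schauder_span_submod.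

End SchauderSpan.

(* The space $\mathcal H_N$, with the norm of $C^{\alpha,0}$. *)
Record schauder_space (R : realType) (T : R) (d : nat) (alpha : exponent R)
    (N : nat) := SchauderSpace {
  schauder_val :> holder0 T d alpha;
  schauder_valP : schauder_val \in schauder_span T d alpha N }.

Section SchauderSpaceNorm.
Context {R : realType} (T : R) (d : nat) (alpha : exponent R) (N : nat).
Local Notation H := (schauder_space T d alpha N).

HB.instance Definition _ := [isSub for @schauder_val R T d alpha N].
HB.instance Definition _ := gen_eqMixin H.
HB.instance Definition _ := gen_choiceMixin H.
HB.instance Definition _ := [SubChoice_isSubLmodule of H by <:].

Let norm (y : H) : R := `|schauder_val y|.

Let normD x y : norm (x + y) <= norm x + norm y.
Proof. exact: (ler_normD (schauder_val x) (schauder_val y)). Qed.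

Let normZ (k : R) x : norm (k *: x) = `|k| * norm x.
Proof. exact: (normrZ k (schauder_val x)). Qed.

Let norm_eq0 x : norm x = 0 -> x = 0.
Proof. by move=> /normr0_eq0 x0; exact: val_inj. Qed.

HB.instance Definition _ := Lmodule_isNormed.Build R H normD normZ norm_eq0.

Lemma schauder_normE (y : H) : `|y| = `|schauder_val y|.
Proof. by []. Qed.

End SchauderSpaceNorm.

Section SchauderOperators.
Context {R : realType} {T : R} {d : nat} {alpha : exponent R} {N : nat}.
Implicit Types a : nat * nat -> 'rV[R]_d.

Lemma schauder_holderP (x : trajectory T d) :
  (exists a, x = schauder_sum N a) -> x \in holder_closure T d alpha.
Proof. by move=> [a ->]; exact: schauder_sum_holder. Qed.

Lemma schauder_spanP (x : trajectory T d) (xa : exists a, x = schauder_sum N a) :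
  Holder0 (schauder_holderP xa) \in schauder_span T d alpha N.
Proof. by rewrite inE. Qed.

Definition mk_schauder (x : trajectory T d) (xa : exists a, x = schauder_sum N a) :
  schauder_space T d alpha N := SchauderSpace (schauder_spanP xa).

Lemma schauder_spaceP (y : schauder_space T d alpha N) :
  exists a, y = schauder_sum N a :> (_ -> _).
Proof. by have := schauder_valP y; rewrite inE. Qed.

Definition schauder_proj (x : holder0 T d alpha) : schauder_space T d alpha N :=
  mk_schauder (ex_intro _ (haar_coef x) erefl).

End SchauderOperators.

Section Coordinates.
Context {R : realType} {T : R} {d : nat} {alpha : exponent R} {N : nat}.

Lemma coordinate_subproof (j : 'I_d) (y : schauder_space T d alpha N) :
  exists a, (fun t => \row_(_ < 1) y t 0 j) = schauder_sum N a
    :> (_ -> _).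
Proof.
have [a ya] := schauder_spaceP y.
exists (fun pm => \row_(_ < 1) a pm 0 j); apply/funext => t.
apply/rowP => i; rewrite ya !mxE !summxE.
by apply: eq_bigr => pm _; rewrite !mxE.
Qed.

(* The scalar path $\langle y, e_j\rangle$. *)
Definition coordinate (j : 'I_d) (y : schauder_space T d alpha N) :
    schauder_space T 1 alpha N := mk_schauder (coordinate_subproof j y).

Lemma of_coordinates_subproof (y : 'I_d -> schauder_space T 1 alpha N) :
  exists a, (fun t => \row_j y j t 0 0) = schauder_sum N a :> (_ -> _).
Proof.
have [a ya] := choice (fun j => schauder_spaceP (y j)).
exists (fun pm => \row_j a j pm 0 0); apply/funext => t.
apply/rowP => j; rewrite !mxE ya !summxE.
by apply: eq_bigr => pm _; rewrite !mxE.
Qed.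

Definition of_coordinates (y : 'I_d -> schauder_space T 1 alpha N) :
    schauder_space T d alpha N := mk_schauder (of_coordinates_subproof y).

Lemma of_coordinatesK y j : coordinate j (of_coordinates y) = y j.
Proof.
apply: val_inj; apply: val_inj; apply/funext => t.
by apply/rowP => i; rewrite /= !mxE ord1.
Qed.

End Coordinates.

Section Quantization.
Context {R : realType}.

Definition borel (E : normedModType R) := g_sigma_algebraType (@open E).

Variables (E : normedModType R) (mu : set (borel E) -> \bar R) (n : nat).
Implicit Types (c : 'I_n -> E) (S : 'I_n -> set E).

Definition is_voronoi c S :=
  [/\ forall i, measurable (S i : set (borel E)),
      trivIset setT S, \bigcup_i S i = setT &
      forall i y, S i y -> forall j, `|y - c i| <= `|y - c j|].

(* [b] is the mean of [mu] conditioned on [A], as a weak integral. *)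
Definition is_barycentre (A : set E) (b : E) :=
  (0 < mu A)%E /\
  forall f : {linear E -> R^o}, continuous f ->
    (\int[mu]_(y in (A : set (borel E))) (f y)%:E = (f b)%:E * mu A)%E.

Definition is_stationary c S :=
  [/\ injective c, is_voronoi c S & forall i, is_barycentre (S i) (c i)].

Definition mean_square_error c : \bar R :=
  (\int[mu]_y \big[mine/+oo]_(i < n) (`|(y : E) - c i| ^+ 2)%:E)%E.

Definition is_mse_minimiser c :=
  forall c', (mean_square_error c <= mean_square_error c')%E.

End Quantization.

Section BrownianMotion.
Context {R : realType} {T : R} {d : nat} {alpha : exponent R}.
Local Notation C := (holder0 T d alpha).
Variable L : set (borel C) -> \bar R.

(* Under [L] the increments of the coordinate process over successive
   intervals, and their coordinates, are independent and centred Gaussian with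
   variance the length of the interval. *)
Definition is_brownian_law := forall (k : nat) (t : nat -> time T)
    (A : 'I_k -> 'I_d -> set R),
  (forall i, (i < k)%N -> t i < t i.+1 :> R) ->
  (forall i j, measurable (A i j)) ->
  L [set x : borel C | forall i j, A i j (((x : C) (t i.+1) - (x : C) (t i)) 0 j)] =
  (\prod_(i < k) \prod_(j < d)
     normal_prob 0 (Num.sqrt (time_dist (t i) (t i.+1))) (A i j))%E.

(* The law of $W^N=P_N[W]$ on $\mathcal H_N$. *)
Definition truncated_law (N : nat) :
    set (borel (schauder_space T d alpha N)) -> \bar R :=
  pushforward L (schauder_proj : borel C -> borel (schauder_space T d alpha N)).

(* The law of $\langle W^N,e_j\rangle$ on $\mathcal H^{N,(1)}$. *)
Definition coordinate_law (N : nat) (j : 'I_d) :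
    set (borel (schauder_space T 1 alpha N)) -> \bar R :=
  pushforward (@truncated_law N)
    (coordinate j : borel (schauder_space T d alpha N) ->
                   borel (schauder_space T 1 alpha N)).

End BrownianMotion.
Arguments truncated_law {R T d alpha} L N.
Arguments coordinate_law {R T d alpha} L N j.

Section ProductQuantization.
Context {R : realType} {T : R} {d : nat} {alpha : exponent R} {N n : nat}.
Implicit Types (c : 'I_n -> schauder_space T 1 alpha N)
  (S : 'I_n -> set (schauder_space T 1 alpha N)) (k : {ffun 'I_d -> 'I_n}).

Definition product_code c k : schauder_space T d alpha N :=
  of_coordinates (fun j => c (k j)).

Definition product_cell S k : set (schauder_space T d alpha N) :=
  [set y | forall j, S (k j) (coordinate j y)].

Definition is_quantization c S
    (q : holder0 T d alpha -> schauder_space T d alpha N) :=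
  forall k x, (schauder_proj @^-1` product_cell S k) x -> q x = product_code c k.

End ProductQuantization.

Section Asymptotics.
Context {R : realType}.
Implicit Types f g : nat -> \bar R.

(* In [\bar R], [x / 0 = +oo] for [x > 0]. *)
Definition lesssim f g :=
  exists C : R, 0 < C /\ (limn_esup (fun n => f n / g n) <= C%:E)%E.

Definition asymp f g := lesssim f g /\ lesssim g f.

End Asymptotics.

(* The branch $\mathcal W_{-1}$ of the inverse of $w\mapsto we^w$, for
   arguments in $[-1/e,0)$. *)
Definition lambertWm1 {R : realType} (z : R) : R :=
  xget 0 [set w : R | w <= -1 /\ w * expR w = z].

(* Main.v *)
Require Import Defs.
From mathcomp Require Import all_boot all_order all_algebra.
From mathcomp Require Import all_classical all_reals all_analysis.
From mathcomp Require Import measurable_realfun.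
From mathcomp Require Import ring lra zify.
Set Implicit Arguments.
Unset Strict Implicit.
Unset Printing Implicit Defensive.
Import Order.TTheory GRing.Theory Num.Theory.
Import numFieldNormedType.Exports.
Local Open Scope classical_set_scope.
Local Open Scope ring_scope.

(** Everything is expressed with the increments of a path [x] over dyadic
    intervals.  They control the Hölder norm (chaining), under the Brownian law
    those of one level are independent Gaussian variables, and they can be read
    on [P_N x], because [P_N] is the linear interpolation at the dyadic points
    of level [N + 1].  The error of the quantizer is at most
    [|x - P_N x|] plus the sum over the coordinates of the distance of a
    coordinate of [P_N x] to its scalar code point.

    The interpolation error only sees the levels [p > N].  On these levels the
    increments, divided by the Hölder scale of their interval, have standard
    deviation of order [decay ^ p] with [decay = 2 ^ (alpha - 1/2)], and the
    largest of the [2 ^ p] of them is of order [sqrt p * decay ^ p].  Summing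
    Gaussian moments over the levels gives [sqrt N * decay ^ N] in every
    [L^r] ([holder_tail_moment], [truncation_error]).

    For the scalar quantizer take [p0] with [2 ^ p0] comparable to [log n], so
    that [decay ^ p0] is comparable to [(log n) ^ (alpha - 1/2)].  Round the
    increments of a path on meshes such that two paths with the same rounded
    increments are at distance [O(decay ^ p0)].  Give the sequences of rounded
    increments geometric weights.  The paths whose cell is much less probable
    than its weight are rare, by summation over the cells ([rare_codes]), and
    for most paths the weight is at least [exp (- C * 2 ^ p0)], by large
    deviations ([rounded_sum_tail]).  Hence, outside a rare set, the ball of
    radius [O(decay ^ p0)] about a path has probability at least
    [exp (- 320 * 2 ^ p0)] ([small_ball]).

    Optimality of the code now bounds the distance [rho] of such a path [y] to
    the code.  Some code point can be given up at a cost [O(1 / n)] in the mean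
    square error, and putting [y] in its place gains at least
    [rho ^ 2 / 2] times the probability of the ball of radius [rho / 4] about
    [y] ([distortion_swap]).  As [n >= exp (640 * 2 ^ p0)], this forces
    [rho = O(decay ^ p0)] ([quantization_event]).  The scalar code is built for
    one coordinate, but all coordinates have the same law
    ([coordinate_law_eq]).  On the rare set the distance is at most a multiple
    of [1 + |x|], which has all moments; as the probability of this set is
    smaller than any power of [decay ^ p0] ([failure_decay]), it does not
    matter, whatever the exponent [r] ([quantization_error]).

    The assumption on [N] says that [sqrt N * decay ^ N] is of the order of
    [(log n) ^ (alpha - 1/2)].  It bounds the interpolation error, and it
    also yields [N + 1 <= 2 * p0], so that the levels to be rounded are not too
    many. *)

(** * Dyadic increments control the Hölder norm *)

Lemma exp_small (R : realType) (b e : R) : 0 <= b < 1 -> 0 < e ->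
  exists q, b ^+ q < e.
Proof.
move=> /andP[b0 b1] e0.
have : b ^+ n @[n --> \oo] --> (0 : R) by apply: cvg_expr; rewrite ger0_norm.
move=> /cvgrPdist_lt /(_ _ e0) [q _ /(_ q)] /=.
by rewrite leqnn sub0r normrN ger0_norm ?exprn_ge0// => /(_ isT); exists q.
Qed.

Lemma mul_le_half (R : realType) (M e b : R) : 0 <= M -> 0 < e ->
  b <= e / (2 * (M + 1)) -> M * b <= e / 2.
Proof.
move=> M0 e0 be; apply: (le_trans (ler_wpM2l M0 be)).
rewrite mulrA ler_pdivrMr; first by nra.
by rewrite mulr_gt0// ltr_wpDl.
Qed.

Lemma eq_or_succ i j : (i < j.+1)%N -> (j < i.+2)%N -> (j == i) || (j == i.+1).
Proof. lia. Qed.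

Lemma three_term_bound (R : realType) (e g B u v w : R) :
  w <= B -> u <= e / 2 + B * g -> v <= e / 2 + B * g ->
  u + (w + v) <= B * (1 + 2 * g) + e.
Proof. lra. Qed.

Section Dyadic.
Context {R : realType} (T : R).
Hypothesis T_gt0 : 0 < T.

Definition dyadic_point (p i : nat) : R := i%:R * T / 2 ^+ p.

Local Notation dyad := dyadic_point.

Definition dyadic_inc {d} (x : trajectory T d) (p i : nat) : 'rV[R]_d :=
  at_time x (dyad p i.+1) - at_time x (dyad p i).

Lemma dyad_itv p i : (i <= 2 ^ p)%N -> 0 <= dyad p i <= T.
Proof.
move=> ip; rewrite /dyadic_point divr_ge0 ?mulr_ge0 ?(ltW T_gt0) ?exprn_ge0//=.
rewrite ler_pdivrMr ?exprn_gt0// mulrC ler_wpM2l ?(ltW T_gt0)//.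
by rewrite -natrX ler_nat.
Qed.

Lemma dyad_double p i : dyad p.+1 i.*2 = dyad p i.
Proof.
by rewrite /dyadic_point -muln2 natrM exprS; field; rewrite expf_neq0.
Qed.

Lemma dyad0 p : dyad p 0 = 0. Proof. by rewrite /dyadic_point !mul0r. Qed.

Lemma dyadD p i : dyad p i.+1 = dyad p i + T / 2 ^+ p.
Proof. by rewrite /dyadic_point -natr1 !mulrDl mul1r. Qed.

Lemma dyad_lt p i : dyad p i < dyad p i.+1.
Proof. by rewrite dyadD ltrDl divr_gt0// exprn_gt0. Qed.

Lemma at_timeE d (x : trajectory T d) (t : time T) : at_time x t = x t.
Proof. by rewrite /at_time valK. Qed.

(** The number of the dyadic interval of level [p] that contains [t]. *)
Definition dyadic_index (p : nat) (t : R) : nat := Num.truncn (t / T * 2 ^+ p).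

Lemma dyadic_index_itv p t : 0 <= t -> (dyadic_index p t)%:R <= t / T * 2 ^+ p < (dyadic_index p t).+1%:R.
Proof.
by move=> t0; apply/truncn_itv; rewrite mulr_ge0 ?divr_ge0 ?exprn_ge0// ltW.
Qed.

Lemma dyadic_index_le p t : 0 <= t <= T -> (dyadic_index p t <= 2 ^ p)%N.
Proof.
move=> /andP[t0 tT]; have /andP[it _] := dyadic_index_itv p t0.
rewrite -(ler_nat R) (le_trans it)// natrX ler_piMl ?exprn_ge0//.
by rewrite ler_pdivrMr// mul1r.
Qed.

Lemma dyadic_indexS p t : 0 <= t ->
  dyadic_index p.+1 t = (dyadic_index p t).*2 \/ dyadic_index p.+1 t = (dyadic_index p t).*2.+1.
Proof.
move=> t0; have /andP[a1 a2] := dyadic_index_itv p t0.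
have /andP[b1 b2] := dyadic_index_itv p.+1 t0.
have h1 : ((dyadic_index p t).*2 < (dyadic_index p.+1 t).+1)%N.
  rewrite -(ltr_nat R); apply: le_lt_trans b2.
  by rewrite -muln2 natrM exprS; lra.
have h2 : (dyadic_index p.+1 t < (dyadic_index p t).+1.*2)%N.
  rewrite -(ltr_nat R); apply: (le_lt_trans b1).
  by rewrite -muln2 natrM exprS; lra.
by rewrite -addnn in h1 h2 *; lia.
Qed.

Lemma dyad_idx p t : 0 <= t -> dyad p (dyadic_index p t) <= t < dyad p (dyadic_index p t).+1.
Proof.
move=> t0; have /andP[a1 a2] := dyadic_index_itv p t0.
have e : t = t / T * 2 ^+ p * T / 2 ^+ p.
  by field; rewrite expf_neq0 ?pnatr_eq0// gt_eqF.
rewrite /dyadic_point {2 3}e ler_pM2r ?invr_gt0 ?exprn_gt0// ler_pM2r//.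
by rewrite ltr_pM2r ?invr_gt0 ?exprn_gt0// ltr_pM2r// a1 a2.
Qed.

Section Chaining.
Context {d : nat} {alpha : exponent R}.
Local Notation a := (exponent_val alpha).

(** The factor by which the Hölder scale of a dyadic interval, the power [alpha]
    of its length, changes from one level to the next. *)
Definition ratio : R := 2 `^ (- a).

Lemma ratio_itv : 0 < ratio < 1.
Proof.
have /andP[a0 _] := exponent_valP alpha.
rewrite powR_gt0//= /ratio powRN invf_lt1 ?powR_gt0//.
have := @gt0_ltr_powR R a a0 1 2; rewrite powR1; apply; rewrite ?nnegrE//.
exact: ltr1n.
Qed.

Lemma ratioX p : ratio ^+ p = (2 ^- p) `^ a.
Proof.
rewrite /ratio -(powR_invn p (ler0n R 2)) -[LHS]powR_mulrn; last exact: powR_ge0.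
by rewrite -!powRrM mulrC mulrN mulNr.
Qed.

Variables (x : holder0 T d alpha) (K : R).
Hypotheses (K_ge0 : 0 <= K) (incK : forall p i, (i < 2 ^ p)%N ->
  enorm (dyadic_inc x p i) <= K * ratio ^+ p).

Let g := ratio / (1 - ratio).

(** From one level to the next the dyadic approximation of [t] from below either
    stays or moves by one interval of the finer level, so the displacements of
    [x] are dominated by a geometric series. *)
Lemma approx_step p q t : 0 <= t <= T -> (p <= q)%N ->
  enorm (at_time x (dyad q (dyadic_index q t)) - at_time x (dyad p (dyadic_index p t)))
    <= K * (ratio ^+ p - ratio ^+ q) * g.
Proof.
move=> /[dup] tT /andP[t0 _] pq; have /andP[r0 r1] := ratio_itv.
rewrite -(subnK pq); elim: (q - p)%N => [|k IH].
  by rewrite add0n !subrr mulr0 mul0r enorm0.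
rewrite addSn; set m := (k + p)%N in IH *.
rewrite -(subrKA (at_time x (dyad m (dyadic_index m t)))).
apply: (le_trans (enormD _ _)).
have E : K * (ratio ^+ p - ratio ^+ m.+1) * g =
    K * ratio ^+ m.+1 + K * (ratio ^+ p - ratio ^+ m) * g.
  rewrite exprS /g; field; lra.
rewrite E lerD//.
have [e|e] := dyadic_indexS m t0; rewrite e.
  by rewrite dyad_double subrr enorm0 mulr_ge0// exprn_ge0// ltW.
rewrite -[dyad m _]dyad_double; apply: incK.
by have := dyadic_index_le m.+1 tT; rewrite e.
Qed.

(** The crude bound from the finiteness of the norm of [x]: it makes the dyadic
    approximations converge, and disappears in the limit. *)
Lemma approx_time q (t : time T) :
  enorm (x t - at_time x (dyad q (dyadic_index q t))) <= `|x| * (T `^ a * ratio ^+ q).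
Proof.
have /andP[a0 _] := exponent_valP alpha; have tT := time_valP t; have /andP[t0 _] := tT.
have /andP[it ti] := dyad_idx q t0; have dT := dyad_itv (dyadic_index_le q tT).
have [e|ne] := eqVneq (dyad q (dyadic_index q t)) (t : R).
  rewrite e at_timeE subrr enorm0 mulr_ge0 ?normr_ge0// mulr_ge0 ?powR_ge0//.
  by rewrite exprn_ge0 ?powR_ge0.
have lt : Time dT < t :> R by rewrite /= lt_neqAle ne it.
rewrite -[dyad q _]/(time_val (Time dT)) at_timeE.
apply: (le_trans (hnormP (holder_closure_fin (holder0_valP x)) lt)).
rewrite -[hnorm _ _]/`|x| ler_wpM2l ?normr_ge0//.
rewrite ratioX -powRM ?(ltW T_gt0)//.
rewrite ge0_ler_powR ?nnegrE ?normr_ge0 ?(ltW a0)//.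
  by rewrite divr_ge0 ?exprn_ge0// ltW.
rewrite /time_dist ger0_norm ?subr_ge0 ?(ltW lt)//= lerBlDr ltW//.
by rewrite addrC -dyadD.
Qed.

Lemma dyadic_scale (y : R) : 0 < y <= 1 ->
  exists2 p, y <= 2 ^- p & 2 ^- p.+1 < y.
Proof.
move=> /andP[y0 y1].
have ex : exists p, 2 ^- p.+1 < y.
  have [|q qy] := @exp_small R 2^-1 y _ y0; first lra.
  exists q; rewrite -exprVn; apply: le_lt_trans qy; rewrite exprS.
  by rewrite ler_piMl ?exprn_ge0//; lra.
exists (ex_minn ex); case: ex_minnP => // -[|m] my min; first by rewrite expr0 invr1.
by rewrite leNgt; apply/negP => /min; rewrite ltnn.
Qed.

Definition chaining_const : R := (1 + 2 * (ratio / (1 - ratio))) / (ratio * T `^ a).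

Lemma chaining_const_gt0 : 0 < chaining_const.
Proof.
have /andP[r0 r1] := ratio_itv.
rewrite divr_gt0 ?mulr_gt0 ?powR_gt0// ltr_wpDr// mulr_ge0// divr_ge0 ?ltW//.
by rewrite subr_gt0.
Qed.

(** On the level whose intervals are comparable to [t - s] the dyadic
    approximations of [s] and [t] coincide or are neighbours; from there each
    of the two times is reached through finer and finer approximations. *)
Lemma chaining : `|x| <= chaining_const * K.
Proof.
have /andP[r0 r1] := ratio_itv.
have g0 : 0 <= g by rewrite divr_ge0 ?subr_ge0 ?ltW.
have /andP[a0 _] := exponent_valP alpha.
apply: hnorm_le.
  by rewrite mulr_ge0// ltW// chaining_const_gt0.
apply/holder_norm_leP => s t st.
have sT := time_valP s; have /andP[s0 _] := sT.
have tT := time_valP t; have /andP[t0 tT'] := tT.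
have [|p py yp] := @dyadic_scale (((t : R) - (s : R)) / T).
  by rewrite divr_gt0 ?subr_gt0//= ler_pdivrMr// mul1r lerBlDr (le_trans tT')// lerDl.
have main : enorm (x t - x s) <= K * ratio ^+ p * (1 + 2 * g).
  (* The approximation at level [m] is within [e / 2] of the path. *)
  apply/ler_addgt0Pr => e e0.
  have M0 : 0 <= `|x| * T `^ a by rewrite mulr_ge0 ?powR_ge0.
  have [||q qe] := @exp_small R ratio (e / (2 * (`|x| * T `^ a + 1))).
  - by rewrite (ltW r0) r1.
  - by rewrite divr_gt0// mulr_gt0// ltr_wpDl.
  have pq : (p <= maxn p q)%N by rewrite leq_maxl.
  have rq : ratio ^+ maxn p q <= ratio ^+ q.
    by rewrite ler_wiXn2l ?leq_maxr// ltW.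
  set m := maxn p q in pq rq.
  have fin (u : time T) : enorm (x u - at_time x (dyad p (dyadic_index p u))) <=
      e / 2 + K * ratio ^+ p * g.
    rewrite -(subrKA (at_time x (dyad m (dyadic_index m u)))).
    apply: (le_trans (enormD _ _)); apply: lerD.
      apply: (le_trans (approx_time m u)).
      rewrite mulrA; apply: le_trans (mul_le_half M0 e0 (ltW qe)).
      by rewrite ler_wpM2l.
    apply: (le_trans (approx_step (time_valP u) pq)).
    rewrite -!mulrA ler_wpM2l// ler_wpM2r//.
    by rewrite gerBl exprn_ge0// ltW.
  have mid : enorm (at_time x (dyad p (dyadic_index p t)) - at_time x (dyad p (dyadic_index p s)))
      <= K * ratio ^+ p.
    have /andP[a1 a2] := dyadic_index_itv p s0; have /andP[b1 b2] := dyadic_index_itv p t0.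
    have st' : (s : R) / T < (t : R) / T by rewrite ltr_pM2r ?invr_gt0.
    have tp0 : 0 < 2 ^+ p :> R by rewrite exprn_gt0.
    have l1 : (dyadic_index p s < (dyadic_index p t).+1)%N.
      rewrite -(ltr_nat R); apply: (le_lt_trans a1); apply: lt_trans b2.
      by rewrite ltr_pM2r.
    have l2 : (dyadic_index p t < (dyadic_index p s).+2)%N.
      rewrite -(ltr_nat R); apply: (le_lt_trans b1).
      rewrite -[(dyadic_index p s).+2]addn1 natrD.
      have : ((t : R) - (s : R)) / T * 2 ^+ p <= 1 by rewrite -ler_pdivlMr// mul1r.
      by rewrite mulrBl mulrBl; move: a2; rewrite -natr1; lra.
    have /orP[/eqP ->|/eqP e1] : (dyadic_index p t == dyadic_index p s) || (dyadic_index p t == (dyadic_index p s).+1).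
      exact: eq_or_succ.
    - by rewrite subrr enorm0 mulr_ge0// exprn_ge0// ltW.
    - rewrite e1; apply: incK; rewrite -e1; exact: dyadic_index_le tT.
  rewrite -(subrKA (at_time x (dyad p (dyadic_index p t)))) -[X in _ + X](subrKA (at_time x (dyad p (dyadic_index p s)))).
  have h1 := fin t; have h2 := fin s.
  have -> : at_time x (dyad p (dyadic_index p s)) - x s = - (1 : R) *: (x s - at_time x (dyad p (dyadic_index p s))).
    by rewrite scaleN1r opprB.
  apply: (le_trans (enormD _ _)); apply: (le_trans (lerD (lexx _) (enormD _ _))).
  rewrite enormZ normrN1 mul1r; exact: three_term_bound.
apply: (le_trans main).
have -> : time_dist s t `^ a = T `^ a * (((t : R) - (s : R)) / T) `^ a.
  rewrite -powRM ?(ltW T_gt0) ?divr_ge0 ?subr_ge0 ?(ltW st) ?(ltW T_gt0)//.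
  rewrite /time_dist ger0_norm ?subr_ge0 ?(ltW st)//; congr (_ `^ _).
  by field; rewrite gt_eqF.
rewrite /chaining_const -/g -mulrA [leRHS](_ : _ =
    K * (1 + 2 * g) * ((((t : R) - (s : R)) / T) `^ a / ratio)); last first.
  by field; rewrite !gt_eqF ?powR_gt0.
rewrite [leLHS](_ : _ = K * (1 + 2 * g) * ratio ^+ p); last by ring.
apply: ler_wpM2l; first by apply: mulr_ge0 => //; apply: addr_ge0 => //; exact: mulr_ge0.
rewrite ler_pdivlMr// -exprSr ratioX ge0_ler_powR ?nnegrE ?(ltW a0) ?(ltW yp)//.
by rewrite divr_ge0 ?subr_ge0 ?(ltW st) ?(ltW T_gt0).
Qed.
End Chaining.
End Dyadic.

(** * Schauder functions *)

Section Interpolation.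
Context {R : realType} (T : R).
Hypothesis T_gt0 : 0 < T.
Local Notation mu := (@lebesgue_measure R).
Local Notation dyad := (dyadic_point T).

Lemma integral_indic_prefix (a b t : R) : 0 <= a -> a <= b -> 0 <= t ->
  fine (\int[mu]_(s in `[0%R, t]) (\1_(`[a, b[) s)%:E) = Num.min t b - Num.min t a.
Proof.
move=> a0 ab t0; rewrite integral_indic//.
have [ta|at_] := ltP t a.
  rewrite (_ : _ `&` _ = set0) ?measure0 ?(min_l (ltW (lt_le_trans ta ab))) ?subrr//.
  apply/seteqP; split => // s [/=]; rewrite !in_itv/= => /andP[h1 _] /andP[_ h2].
  by have := lt_le_trans ta (le_trans h1 h2); rewrite ltxx.
have [tb|bt] := ltP t b.
  rewrite (_ : _ `&` _ = [set` `[a, t]]); last first.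
    apply/seteqP; split=> s /=; rewrite !in_itv/=.
      by move=> [/andP[-> _] /andP[_ ->]].
    move=> /andP[h1 h2]; rewrite h1 h2 (le_trans a0 h1); split=> //=.
    exact: le_lt_trans tb.
  rewrite [X in fine X]lebesgue_measure_itv/= lte_fin; move: at_; rewrite le_eqVlt.
  by case/orP => [/eqP ->|->]; rewrite ?ltxx ?subrr// -EFinB.
rewrite (_ : _ `&` _ = [set` `[a, b[]); last first.
  apply/seteqP; split=> s /=; rewrite !in_itv/=; first by case.
  move=> /[dup] h /andP[h1 h2]; rewrite h (le_trans a0 h1); split=> //=.
  exact: le_trans (ltW h2) bt.
rewrite [X in fine X]lebesgue_measure_itv/= lte_fin; move: ab; rewrite le_eqVlt.
by case/orP => [/eqP ->|->]; rewrite ?ltxx ?subrr// -EFinB.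
Qed.

Lemma schauder00 t : 0 <= t -> schauder T (0, 0)%N t = (Num.sqrt T)^-1 * t.
Proof.
move=> t0; rewrite /schauder /haar eqxx Rintegral_cst//.
rewrite [X in fine X]lebesgue_measure_itv/= lte_fin.
case: ltP => [_|h]; first by rewrite sube0.
by rewrite (_ : t = 0) ?mulr0//; apply/eqP; rewrite eq_le h.
Qed.

(** The primitive of the indicator of [a <= t < b] is the clipped ramp
    [min t b - min t a]; a Schauder function is the difference of two of them. *)
Lemma schauder_tent p i t : 0 <= t ->
  schauder T (p, i.+1) t = Num.sqrt (2 ^+ p / T) *
    ((Num.min t (dyad p.+1 i.*2.+1) - Num.min t (dyad p i)) -
     (Num.min t (dyad p i.+1) - Num.min t (dyad p.+1 i.*2.+1))).
Proof.
move=> t0.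
have eL : dyadic_left T (p, i.+1) = dyad p i.
  by rewrite /dyadic_left /dyadic_point/= -natr1 addrK.
have eM : dyadic_mid T (p, i.+1) = dyad p.+1 i.*2.+1.
  rewrite /dyadic_mid /dyadic_point/= -[in RHS]natr1 -muln2 natrM -[i.+1%:R]natr1.
  by congr (_ * _ / _); ring.
have eR : dyadic_right T (p, i.+1) = dyad p i.+1 by [].
have lm : dyad p i <= dyad p.+1 i.*2.+1 by rewrite -dyad_double// ltW// dyad_lt.
have mr : dyad p.+1 i.*2.+1 <= dyad p i.+1.
  by rewrite -(dyad_double T p i.+1) doubleS ltW// dyad_lt.
have l0 : 0 <= dyad p i by rewrite divr_ge0 ?mulr_ge0 ?(ltW T_gt0) ?exprn_ge0.
rewrite /schauder /haar xpair_eqE/= andbF eL eM eR.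
have ii (a b : R) : mu.-integrable `[0, t] (EFin \o (\1_(`[a, b[) : R -> R)).
  apply: measurable_bounded_integrable => //.
    by rewrite [X in (X < _)%E]lebesgue_measure_itv/= lte_fin; case: ifP; rewrite ?ltry// -EFinB ltry.
  exists 1; split; first by rewrite num_real.
  move=> y /ltW yb s _; apply: le_trans yb; rewrite indicE ger0_norm ?ler0n//.
  by rewrite lern1 leq_b1.
rewrite RintegralZl//; last first.
  rewrite (_ : EFin \o _ = (EFin \o (\1_(`[dyad p i, dyad p.+1 i.*2.+1[) : R -> R)) \-
    (EFin \o (\1_(`[dyad p.+1 i.*2.+1, dyad p i.+1[) : R -> R)))%E; first exact: integrableB.
  by apply/funext => s /=; rewrite EFinB.
rewrite RintegralB//; congr (_ * (_ - _)); rewrite /Rintegral integral_indic_prefix//.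
exact: le_trans lm.
Qed.

End Interpolation.

(** * Schauder partial sums are dyadic interpolations *)

Lemma sum_double (V : zmodType) (m n : nat) (G : nat -> V) : m = n.*2 ->
  \sum_(l < m) G l = \sum_(i < n) (G i.*2 + G i.*2.+1).
Proof.
move=> ->; elim: n => [|n IH]; first by rewrite !big_ord0.
by rewrite doubleS !big_ord_recr/= IH addrA.
Qed.

Section Projection.
Context {R : realType} (T : R).
Hypothesis T_gt0 : 0 < T.
Local Notation dyad := (dyadic_point T).

Lemma sum_Lambda (V : zmodType) N (F : nat * nat -> V) :
  \sum_(pm <- Lambda N) F pm =
  F (0, 0)%N + \sum_(p < N.+1) \sum_(i < 2 ^ p) F (p : nat, i.+1).
Proof.
rewrite big_cons big_allpairs_dep; congr (_ + _).
rewrite -[iota 0 _]/(index_iota 0 N.+1) big_mkord; apply: eq_bigr => p _.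
have -> : iota 1 (2 ^ p) = index_iota 1 (2 ^ p).+1 by rewrite /index_iota subSS subn0.
by rewrite big_add1 big_mkord.
Qed.

(** The linear interpolation of [x] at the dyadic points of level [p], as a sum of
    clipped ramps: no case distinction on the interval of [t] is then required
    to compare two levels. *)
Definition interp {d} (p : nat) (x : trajectory T d) (t : R) : 'rV[R]_d :=
  \sum_(i < 2 ^ p) (2 ^+ p / T * (Num.min t (dyad p i.+1) - Num.min t (dyad p i)))
    *: dyadic_inc x p i.

Lemma interp0 d (x : trajectory T d) t : 0 <= t <= T ->
  interp 0 x t = schauder T (0, 0)%N t *: haar_coef x (0, 0)%N.
Proof.
move=> /andP[t0 tT]; rewrite /interp expn0 big_ord1 /dyadic_inc dyad0 /dyadic_point !mul1r.
rewrite expr0 divr1 min_l// min_r// subr0 schauder00// /haar_coef eqxx scalerA.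
congr (_ *: _); rewrite mulrAC -invfM -expr2 sqr_sqrtr ?ltW// ?div1r mulrC//.
Qed.

(** Refining the interpolation by one level moves the value at the midpoint of
    every interval, which adds a tent; the Haar coefficient is its height,
    up to the normalisation of the Haar function. *)
Lemma interpS d (x : trajectory T d) p t : 0 <= t <= T ->
  interp p.+1 x t = interp p x t +
    \sum_(i < 2 ^ p) schauder T (p, i.+1) t *: haar_coef x (p, i.+1).
Proof.
move=> /andP[t0 tT]; have e2 : (2 ^ p.+1 = (2 ^ p).*2)%N by rewrite expnS mul2n.
rewrite /interp (sum_double (fun l => (2 ^+ p.+1 / T *
  (Num.min t (dyad p.+1 l.+1) - Num.min t (dyad p.+1 l))) *: dyadic_inc x p.+1 l) e2).
rewrite -big_split/=; apply: eq_bigr => i _.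
rewrite schauder_tent// /haar_coef xpair_eqE andbF/=.
have -> : dyadic_left T (p, i.+1) = dyad p i.
  by rewrite /dyadic_left /dyadic_point/= -natr1 addrK.
have -> : dyadic_mid T (p, i.+1) = dyad p.+1 i.*2.+1.
  rewrite /dyadic_mid /dyadic_point/= -[in RHS]natr1 -muln2 natrM -[i.+1%:R]natr1.
  by congr (_ * _ / _); ring.
have -> : dyadic_right T (p, i.+1) = dyad p i.+1 by [].
rewrite /dyadic_inc -doubleS !dyad_double.
move: (Num.min t _) (Num.min t _) (Num.min t _) => A B C.
move: (at_time x _) (at_time x _) (at_time x _) => u v w.
have ss : Num.sqrt (2 ^+ p / T) * Num.sqrt (2 ^+ p / T) = 2 ^+ p / T.
  by rewrite -expr2 sqr_sqrtr// divr_ge0 ?exprn_ge0// ltW.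
apply/rowP => k; rewrite !mxE mulrACA ss exprS; ring.
Qed.

Lemma schauder_sumE d (x : trajectory T d) N (t : time T) :
  schauder_sum N (haar_coef x) t = interp N.+1 x t.
Proof.
have tT := time_valP t; rewrite /schauder_sum sum_Lambda -interp0//.
elim: N => [|N IH]; first by rewrite big_ord1 -interpS.
by rewrite big_ord_recr/= addrA IH -interpS.
Qed.

Lemma at_timeP d (x : trajectory T d) (s : R) (sT : 0 <= s <= T) :
  at_time x s = x (Time sT).
Proof. exact: (at_timeE x (Time sT)). Qed.

Lemma dyad_scale q P i : (q <= P)%N -> dyad q i = dyad P (i * 2 ^ (P - q)).
Proof.
move=> qP; have e : 2 ^+ P = 2 ^+ q * 2 ^+ (P - q) :> R by rewrite -exprD subnKC.
rewrite /dyadic_point natrM natrX e; field.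
by rewrite !expf_neq0.
Qed.

Lemma dyadic_inc_sum d (x : trajectory T d) q P i : (q <= P)%N ->
  dyadic_inc x q i = \sum_(k < 2 ^ (P - q)) dyadic_inc x P (i * 2 ^ (P - q) + k).
Proof.
move=> qP; rewrite /dyadic_inc !(dyad_scale _ qP).
rewrite (eq_bigr (fun k : 'I__ => (fun l => at_time x (dyad P (i * 2 ^ (P - q) + l))) k.+1
  - (fun l => at_time x (dyad P (i * 2 ^ (P - q) + l))) k)); last first.
  by move=> k _; rewrite addnS.
rewrite -(big_mkord xpredT (fun k => (fun l => at_time x (dyad P (i * 2 ^ (P - q) + l))) k.+1
  - (fun l => at_time x (dyad P (i * 2 ^ (P - q) + l))) k)).
by rewrite telescope_sumr// addn0 mulSn addnC.
Qed.

Lemma dyad_le q i j : (i <= j)%N -> dyad q i <= dyad q j.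
Proof.
move=> ij; rewrite /dyadic_point ler_pM2r ?invr_gt0 ?exprn_gt0// ler_pM2r//.
by rewrite ler_nat.
Qed.

(** Linearity between the dyadic points of level [P], as seen by the increments: a
    halving of the interval halves the increment. *)
Definition piecewise_linear {d} (P : nat) (y : trajectory T d) :=
  forall q i, (P <= q)%N -> (i < 2 ^ q)%N ->
    dyadic_inc y q i = 2 ^- (q - P) *: dyadic_inc y P (i %/ 2 ^ (q - P)).

(** A ramp is constant outside its own interval, so only the one containing the
    small interval contributes. *)
Lemma interp_inc d (x : trajectory T d) P q i : (P <= q)%N -> (i < 2 ^ q)%N ->
  interp P x (dyad q i.+1) - interp P x (dyad q i) =
  2 ^- (q - P) *: dyadic_inc x P (i %/ 2 ^ (q - P)).
Proof.
move=> Pq iq; set h := (2 ^ (q - P))%N.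
have h0 : (0 < h)%N by rewrite expn_gt0.
have i0P : (i %/ h < 2 ^ P)%N.
  by rewrite ltn_divLR// -expnD subnKC.
rewrite /interp -sumrB (bigD1 (Ordinal i0P))//= big1 ?addr0.
  rewrite -scalerBl -mulrBr !(dyad_scale _ Pq) -/h.
  have l1 : (i %/ h * h <= i)%N by rewrite leq_trunc_div.
  have l2 : (i < (i %/ h).+1 * h)%N by rewrite ltn_ceil.
  rewrite (min_l (dyad_le _ (l2 : i.+1 <= _)%N)) (min_l (dyad_le _ (ltnW l2))).
  rewrite (min_r (dyad_le _ l1)) (min_r (dyad_le _ (leqW l1))).
  have e : 2 ^+ q = 2 ^+ P * 2 ^+ (q - P) :> R by rewrite -exprD subnKC.
  rewrite dyadD e; congr (_ *: _); field.
  by rewrite !expf_neq0//= gt_eqF.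
move=> l /eqP li; rewrite -scalerBl -mulrBr !(dyad_scale _ Pq) -/h.
have /orP[ll|ll] : (l < i %/ h)%N || (i %/ h < l)%N.
  by rewrite -neq_ltn; apply/eqP => e; apply: li; exact: val_inj.
- have r : (l.+1 * h <= i)%N by rewrite -leq_divRL.
  have r' : (l * h <= i)%N by apply: leq_trans r; rewrite leq_mul2r leqnSn orbT.
  rewrite !(min_r (dyad_le _ r)) !(min_r (dyad_le _ r')).
  rewrite !(min_r (dyad_le _ (leqW r))) !(min_r (dyad_le _ (leqW r'))).
  by rewrite subrr mulr0 scale0r.
- have r : (i.+1 <= l * h)%N by rewrite -ltn_divLR.
  have r' : (i.+1 <= l.+1 * h)%N by apply: (leq_trans r); rewrite leq_mul2r leqnSn orbT.
  rewrite !(min_l (dyad_le _ r)) !(min_l (dyad_le _ r')).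
  rewrite !(min_l (dyad_le _ (ltnW r))) !(min_l (dyad_le _ (ltnW r'))).
  by rewrite !subrr mulr0 scale0r.
Qed.

End Projection.

(** * Bounds for the dyadic interpolation *)

Section ProjectionBounds.
Context {R : realType} (T : R).
Hypothesis T_gt0 : 0 < T.
Context {alpha : exponent R}.
Local Notation a := (exponent_val alpha).
Local Notation ratio := (@ratio R alpha).
Local Notation CH := (@chaining_const R T alpha).

Lemma half_le_ratio : 2^-1 <= ratio.
Proof.
have /andP[a0 a1] := exponent_valP alpha.
have := ratioX (alpha := alpha) 1; rewrite !expr1 => ->.
rewrite -[leLHS]powRr1//; apply: ger_powR; first by rewrite invr_gt0 ltr0n/=; lra.
lra.
Qed.

Lemma dyadic_incB d (x y : trajectory T d) p i : dyadic_inc (x - y) p i = dyadic_inc x p i - dyadic_inc y p i.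
Proof.
have at_timeB t : at_time (x - y) t = at_time x t - at_time y t.
  by rewrite /at_time; case: insubP => [u _ _|_]; rewrite /= ?subr0.
by rewrite /dyadic_inc !at_timeB; apply/rowP => k; rewrite !mxE; ring.
Qed.

Lemma dyadic_inc_le d (x : holder0 T d alpha) p i : (i < 2 ^ p)%N ->
  enorm (dyadic_inc x p i) <= `|x| * T `^ a * ratio ^+ p.
Proof.
move=> ip; have tS := dyad_itv T_gt0 ip; have tI := dyad_itv T_gt0 (ltnW ip).
rewrite /dyadic_inc (at_timeP x tS) (at_timeP x tI).
have lt : Time tI < Time tS :> R by exact: dyad_lt.
apply: (le_trans (hnormP (holder_closure_fin (holder0_valP x)) lt)).
rewrite -[hnorm _ _]/`|x| -mulrA; apply: ler_wpM2l; first exact: normr_ge0.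
have i0 : 0 <= 2 ^- p :> R by rewrite invr_ge0 exprn_ge0.
rewrite ratioX -(powRM a (ltW T_gt0) i0).
rewrite /time_dist ger0_norm ?subr_ge0 ?(ltW lt)//= dyadD addrC addKr.
exact: lexx.
Qed.

(** Beyond level [P] the increments are halved from one level to the next, while
    the Hölder scale is multiplied by [ratio], which is at least [1 / 2]. *)
Lemma chaining_piecewise_linear d (y : holder0 T d alpha) P K : 0 <= K ->
  piecewise_linear P y ->
  (forall p i, (p <= P)%N -> (i < 2 ^ p)%N -> enorm (dyadic_inc y p i) <= K * ratio ^+ p) ->
  `|y| <= CH * K.
Proof.
move=> K0 yP yK; apply: chaining => // p i ip.
have [pP|/ltnW Pp] := leqP p P; first exact: yK.
rewrite yP// enormZ ger0_norm; last by rewrite invr_ge0 exprn_ge0.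
have iP : (i %/ 2 ^ (p - P) < 2 ^ P)%N.
  by rewrite ltn_divLR ?expn_gt0// -expnD subnKC.
have r0 : 0 <= ratio by have /andP[/ltW] := ratio_itv (alpha := alpha).
apply: (le_trans (ler_wpM2l _ (yK _ _ (leqnn P) iP))).
  by rewrite invr_ge0 exprn_ge0.
rewrite mulrCA; apply: ler_wpM2l => //.
rewrite -[in leRHS](subnK Pp) exprD; apply: ler_wpM2r; first exact: exprn_ge0.
by rewrite -exprVn; apply: lerXn2r; rewrite ?nnegrE// half_le_ratio.
Qed.

Lemma piecewise_linearB d (x y : trajectory T d) P :
  piecewise_linear P x -> piecewise_linear P y -> piecewise_linear P (x - y).
Proof.
move=> xP yP q i Pq iq; rewrite !dyadic_incB (xP q i)// (yP q i)//.
by rewrite [RHS]scalerBr.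
Qed.

Section Proj.
Context {d : nat} (N : nat).
Local Notation proj := (@schauder_proj R T d alpha N).
Implicit Types x : holder0 T d alpha.

Lemma at_time_proj x t : 0 <= t <= T -> at_time (proj x) t = interp N.+1 x t.
Proof. by move=> tT; rewrite (at_timeP _ tT)/= schauder_sumE. Qed.

Lemma proj_inc_fine x q i : (N < q)%N -> (i < 2 ^ q)%N ->
  dyadic_inc (proj x) q i = 2 ^- (q - N.+1) *: dyadic_inc x N.+1 (i %/ 2 ^ (q - N.+1)).
Proof.
move=> Nq iq; rewrite -interp_inc// /dyadic_inc !at_time_proj//.
  exact/dyad_itv/ltnW.
exact/dyad_itv.
Qed.

(** The interpolation takes the values of [x] at the points of level [N + 1], among
    which are those of all coarser levels. *)
Lemma proj_inc_coarse x q i : (q <= N.+1)%N -> (i < 2 ^ q)%N ->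
  dyadic_inc (proj x) q i = dyadic_inc x q i.
Proof.
move=> qN iq; rewrite !(dyadic_inc_sum _ _ qN); apply: eq_bigr => k _.
rewrite proj_inc_fine// ?subnn ?expr0 ?invr1 ?scale1r ?expn0 ?divn1//.
apply: (@leq_trans (i.+1 * 2 ^ (N.+1 - q))).
  by rewrite mulSn addnC ltn_add2r.
by rewrite -{2}(subnKC qN) expnD leq_mul2r iq orbT.
Qed.

Lemma proj_piecewise_linear x : piecewise_linear N.+1 (proj x).
Proof.
move=> q i Nq iq; rewrite proj_inc_fine// proj_inc_coarse//.
by rewrite ltn_divLR ?expn_gt0// -expnD subnKC.
Qed.

Lemma proj_le x : `|proj x| <= CH * T `^ a * `|x|.
Proof.
rewrite schauder_normE -mulrA (mulrC (T `^ a)).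
apply: (chaining_piecewise_linear _ (@proj_piecewise_linear x)).
  by rewrite mulr_ge0 ?powR_ge0.
by move=> p i pP ip; rewrite proj_inc_coarse// dyadic_inc_le.
Qed.

(** The increments of the interpolation on the levels beyond [N] obey the same bound
    as those of [x], since they come from level [N + 1] by halving. *)
Lemma sub_proj_le x K : 0 <= K ->
  (forall p i, (N < p)%N -> (i < 2 ^ p)%N -> enorm (dyadic_inc x p i) <= K * ratio ^+ p) ->
  `|x - proj x| <= CH * (2 * K).
Proof.
move=> K0 xK; have /andP[/ltW r0 _] := ratio_itv (alpha := alpha).
apply: chaining => //; first exact: mulr_ge0.
move=> p i ip; rewrite dyadic_incB.
have [Np|pN] := ltnP N p; last first.
  by rewrite proj_inc_coarse// ?subrr ?enorm0 ?mulr_ge0 ?exprn_ge0// ltnW.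
have -> : dyadic_inc x p i - dyadic_inc (proj x) p i = dyadic_inc x p i + (- 1) *: dyadic_inc (proj x) p i.
  by rewrite scaleN1r.
apply: (le_trans (enormD _ _)); rewrite enormZ normrN1 mul1r.
rewrite (mulrC 2) mulr2n mulrDr mulrDl mulr1; apply: lerD; first exact: xK.
rewrite proj_inc_fine// enormZ ger0_norm; last by rewrite invr_ge0 exprn_ge0.
have iP : (i %/ 2 ^ (p - N.+1) < 2 ^ N.+1)%N.
  by rewrite ltn_divLR ?expn_gt0// -expnD subnKC.
apply: (le_trans (ler_wpM2l _ (xK _ _ (ltnSn N) iP))).
  by rewrite invr_ge0 exprn_ge0.
rewrite mulrCA; apply: ler_wpM2l => //.
rewrite -[in leRHS](subnK Np) exprD; apply: ler_wpM2r; first exact: exprn_ge0.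
by rewrite -exprVn; apply: lerXn2r; rewrite ?nnegrE// half_le_ratio.
Qed.

Lemma projB x y : proj (x - y) = proj x - proj y.
Proof.
apply: val_inj; apply: val_inj; apply/funext => t.
rewrite -[RHS]/((proj x : trajectory T d) t - (proj y : trajectory T d) t) /=.
rewrite !schauder_sumE// /interp -sumrB; apply: eq_bigr => i _.
by rewrite -scalerBr dyadic_incB.
Qed.

Definition coord_proj (j : 'I_d) x : schauder_space T 1 alpha N :=
  coordinate j (proj x).

Lemma inc_coordinate j (y : schauder_space T d alpha N) p i : (i < 2 ^ p)%N ->
  dyadic_inc (coordinate j y) p i = \row_(_ < 1) dyadic_inc y p i 0 j.
Proof.
move=> ip; have tS := dyad_itv T_gt0 ip; have tI := dyad_itv T_gt0 (ltnW ip).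
rewrite /dyadic_inc (at_timeP _ tS) (at_timeP _ tI) (at_timeP y tS) (at_timeP y tI).
by apply/rowP => k; rewrite !mxE.
Qed.

End Proj.
End ProjectionBounds.

(** * Coordinates and Borel measurability *)

Section Euclid.
Context {R : realType}.

Lemma coord_le_enorm d (u : 'rV[R]_d) j : `|u 0 j| <= enorm u.
Proof.
rewrite -ler_sqr ?nnegrE ?enorm_ge0// enormE real_normK ?num_real//.
by rewrite (bigD1 j)//= lerDl sumr_ge0// => i _; exact: sqr_ge0.
Qed.

Lemma enorm_le_sum d (u : 'rV[R]_d) : enorm u <= \sum_j `|u 0 j|.
Proof.
have s0 (P : pred 'I_d) : 0 <= \sum_(j | P j) `|u 0 j| by apply: sumr_ge0.
rewrite -ler_sqr ?nnegrE ?enorm_ge0// enormE.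
rewrite expr2 mulr_suml; apply: ler_sum => j _.
rewrite -real_normK ?num_real// expr2 ler_wpM2l//.
by rewrite (bigD1 j)//= lerDl.
Qed.

Lemma enorm1 (u : 'rV[R]_1) : enorm u = `|u 0 0|.
Proof. by rewrite /enorm big_ord1 sqrtr_sqr. Qed.

Lemma row1B (u v : R) : ((\row_(_ < 1) u) - (\row_(_ < 1) v)) 0 0 = u - v.
Proof. by rewrite !mxE. Qed.

End Euclid.

Section Borel.
Context {R : realType}.

Lemma continuous_borel (E F : normedModType R) (f : E -> F) :
  continuous f -> measurable_fun setT (f : borel E -> borel F).
Proof.
move=> cf; apply: (@measurability _ _ (borel E) (borel F) setT f (@open F)) => //.
move=> _ [B oB <-]; rewrite setTI; apply: sub_sigma_algebra.
exact: (@open_comp _ _ f B (fun x _ => cf x)).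
Qed.

Lemma continuous_borel_real (E : normedModType R) (f : E -> R) :
  continuous f -> measurable_fun setT (f : borel E -> R).
Proof.
move=> cf; apply: (measurability _ (RGenOInfty.measurableE R)) => //.
move=> _ [_ [y ->] <-]; rewrite setTI; apply: sub_sigma_algebra.
by apply: open_comp => // x _; exact: cf.
Qed.

Lemma lipschitz_continuous (E F : normedModType R) (f : E -> F) (M : R) :
  (forall x y, `|f x - f y| <= M * `|x - y|) -> continuous f.
Proof.
move=> fM x; apply/cvgrPdist_lt => e e0.
have M1 : 0 < `|M| + 1 by rewrite ltr_wpDl.
near=> y.
apply: (le_lt_trans (fM x y)); apply: (@le_lt_trans _ _ ((`|M| + 1) * `|x - y|)).
  by apply: ler_wpM2r => //; rewrite ler_wpDr// ler_norm.
rewrite mulrC -ltr_pdivlMr//; near: y.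
by apply: cvgr_dist_lt => //; rewrite divr_gt0.
Unshelve. all: by end_near. Qed.

End Borel.

Section Coordinates.
Context {R : realType} (T : R).
Hypothesis T_gt0 : 0 < T.
Context {alpha : exponent R} {d : nat} (N : nat).
Local Notation a := (exponent_val alpha).
Local Notation ratio := (@ratio R alpha).
Local Notation CH := (@chaining_const R T alpha).
Local Notation proj := (@schauder_proj R T d alpha N).
Local Notation cproj := (@coord_proj R T alpha d N).
Implicit Types x y : holder0 T d alpha.

Lemma coord_proj_inc j x p i : (p <= N.+1)%N -> (i < 2 ^ p)%N ->
  dyadic_inc (cproj j x) p i = \row_(_ < 1) dyadic_inc x p i 0 j.
Proof.
by move=> pN ip; rewrite inc_coordinate// proj_inc_coarse.
Qed.

Lemma coord_proj_piecewise_linear j x : piecewise_linear N.+1 (cproj j x).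
Proof.
move=> q i Nq iq.
have iP : (i %/ 2 ^ (q - N.+1) < 2 ^ N.+1)%N.
  by rewrite ltn_divLR ?expn_gt0// -expnD subnKC.
rewrite !inc_coordinate// proj_piecewise_linear//.
by apply/rowP => k; rewrite !mxE.
Qed.

(** The coordinates of the two paths may differ, since code points made for one
    coordinate are used for all of them. *)
Lemma coord_proj_sub_le j j' x x' K : 0 <= K ->
  (forall p i, (p <= N.+1)%N -> (i < 2 ^ p)%N ->
    `|dyadic_inc x p i 0 j - dyadic_inc x' p i 0 j'| <= K * ratio ^+ p) ->
  `|cproj j x - cproj j' x'| <= CH * K.
Proof.
move=> K0 xK; rewrite schauder_normE.
apply: (chaining_piecewise_linear T_gt0 (P := N.+1)) => //.
  exact: (piecewise_linearB (@coord_proj_piecewise_linear j x)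
           (@coord_proj_piecewise_linear j' x')).
move=> p i pN ip; rewrite dyadic_incB !coord_proj_inc// enorm1 row1B.
exact: xK.
Qed.

Lemma coord_projB j x y : cproj j (x - y) = cproj j x - cproj j y.
Proof.
rewrite /coord_proj projB//; apply: val_inj; apply: val_inj; apply/funext => t.
apply/rowP => k; rewrite ord1 [RHS](_ : _ = ((cproj j x : trajectory T 1) t -
  (cproj j y : trajectory T 1) t) 0 0) // row1B.
rewrite [LHS]mxE (_ : (proj x - proj y : trajectory T d) t =
  (proj x : trajectory T d) t - (proj y : trajectory T d) t)//.
by rewrite [LHS]mxE [X in _ + X]mxE.
Qed.

Lemma coord_proj_le j x : `|cproj j x| <= CH * T `^ a * `|x|.
Proof.
rewrite -[cproj j x]subr0.
have <- : cproj j 0 = 0 by rewrite -{1}(subrr x) coord_projB subrr.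
rewrite -mulrA (mulrC (T `^ a)).
apply: coord_proj_sub_le; first by rewrite mulr_ge0 ?powR_ge0.
move=> p i pN ip.
have -> : dyadic_inc x p i 0 j - dyadic_inc (0 : holder0 T d alpha) p i 0 j = dyadic_inc x p i 0 j.
  have z : dyadic_inc (0 : holder0 T d alpha) p i = 0.
    by have := dyadic_incB x x p i; rewrite [X in _ = X]subrr; apply: etrans; rewrite subrr.
  by rewrite z [X in _ - X]mxE subr0.
exact: le_trans (coord_le_enorm _ _) (dyadic_inc_le T_gt0 _ ip).
Qed.

Lemma coord_proj_continuous j : continuous (cproj j).
Proof.
apply: (@lipschitz_continuous _ _ _ _ (CH * T `^ a)) => x y.
by rewrite -coord_projB coord_proj_le.
Qed.

Lemma of_coordinates_dist (y : schauder_space T d alpha N)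
    (z : 'I_d -> schauder_space T 1 alpha N) :
  `|y - of_coordinates z| <= \sum_j `|coordinate j y - z j|.
Proof.
rewrite schauder_normE; apply: hnorm_le; first by apply: sumr_ge0 => j _.
apply/holder_norm_leP => s t st; apply: (le_trans (enorm_le_sum _)).
rewrite mulr_suml; apply: ler_sum => j _.
have := hnormP (holder_closure_fin (holder0_valP (coordinate j y - z j))) st.
rewrite -[hnorm _ _]/`|coordinate j y - z j| enorm1; apply: le_trans.
rewrite le_eqVlt; apply/orP; left; apply/eqP; congr `|_|.
set w := coordinate j y - z j.
rewrite -[w : trajectory T 1]/((coordinate j y : trajectory T 1) - (z j : trajectory T 1)).
rewrite -[y - of_coordinates z : trajectory T d]/((y : trajectory T d) - (of_coordinates z : trajectory T d)).
by rewrite !mxE.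
Qed.

End Coordinates.

(** * Increments of Brownian motion *)

(** Half of the exponent of the Gaussian density is cancelled, which doubles the
    variance. *)
Lemma normal_pdf_tilt (R : realType) (s y : R) : 0 < s ->
  expR (y ^+ 2 / (4 * s ^+ 2)) * normal_pdf 0 s y =
  Num.sqrt 2 * normal_pdf 0 (Num.sqrt 2 * s) y.
Proof.
move=> s0; have q0 : 0 < Num.sqrt 2 :> R by rewrite sqrtr_gt0.
rewrite !normal_pdfE; last 2 first.
- by rewrite mulf_neq0// gt_eqF.
- by rewrite gt_eqF.
rewrite /normal_fun !subr0 /normal_peak exprMn sqr_sqrtr//.
have -> : 2 * s ^+ 2 * pi *+ 2 = 2 * (s ^+ 2 * pi *+ 2) by rewrite -mulrA mulrnAr.
rewrite sqrtrM// (invfM (Num.sqrt 2)) mulrCA -expRD.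
transitivity (Num.sqrt 2 / Num.sqrt 2 * ((Num.sqrt (s ^+ 2 * pi *+ 2))^-1 *
  expR (- y ^+ 2 / (2 * s ^+ 2 *+ 2)))); last by rewrite !mulrA.
rewrite mulfV ?gt_eqF// mul1r.
by congr (_ * expR _); field; rewrite gt_eqF.
Qed.

Lemma rowB (V : zmodType) d (u v : 'rV[V]_d) j : (u - v) 0 j = u 0 j - v 0 j.
Proof. by rewrite !mxE. Qed.

(** The measure structure of a push-forward depends on the measurability of the
    map, which cannot be inferred: this constant takes it as an argument. *)
Local Notation image_measure :=
  measure_function_pushforward__canonical__measure_function_Measure.

Lemma ge0_integral_law d1 d2 (T1 : measurableType d1) (T2 : measurableType d2)
    (R : realType) (m1 : {measure set T1 -> \bar R}) (m2 : {measure set T2 -> \bar R})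
    (f : T1 -> T2) (phi : T2 -> \bar R) : measurable_fun setT f ->
  (forall A, measurable A -> m1 (f @^-1` A) = m2 A) ->
  measurable_fun setT phi -> (forall y, 0 <= phi y)%E ->
  (\int[m1]_x (phi \o f) x = \int[m2]_y phi y)%E.
Proof.
move=> mf fm mphi phi0.
have := ge0_integral_pushforward mf m1 measurableT mphi (fun y _ => phi0 y).
rewrite preimage_setT => <-.
by apply: (@eq_measure_integral _ _ _ _ m2 (image_measure m1 mf)) => A mA _; exact: fm.
Qed.

Section Gaussian.
Context {R : realType}.
Local Notation mu := (@lebesgue_measure R).
Local Open Scope ereal_scope.

Lemma integral_normal_prob (s : R) (f : R -> \bar R) : (forall y, 0 <= f y) ->
  measurable_fun setT f ->
  \int[normal_prob 0 s]_y f y = \int[mu]_y (f y * (normal_pdf 0 s y)%:E).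
Proof.
move=> f0 mf; have dom := normal_prob_dominates (0 : R) s.
rewrite -(Radon_Nikodym_SigmaFinite.change_of_variables dom)//.
have mpdf : measurable_fun setT (fun y => (normal_pdf 0 s y)%:E : \bar R).
  by apply/measurable_EFinP; exact: measurable_normal_pdf.
have mg := measurable_int _ (Radon_Nikodym_SigmaFinite.f_integrable dom).
apply: ae_eq_integral => //; try exact: emeasurable_funM.
have : ae_eq mu setT (Radon_Nikodym_SigmaFinite.f (normal_prob 0 s) mu)
    (fun y => (normal_pdf 0 s y)%:E).
  apply: integral_ae_eq => //; first exact: Radon_Nikodym_SigmaFinite.f_integrable.
  by move=> E _ mE; rewrite -Radon_Nikodym_SigmaFinite.f_integral.
by apply: filterS => y /(_ I) e _; rewrite e.
Qed.

Lemma normal_exp_moment (s : R) : (0 < s)%R ->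
  \int[normal_prob 0 s]_y (expR (y ^+ 2 / (4 * s ^+ 2)))%:E <= 2%:E.
Proof.
move=> s0; rewrite integral_normal_prob; first last.
  apply/measurable_EFinP; apply: measurableT_comp => //.
  by apply: measurable_funM => //; exact: measurable_funX.
  by move=> y; rewrite lee_fin expR_ge0.
pose s' : R := (Num.sqrt 2 * s)%R.
have -> : \int[mu]_y ((expR (y ^+ 2 / (4 * s ^+ 2)))%:E * (normal_pdf 0 s y)%:E) =
    \int[mu]_y ((Num.sqrt 2)%:E * (normal_pdf 0 s' y)%:E).
  apply: eq_integral => y _; rewrite -!EFinM; congr EFin.
  exact: normal_pdf_tilt.
rewrite ge0_integralZl//.
- rewrite integral_normal_pdf mule1 lee_fin -(@ler_sqr R) ?nnegrE//.
  by rewrite sqr_sqrtr// expr2 -natrM ler_nat.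
- by apply/measurable_EFinP; exact: measurable_normal_pdf.
- by move=> y _; rewrite lee_fin normal_pdf_ge0.
Qed.

End Gaussian.

Section BrownianIncrements.
Context {R : realType} {T : R} {d : nat} {alpha : exponent R}.
Hypothesis T_gt0 : 0 < T.
Local Notation dyad := (dyadic_point T).
Local Notation C := (holder0 T d alpha).
Variable L : probability (borel C) R.
Hypothesis hL : is_brownian_law L.

Definition coordinate_inc (j : 'I_d) p i (x : C) : R := dyadic_inc x p i 0 j.

Definition increment_std p : R := Num.sqrt (T / 2 ^+ p).

Lemma increment_std_gt0 p : 0 < increment_std p.
Proof. by rewrite sqrtr_gt0 divr_gt0 ?exprn_gt0. Qed.

(** The intervals of level [p] are successive, so this is the product law of the
    Brownian increments with no condition on the other coordinates. *)
Lemma box_law p (j : 'I_d) (A : 'I_(2 ^ p) -> set R) : (forall i, measurable (A i)) ->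
  L [set x : borel C | forall i, A i (coordinate_inc j p i x)] =
  (\prod_(i < 2 ^ p) normal_prob 0 (increment_std p) (A i))%E.
Proof.
move=> mA; have T00 : 0 <= (0 : R) <= T by rewrite lexx ltW.
pose t i : time T := insubd (Time T00) (dyad p i).
have tE i : (i <= 2 ^ p)%N -> time_val (t i) = dyad p i.
  by move=> ip; rewrite -[time_val _]/(val _) insubdK// -topredE/= dyad_itv.
pose B (i : 'I_(2 ^ p)) (j' : 'I_d) := if j' == j then A i else setT.
have tlt i : (i < 2 ^ p)%N -> t i < t i.+1 :> R.
  by move=> ip; rewrite !tE ?dyad_lt// ltnW.
have mB i j' : measurable (B i j') by rewrite /B; case: ifP.
have := hL tlt mB; congr (L _ = _).
- have tP i (ip : (i <= 2 ^ p)%N) x : at_time x (dyad p i) = x (t i) :> 'rV[R]_d.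
    by rewrite -tE// at_timeE.
  apply/seteqP; split=> x /= xA => [i|i j'].
    by move: (xA i j); rewrite /B eqxx /coordinate_inc /dyadic_inc !tP// ltnW.
  rewrite /B; case: eqP => // ->.
  by move: (xA i); rewrite /coordinate_inc /dyadic_inc !tP// ltnW.
- apply: eq_bigr => i _; rewrite (bigD1 j)//= big1 ?mule1.
    have -> : time_dist (t i) (t i.+1) = T / 2 ^+ p.
      rewrite /time_dist (tE i.+1)// (tE i (ltnW _))// dyadD addrC addKr.
      by rewrite ger0_norm// divr_ge0 ?exprn_ge0// ltW.
    by rewrite /B eqxx.
  by move=> j' /negPf jj'; rewrite /B jj' probability_setT.
Qed.

Lemma measurable_coordinate_inc p i (j : 'I_d) : (i < 2 ^ p)%N ->
  measurable_fun setT (coordinate_inc j p i : borel C -> R).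
Proof.
move=> ip; apply: (continuous_borel_real (E := C)).
apply: (@lipschitz_continuous _ C R^o _ (T `^ alpha * ratio (alpha := alpha) ^+ p)).
move=> x y.
have -> : coordinate_inc j p i x - coordinate_inc j p i y = dyadic_inc (x - y) p i 0 j.
  by rewrite -rowB; congr (fun_of_matrix _ 0 j); exact/esym/dyadic_incB.
rewrite [leRHS]mulrC mulrA.
exact: le_trans (coord_le_enorm _ _) (dyadic_inc_le T_gt0 (x - y) ip).
Qed.

Lemma increment_law p i (j : 'I_d) (A : set R) : (i < 2 ^ p)%N -> measurable A ->
  L [set x : borel C | A (coordinate_inc j p i x)] = normal_prob 0 (increment_std p) A.
Proof.
move=> ip mA.
have := @box_law p j (fun k => if k == Ordinal ip then A else setT).
rewrite (bigD1 (Ordinal ip))//= big1 ?mule1; last first.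
  by move=> k /negPf ->; rewrite probability_setT.
rewrite eqxx => <-.
  congr (L _); apply/seteqP; split=> x /= xA => [k|].
    by case: eqP => // ->.
  by move: (xA (Ordinal ip)); rewrite eqxx.
by move=> k; case: ifP.
Qed.

Lemma increment_exp_moment p i (j : 'I_d) : (i < 2 ^ p)%N ->
  (\int[L]_x (expR ((coordinate_inc j p i x / increment_std p) ^+ 2 / 4))%:E <= 2%:E)%E.
Proof.
move=> ip; have s0 := increment_std_gt0 p.
pose f (y : R) := (expR (y ^+ 2 / (4 * increment_std p ^+ 2)))%:E.
have mf : measurable_fun setT f.
  apply/measurable_EFinP; apply: measurableT_comp => //.
  by apply: measurable_funM => //; exact: measurable_funX.
have f0 y : (0 <= f y)%E by rewrite lee_fin expR_ge0.
have -> : (\int[L]_x (expR ((coordinate_inc j p i x / increment_std p) ^+ 2 / 4))%:E =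
  \int[L]_x (f \o (coordinate_inc j p i : borel C -> R)) x)%E.
  apply: eq_integral => x _; rewrite /f/=; congr (expR _)%:E; field.
  by rewrite gt_eqF.
rewrite (ge0_integral_law (m2 := normal_prob 0 (increment_std p))
  (measurable_coordinate_inc j ip) _ mf f0).
  exact: normal_exp_moment.
by move=> A mA; exact: increment_law.
Qed.

(** Markov's inequality for the exponential moment. *)
Lemma normal_tail p (u : R) : 0 <= u ->
  (normal_prob 0 (increment_std p) [set y | (u * increment_std p <= `|y|)%R]
    <= (2 * expR (- u ^+ 2 / 4))%:E)%E.
Proof.
move=> u0; have s0 := increment_std_gt0 p; set s := increment_std p in s0 *.
pose f (y : R) := (expR (y ^+ 2 / (4 * s ^+ 2)))%:E.
have mf : measurable_fun setT f.
  apply/measurable_EFinP; apply: measurableT_comp => //.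
  by apply: measurable_funM => //; exact: measurable_funX.
have f0 y : (0 <= f y)%E by rewrite lee_fin expR_ge0.
set A := [set y | _]; have mA : measurable A.
  by rewrite -[A]setTI; apply: measurable_fun_le => //; exact: measurableT_comp.
have h : ((expR (u ^+ 2 / 4))%:E * normal_prob 0 s A <= 2%:E)%E.
  rewrite -integral_cst//; apply: le_trans (normal_exp_moment s0).
  apply: (@le_trans _ _ (\int[normal_prob 0 s]_(y in A) f y)%E).
    apply: ge0_le_integral => //.
    - by move=> y _; rewrite lee_fin expR_ge0.
    - exact: measurable_funTS.
    - move=> y Ay; rewrite lee_fin ler_expR.
      have -> : y ^+ 2 / (4 * s ^+ 2) = y ^+ 2 / s ^+ 2 / 4 by field; rewrite gt_eqF.
      rewrite ler_wpM2r// ler_pdivlMr ?exprn_gt0// -exprMn -[y ^+ 2]real_normK ?num_real//.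
      by rewrite ler_sqr ?nnegrE ?mulr_ge0 ?(ltW s0).
  exact: ge0_subset_integral.
have <- : ((expR (- u ^+ 2 / 4))%:E * ((expR (u ^+ 2 / 4))%:E * normal_prob 0 s A) =
    normal_prob 0 s A)%E.
  by rewrite muleA -EFinM -expRD mulNr addNr expR0 mul1e.
rewrite (mulrC 2) EFinM; exact: lee_wpmul2l.
Qed.

End BrownianIncrements.

(** * Gaussian and geometric bounds *)

Section RealBounds.
Context {R : realType}.
Implicit Types r y : R.

Lemma powR_exprn (x : R) r p : 0 <= x -> (x ^+ p) `^ r = (x `^ r) ^+ p.
Proof.
move=> x0; rewrite -(powR_mulrn p x0) -(powR_mulrn p (powR_ge0 x r)) -!powRrM.
by rewrite mulrC.
Qed.

Lemma expR1_ge2 : 2 <= expR 1 :> R.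
Proof. have := expR_ge1Dx (1 : R); lra. Qed.

Lemma expRn_ge2n n : 2 ^+ n <= expR n%:R :> R.
Proof.
rewrite -[n%:R]mulr1 expRM_natl; apply: lerXn2r; rewrite ?nnegrE ?expR_ge0//.
exact: expR1_ge2.
Qed.

Lemma powR_le_expR r : 0 < r -> exists2 k : R, 0 < k &
  forall y, 0 <= y -> y `^ r <= k * expR (y ^+ 2 / 8).
Proof.
move=> r0; pose n := Num.truncn r.
have rn : r < n.+1%:R by have /andP[] := truncn_itv (ltW r0).
pose f : R := 8 ^+ n.+1 * n.+1`!%:R.
have f1 : 0 < f by rewrite mulr_gt0 ?exprn_gt0// ltr0n fact_gt0.
exists (1 + f); first by rewrite addr_gt0.
move=> y y0; have e1 : 1 <= expR (y ^+ 2 / 8).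
  by rewrite -[leLHS]expR0 ler_expR divr_ge0 ?sqr_ge0.
rewrite mulrDl mul1r; have [y1|/ltW y1] := leP y 1.
  apply: (@le_trans _ _ 1); last by rewrite ler_wpDr// mulr_ge0 ?ltW ?expR_gt0.
  have := @ge0_ler_powR R r (ltW r0) y 1; rewrite powR1; apply; rewrite ?nnegrE//.
apply: (@le_trans _ _ ((y ^+ 2) ^+ n.+1)).
  rewrite -exprM -powR_mulrn//; apply: ler_powR => //; apply: (le_trans (ltW rn)).
  by rewrite ler_nat leq_pmull.
rewrite ler_wpDl ?expR_ge0//.
have h : 0 <= y ^+ 2 / 8 by rewrite divr_ge0 ?sqr_ge0.
have := expR_ge1Dxn n h; set e := expR _ => he.
have : (y ^+ 2 / 8) ^+ n.+1 / n.+1`!%:R <= e by apply: le_trans he; rewrite ler_wpDl.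
rewrite ler_pdivrMr ?ltr0n ?fact_gt0// expr_div_n ler_pdivrMr ?exprn_gt0//.
by rewrite (_ : f * e = e * n.+1`!%:R * 8 ^+ n.+1)// /f; ring.
Qed.

(** If [y] exceeds [3 * sqrt (p + 1)] then [exp (y ^ 2 / 8)] exceeds [2 ^ p], and
    [y ^ r] is dominated by another such factor.  The gain [2 ^- p] pays for a
    sum over the [2 ^ p] increments of level [p]. *)
Lemma gaussian_power_bound r : 0 < r -> exists2 k : R, 0 < k &
  forall p y, 0 <= y -> y `^ r <= (3 * Num.sqrt p.+1%:R) `^ r +
    k * expR (y ^+ 2 / 4) * 2 ^- p.
Proof.
move=> r0; have [k k0 yk] := powR_le_expR r0; exists k => // p y y0.
have [yp|/ltW yp] := leP y (3 * Num.sqrt p.+1%:R).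
  rewrite ler_wpDr//; last by rewrite ge0_ler_powR ?nnegrE ?(ltW r0)// mulr_ge0 ?sqrtr_ge0.
  by rewrite mulr_ge0 ?invr_ge0 ?exprn_ge0// mulr_ge0 ?expR_ge0// ltW.
rewrite ler_wpDl ?powR_ge0//; apply: (le_trans (yk y y0)).
rewrite -mulrA; apply: ler_wpM2l; first exact: ltW.
have -> : y ^+ 2 / 4 = y ^+ 2 / 8 + y ^+ 2 / 8 by field.
rewrite expRD -mulrA ler_peMr ?expR_ge0//.
rewrite ler_pdivlMr ?exprn_gt0// mul1r; apply: (le_trans (expRn_ge2n p)).
rewrite ler_expR ler_pdivlMr//.
have : (3 * Num.sqrt p.+1%:R) ^+ 2 <= y ^+ 2.
  by rewrite ler_sqr ?nnegrE ?mulr_ge0 ?sqrtr_ge0.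
rewrite exprMn sqr_sqrtr ?ler0n// -natr1; have : 0 <= p%:R :> R by []. lra.
Qed.

Lemma nneseries_geometric_le (a q : R) P : 0 <= a -> 0 <= q < 1 ->
  (\sum_(P <= p <oo) (a * q ^+ p)%:E <= (a * q ^+ P / (1 - q))%:E)%E.
Proof.
move=> a0 /andP[q0 q1]; apply: lime_le.
  by apply: is_cvg_nneseries => n _ _; rewrite lee_fin mulr_ge0 ?exprn_ge0.
near=> n; rewrite sumEFin lee_fin.
have [nP|Pn] := leqP n P.
  by rewrite big_geq// divr_ge0 ?mulr_ge0 ?exprn_ge0// subr_ge0 ltW.
suff : \sum_(P <= i < n) a * q ^+ i = a * (q ^+ P - q ^+ n) / (1 - q).
  move=> ->; rewrite ler_pM2r ?invr_gt0 ?subr_gt0//; apply: ler_wpM2l => //.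
  by rewrite gerBl exprn_ge0.
rewrite -(subnK (ltnW Pn)); elim: (n - P)%N => [|m IH].
  by rewrite add0n big_geq// subrr mulr0 mul0r.
rewrite addSn big_nat_recr ?leq_addl//= IH exprS; field.
by rewrite subr_eq0 gt_eqF.
Unshelve. all: by end_near. Qed.

(** The standard deviation of an increment of level [p] is a multiple of
    [ratio ^ p * decay ^ p]: [decay] is what the Hölder scale leaves of it. *)
Definition decay (alpha : exponent R) : R := 2 `^ ((alpha : R) - 1 / 2).

Lemma decay_itv alpha : 0 < decay alpha < 1.
Proof.
have /andP[a0 a1] := exponent_valP alpha.
rewrite powR_gt0//= /decay -opprB powRN invf_lt1 ?powR_gt0//.
have h : 0 < 1 / 2 - (alpha : R) by lra.
have := @gt0_ltr_powR R _ h 1 2; rewrite powR1; apply; rewrite ?nnegrE//.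
exact: ltr1n.
Qed.

Lemma increment_stdE (T : R) (alpha : exponent R) p : 0 < T ->
  increment_std (T := T) p =
  Num.sqrt T * (ratio (alpha := alpha) ^+ p * decay alpha ^+ p).
Proof.
move=> T0; rewrite /increment_std sqrtrM ?ltW// -exprMn; congr (_ * _).
have h : ratio (alpha := alpha) * decay alpha = (Num.sqrt 2)^-1.
  rewrite -powR12_sqrt// -powRN /ratio /decay -powRD ?pnatr_eq0 ?implybT//.
  by congr (_ `^ _); field.
rewrite h -[RHS]ger0_norm ?exprn_ge0 ?invr_ge0// -sqrtr_sqr; congr Num.sqrt.
by rewrite -exprM mulnC exprM exprVn sqr_sqrtr// exprVn.
Qed.
End RealBounds.

(** * Moments of quantities bounded by chaining *)

Section Moments.
Context {R : realType} {T : R} {d : nat} {alpha : exponent R}.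
Hypothesis T_gt0 : 0 < T.
Local Notation C := (holder0 T d alpha).
Variable L : probability (borel C) R.
Hypothesis hL : is_brownian_law L.
Local Notation ratio := (@ratio R alpha).
Local Notation decay := (decay alpha).
Local Notation std := (@increment_std R T).

(** What [gaussian_power_bound] leaves, beyond a deterministic term, of the powers
    of the increments of level [p]; adding over all of them instead of
    taking a supremum only changes the constant in its mean. *)
Let excess (k q : R) p (x : C) : R := \sum_(i < 2 ^ p) \sum_(j < d)
  k * q ^+ p * 2 ^- p * expR ((coordinate_inc j p i x / std p) ^+ 2 / 4).

Let excess_ge0 k q p x : 0 <= k -> 0 <= q -> 0 <= excess k q p x.
Proof.
move=> k0 q0; apply: sumr_ge0 => i _; apply: sumr_ge0 => j _.
by rewrite !mulr_ge0 ?expR_ge0 ?invr_ge0 ?exprn_ge0.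
Qed.

Let measurable_exp_coordinate_inc p i (j : 'I_d) : (i < 2 ^ p)%N ->
  measurable_fun setT ((fun x => expR ((coordinate_inc j p i x / std p) ^+ 2 / 4)) : borel C -> R).
Proof.
move=> ip; apply: measurableT_comp => //; apply: measurable_funM => //.
apply: measurable_funX; apply: measurable_funM => //.
exact: (measurable_coordinate_inc T_gt0 j ip).
Qed.

Let measurable_excess k q p : measurable_fun setT (excess k q p : borel C -> R).
Proof.
apply: measurable_sum => i; apply: measurable_sum => j.
by apply: measurable_funM => //; exact: measurable_exp_coordinate_inc.
Qed.

Let integral_excess k q p : 0 <= k -> 0 <= q ->
  (\int[L]_x (excess k q p x)%:E <= (2 * d%:R * k * q ^+ p)%:E)%E.
Proof.
move=> k0 q0.
have c0 : 0 <= k * q ^+ p * 2 ^- p by rewrite !mulr_ge0 ?invr_ge0 ?exprn_ge0.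
have -> : (\int[L]_x (excess k q p x)%:E = \sum_(i < 2 ^ p) \sum_(j < d)
   \int[L]_x ((k * q ^+ p * 2 ^- p)%:E * (expR ((coordinate_inc j p i x / std p) ^+ 2 / 4))%:E))%E.
  under eq_integral do rewrite /excess -sumEFin.
  rewrite ge0_integral_sum//; last 2 first.
  - move=> i; apply/measurable_EFinP; apply: measurable_sum => j.
    by apply: measurable_funM => //; exact: measurable_exp_coordinate_inc.
  - move=> i x _; rewrite lee_fin; apply: sumr_ge0 => j _.
    by rewrite mulr_ge0 ?expR_ge0.
  apply: eq_bigr => i _; under eq_integral do rewrite -sumEFin.
  rewrite ge0_integral_sum//.
  - move=> j; apply/measurable_EFinP.
    by apply: measurable_funM => //; exact: measurable_exp_coordinate_inc.
  - by move=> j x _; rewrite lee_fin mulr_ge0 ?expR_ge0.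
apply: (@le_trans _ _ (\sum_(i < 2 ^ p) \sum_(j < d) ((k * q ^+ p * 2 ^- p) * 2)%:E)%E).
  apply: lee_sum => i _; apply: lee_sum => j _.
  rewrite ge0_integralZl//.
  - rewrite [X in (_ <= X)%E]EFinM; apply: lee_wpmul2l; first by rewrite lee_fin.
    exact: increment_exp_moment.
  - by apply/measurable_EFinP; exact: measurable_exp_coordinate_inc.
under eq_bigr do rewrite sumEFin sumr_const card_ord -[_ *+ d]mulr_natl.
rewrite sumEFin sumr_const card_ord -[_ *+ (2 ^ p)]mulr_natl natrX lee_fin.
rewrite le_eqVlt; apply/orP; left; apply/eqP; field.
by rewrite expf_neq0.
Qed.

(** [D] is any quantity which chaining controls by the levels from [P] on, such as
    the norm of [x] or of [x - P_N x].  The powers [r] of all the increments,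
    rescaled, are at most [M ^ r] plus the sum of the excesses of the levels,
    whose means form a geometric series. *)
Lemma holder_tail_moment (r : R) : 0 < r -> exists2 k : R, 0 < k &
  forall P M, 0 <= M -> (forall p, (P <= p)%N -> decay ^+ p * (3 * Num.sqrt p.+1%:R) <= M) ->
  forall D : C -> R, (forall x, 0 <= D x) -> measurable_fun setT (D : borel C -> R) ->
  (forall (x : C) K, 0 <= K -> (forall p i, (P <= p)%N -> (i < 2 ^ p)%N ->
     enorm (dyadic_inc x p i) <= K * ratio ^+ p) -> D x <= K) ->
  (\int[L]_x (D x `^ r)%:E <= (k * (M `^ r + (decay `^ r) ^+ P))%:E)%E.
Proof.
move=> r0; have [k1 k10 yk] := gaussian_power_bound r0.
have /andP[dc0 dc1] := decay_itv alpha.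
set q := decay `^ r; have q0 : 0 < q by rewrite powR_gt0.
have q1 : q < 1.
  have := @gt0_ltr_powR R r r0 decay 1; rewrite powR1; apply; rewrite ?nnegrE//.
  exact: ltW.
pose c := (d.+1%:R * Num.sqrt T) `^ r; pose k2 := 2 * d%:R * k1 / (1 - q).
have c0 : 0 < c by rewrite powR_gt0// mulr_gt0 ?sqrtr_gt0.
have k20 : 0 <= k2 by rewrite divr_ge0 ?mulr_ge0 ?(ltW k10)// subr_ge0 ltW.
exists (c * (1 + k2)); first by rewrite mulr_gt0// ltr_wpDr.
move=> P M M0 hM D D0 mD DK.
pose V x := (\sum_(l <oo) (excess k1 q (P + l) x)%:E)%E.
have g0 p x : (0 <= (excess k1 q p x)%:E)%E by rewrite lee_fin excess_ge0 ?ltW.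
have mV : measurable_fun setT (V : borel C -> \bar R).
  by apply: (ge0_emeasurable_sum (P := xpredT)) => // l _; apply/measurable_EFinP.
have V0 x : (0 <= V x)%E by apply: nneseries_ge0.
have pointwise x : ((D x `^ r)%:E <= c%:E * ((M `^ r)%:E + V x))%E.
  move: (V0 x); rewrite /V; case E : (\sum_(l <oo) _)%E => [v| |]// v0; last first.
    by rewrite addey// gt0_muley// ?leey// lte_fin.
  rewrite -EFinD -EFinM lee_fin; rewrite lee_fin in v0.
  have Mv0 : 0 <= M `^ r + v by rewrite addr_ge0 ?powR_ge0.
  have -> : c * (M `^ r + v) = (d.+1%:R * Num.sqrt T * (M `^ r + v) `^ r^-1) `^ r.
    rewrite powRM ?powR_ge0 ?mulr_ge0 ?sqrtr_ge0// -powRrM mulVf ?gt_eqF//.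
    by rewrite powRr1.
  rewrite ge0_ler_powR ?nnegrE ?(ltW r0) ?mulr_ge0 ?sqrtr_ge0 ?powR_ge0//.
  apply: DK => [|p i Pp ip]; first by rewrite !mulr_ge0 ?sqrtr_ge0 ?powR_ge0.
  have s0 := increment_std_gt0 T_gt0 p.
  have each j : `|coordinate_inc j p i x| <= Num.sqrt T * (M `^ r + v) `^ r^-1 * ratio ^+ p.
    have -> : coordinate_inc j p i x = std p * (coordinate_inc j p i x / std p).
      by rewrite mulrC divfK// gt_eqF.
    set Y := coordinate_inc j p i x / std p; rewrite normrM (ger0_norm (ltW s0)).
    rewrite (increment_stdE alpha p T_gt0) -!mulrA; apply: ler_wpM2l; first exact: sqrtr_ge0.
    rewrite [leRHS]mulrC; apply: ler_wpM2l.
      by rewrite exprn_ge0// ltW//; have /andP[] := ratio_itv (alpha := alpha).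
    set u := _ * _; have u0 : 0 <= u by rewrite mulr_ge0// exprn_ge0 ?ltW.
    have -> : u = (u `^ r) `^ r^-1 by rewrite -powRrM mulfV ?gt_eqF// powRr1.
    rewrite ge0_ler_powR ?nnegrE ?powR_ge0 ?invr_ge0 ?(ltW r0)//.
    have dp0 : 0 <= decay ^+ p by rewrite exprn_ge0 ?ltW.
    have dpr : (decay ^+ p) `^ r = q ^+ p by exact: powR_exprn (ltW dc0).
    rewrite /u powRM// dpr.
    apply: (le_trans (ler_wpM2l _ (yk p _ (normr_ge0 Y)))).
      by rewrite exprn_ge0 ?ltW.
    rewrite mulrDr; apply: lerD.
      rewrite -dpr -powRM ?mulr_ge0 ?sqrtr_ge0//.
      rewrite ge0_ler_powR ?nnegrE ?(ltW r0) ?mulr_ge0 ?sqrtr_ge0//.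
      exact: hM.
    have gv : excess k1 q p x <= v.
      rewrite -lee_fin -E.
      apply: le_trans (nneseries_lim_ge (m := 0) (p - P).+1 _) => //.
      by rewrite big_nat_recr//= subnKC// leeDr// sume_ge0.
    apply: le_trans gv; rewrite /excess (bigD1 (Ordinal ip))//= (bigD1 j)//=.
    have t0 (l : nat) (j' : 'I_d) :
        0 <= k1 * q ^+ p * 2 ^- p * expR ((coordinate_inc j' p l x / std p) ^+ 2 / 4).
      by rewrite !mulr_ge0 ?expR_ge0 ?invr_ge0 ?exprn_ge0 ?ltW.
    rewrite -addrA ler_wpDr//.
      by rewrite addr_ge0// sumr_ge0// => l _; apply: sumr_ge0.
    rewrite -/Y real_normK ?num_real// le_eqVlt; apply/orP; left; apply/eqP; ring.
  apply: (le_trans (enorm_le_sum _)).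
  apply: (le_trans (ler_sum _ (fun j _ => each j))).
  rewrite sumr_const card_ord -[_ *+ d]mulr_natl -!mulrA; apply: ler_wpM2r.
    by rewrite !mulr_ge0 ?sqrtr_ge0 ?powR_ge0 ?exprn_ge0// ltW//; have /andP[] := ratio_itv (alpha := alpha).
  by rewrite ler_nat.
apply: (@le_trans _ _ (\int[L]_x (c%:E * ((M `^ r)%:E + V x)))%E).
  apply: ge0_le_integral => //.
  - by move=> x _; rewrite lee_fin powR_ge0.
  - apply/measurable_EFinP; apply: (measurableT_comp (measurable_powR _)) => //.
  - by apply: emeasurable_funM => //; exact: emeasurable_funD.
rewrite ge0_integralZl//; last 3 first.
- exact: emeasurable_funD.
- by move=> x _; rewrite adde_ge0// lee_fin powR_ge0.
- by rewrite lee_fin ltW.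
rewrite -mulrA EFinM; apply: lee_wpmul2l; first by rewrite lee_fin ltW.
rewrite ge0_integralD//; last by move=> x _; rewrite lee_fin powR_ge0.
rewrite integral_cst// [X in (_ * X)%E]probability_setT mule1.
rewrite integral_nneseries//; last by move=> l; apply/measurable_EFinP.
have step : (\sum_(l <oo) \int[L]_x (excess k1 q (P + l) x)%:E <= (k2 * q ^+ P)%:E)%E.
  apply: (@le_trans _ _ (\sum_(0 <= l <oo) (2 * d%:R * k1 * q ^+ P * q ^+ l)%:E)%E).
    apply: lee_nneseries => l _; first by move=> _; apply: integral_ge0.
    by rewrite -mulrA -exprD; apply: integral_excess; exact: ltW.
  apply: le_trans (nneseries_geometric_le 0 _ _) _.
  - by rewrite mulr_ge0 ?exprn_ge0 ?mulr_ge0// ltW.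
  - by rewrite (ltW q0).
  - by rewrite lee_fin le_eqVlt; apply/orP; left; apply/eqP; rewrite /k2; ring.
apply: (le_trans (leeD (lexx _) step)); rewrite -EFinD lee_fin.
rewrite mulrDl mul1r mulrDr -addrA lerD2l.
by have := powR_ge0 M r; have := exprn_ge0 P (ltW q0); nra.
Qed.
End Moments.

(** * Codes with geometric weights *)

Section Geometric.
Context {R : realType}.

Lemma geometric_sum_le (z : R) B : 0 <= z < 1 -> \sum_(b < B) z ^+ b <= (1 - z)^-1.
Proof.
move=> /andP[z0 z1]; have z1' : 0 < 1 - z by rewrite subr_gt0.
rewrite -[leRHS]div1r ler_pdivlMr// mulrC.
rewrite (_ : (1 - z) * _ = 1 - z ^+ B); first by rewrite gerBl exprn_ge0.
by rewrite -[1 - z]opprB mulNr -subrX1 opprB.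
Qed.

(** The sum of a product over all codes is the product of the geometric series. *)
Lemma sum_code_weight_le (I : finType) (z : I -> R) B : (forall i, 0 <= z i < 1) ->
  \sum_(k : {ffun I -> 'I_B}) \prod_i z i ^+ k i <= \prod_i (1 - z i)^-1.
Proof.
move=> z01; rewrite -(bigA_distr_bigA (fun i (b : 'I_B) => z i ^+ b)).
apply: ler_prod => i _; have /andP[z0 z1] := z01 i.
by rewrite geometric_sum_le// andbT sumr_ge0// => b _; exact: exprn_ge0.
Qed.

End Geometric.

Section UnionBound.
Context {d} {Om : measurableType d} {R : realType} (P : probability Om R).

Lemma finite_union_bound (K : finType) (E : set Om) (F : K -> set Om) :
  measurable E -> (forall k, measurable (F k)) -> E `<=` \bigcup_k F k ->
  (P E <= \sum_k P (F k))%E.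
Proof.
move=> mE mF EF.
have := content_sub_fsum P finite_finset (fun k _ => mF k) mE EF.
rewrite (fsbigE (index_enum K)) ?index_enum_uniq//.
  by under eq_bigl do rewrite in_setT.
by move=> k _; rewrite mem_index_enum.
Qed.

Variables (I : finType) (code code' : Om -> I -> nat).

Definition cell (cd : Om -> I -> nat) (k : I -> nat) : set Om :=
  [set x | forall i, cd x i = k i].

Lemma measurable_cell (cd : Om -> I -> nat) (k : I -> nat) :
  (forall i m, measurable [set x | cd x i = m]) -> measurable (cell cd k).
Proof.
move=> mcd; have -> : cell cd k = \bigcap_(i in [set: I]) [set x | cd x i = k i].
  by apply/seteqP; split=> x /= xk i; [move=> _|]; exact: xk.
by apply: fin_bigcap_measurable => //; exact: finite_finset.
Qed.

Hypothesis mcode' : forall i m, measurable [set x | code' x i = m].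
Hypothesis same_law : forall k, P (cell code k) = P (cell code' k).

(** The cells that are less probable than [theta] times their weight have together a
    probability at most [theta] times the sum of all weights.  The cell is
    measured with [code] and the path is encoded with [code'], which have the
    same law; the bound [B] keeps the number of codes finite. *)
Lemma rare_codes (z : I -> R) (theta : R) (B : nat) :
  (forall i, 0 <= z i < 1) -> 0 <= theta ->
  exists U : set Om, [/\ measurable U, (P U <= (theta * \prod_i (1 - z i)^-1)%:E)%E &
   forall x, ~ U x -> (forall i, code' x i < B)%N ->
     ((theta * \prod_i z i ^+ code' x i)%:E <= P (cell code (code' x)))%E].
Proof.
move=> z01 th0.
pose w (k : {ffun I -> 'I_B}) : R := \prod_i z i ^+ k i.
have w0 k : 0 <= w k.
  by apply: prodr_ge0 => i _; have /andP[z0 _] := z01 i; exact: exprn_ge0.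
(* The cell of [k] when it is rare, and nothing otherwise. *)
pose F (k : {ffun I -> 'I_B}) : set Om :=
  if (P (cell code (fun i => k i)) < (theta * w k)%:E)%E
  then cell code' (fun i => k i) else set0.
have mF k : measurable (F k).
  by rewrite /F; case: ifP => // _; exact: measurable_cell.
exists (\bigcup_k F k).
have mU : measurable (\bigcup_k F k).
  by apply: fin_bigcup_measurable => //; exact: finite_finset.
split=> //.
- apply: (le_trans (finite_union_bound mU mF (@subset_refl _ _))).
  apply: (@le_trans _ _ (\sum_k (theta * w k)%:E)%E).
    apply: lee_sum => k _; rewrite /F; case: ifP => [h|_].
      by rewrite -same_law ltW.
    by rewrite measure0 lee_fin mulr_ge0.
  rewrite sumEFin lee_fin -mulr_sumr; apply: ler_wpM2l => //.
  exact: sum_code_weight_le.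
- move=> x Ux xB; rewrite leNgt; apply/negP => h; apply: Ux.
  exists [ffun i => Ordinal (xB i)] => //.
  have e : (fun i => [ffun i => Ordinal (xB i)] i : nat) = code' x.
    by apply/funext => i; rewrite ffunE.
  rewrite /F; have -> : w [ffun i => Ordinal (xB i)] = \prod_i z i ^+ code' x i.
    by apply: eq_bigr => i _; rewrite ffunE.
  by rewrite e h => i.
Qed.

End UnionBound.

Section Truncn.
Context {d} {Om : measurableType d} {R : realType}.

Lemma measurable_truncn (f : Om -> R) (m : nat) : measurable_fun setT f ->
  measurable [set x | Num.truncn (f x) = m].
Proof.
move=> mf; have le k : measurable [set x | (Num.truncn (f x) <= k)%N].
  have -> : [set x | (Num.truncn (f x) <= k)%N] = setT `&` f @^-1` `]-oo, k.+1%:R[.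
    by rewrite setTI; apply/seteqP; split=> x /=; rewrite truncn_le_nat in_itv.
  exact: mf.
case: m => [|m].
  have -> : [set x | Num.truncn (f x) = 0%N] = [set x | (Num.truncn (f x) <= 0)%N].
    by apply/seteqP; split=> x /=; rewrite leqn0 => /eqP.
  exact: le.
have -> : [set x | Num.truncn (f x) = m.+1] =
    [set x | (Num.truncn (f x) <= m.+1)%N] `\` [set x | (Num.truncn (f x) <= m)%N].
  apply/seteqP; split=> x /=; first by move=> ->; rewrite leqnn ltnn.
  by move=> [h1 /negP]; rewrite -ltnNge => h2; apply/eqP; rewrite eqn_leq h1.
exact: measurableD.
Qed.

(** Truncation sends all negative numbers to [0], so both [a] and [- a] are needed to
    locate [a]; an interval of width [2] about [0] has a single code. *)
Lemma truncn_close (a b : R) : Num.truncn a = Num.truncn b ->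
  Num.truncn (- a) = Num.truncn (- b) -> `|a - b| <= 2.
Proof.
wlog ab : a b / b <= a => [h|].
  have [ba|/ltW ab] := leP b a; first exact: h.
  by move=> e1 e2; rewrite distrC; apply: h.
move=> e1 e2; rewrite ger0_norm ?subr_ge0//.
have a1 := truncnS_gt a; have b1 := truncnS_gt (- b).
have [b0|/ltW b0] := leP 0 b.
  have := truncn_itv b0; rewrite -e1 => /andP[h _].
  by move: a1; rewrite -natr1; lra.
have [a0|/ltW a0] := leP a 0.
  have na0 : 0 <= - a by rewrite oppr_ge0.
  have := truncn_itv na0; rewrite e2 => /andP[h _].
  by move: b1; rewrite -natr1; lra.
have h1 : Num.truncn b = 0%N by apply/eqP; rewrite -leqn0 truncn_le_nat; lra.
have h2 : Num.truncn (- a) = 0%N by apply/eqP; rewrite -leqn0 truncn_le_nat; lra.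
by move: a1 b1; rewrite e1 -e2 h1 h2; lra.
Qed.

End Truncn.

(** * The rounded increments as a code *)

Lemma block_lt q P i k : (q <= P)%N -> (i < 2 ^ q)%N -> (k < 2 ^ (P - q))%N ->
  (i * 2 ^ (P - q) + k < 2 ^ P)%N.
Proof.
move=> qP iq kP; apply: (@leq_trans (i.+1 * 2 ^ (P - q))).
  by rewrite mulSn addnC ltn_add2r.
by rewrite -{2}(subnKC qP) expnD leq_mul2r iq orbT.
Qed.

Lemma lee_prod_fin (R : realType) (I : finType) (f : I -> \bar R) (g : I -> R) :
  (forall i, 0 <= f i)%E -> (forall i, f i <= (g i)%:E)%E ->
  (\prod_i f i <= (\prod_i g i)%:E)%E.
Proof.
move=> f0 fg; suff : (0 <= \prod_i f i <= (\prod_i g i)%:E)%E by case/andP.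
elim/big_rec2: _ => [|i x y _ /andP[x0 xy]]; first by rewrite lee_fin ler01 lexx.
by rewrite mule_ge0//= EFinM lee_pmul.
Qed.

Section CoordinateLaws.
Context {R : realType} {T : R} {d : nat} {alpha : exponent R}.
Hypothesis T_gt0 : 0 < T.
Local Notation C := (holder0 T d alpha).
Variable L : probability (borel C) R.
Hypothesis hL : is_brownian_law L.
Local Notation std := (@increment_std R T).

(** A pi-system for the product sigma-algebra of the first [n] entries of a
    sequence. *)
Definition boxes (n : nat) : set (set (nat -> R)) :=
  [set B | exists2 A : nat -> set R, (forall i, measurable (A i)) &
     B = [set v | forall i, (i < n)%N -> A i (v i)]].

Let vectors n := g_sigma_algebraType (boxes n).

Let fine_increments (j : 'I_d) p (x : C) : nat -> R := fun l => coordinate_inc j p l x.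

Let fine_increments_box j p (A : nat -> set R) : (forall i, measurable (A i)) ->
  L (fine_increments j p @^-1` [set v | forall i, (i < 2 ^ p)%N -> A i (v i)]) =
  (\prod_(i < 2 ^ p) normal_prob 0 (std p) (A i))%E.
Proof.
move=> mA; rewrite -(box_law T_gt0 hL j (fun i : 'I__ => mA i)); congr (L _).
apply/seteqP; split=> x /= xA i; first exact: xA.
by move=> ip; exact: (xA (Ordinal ip)).
Qed.

Let measurable_fine_increments j p :
  measurable_fun setT (fine_increments j p : borel C -> vectors (2 ^ p)).
Proof.
apply: (@measurability _ _ (borel C) (vectors (2 ^ p)) setT _ (boxes (2 ^ p))) => //.
move=> _ [B [A mA ->] <-]; rewrite setTI.
have -> : fine_increments j p @^-1` [set v | forall i, (i < 2 ^ p)%N -> A i (v i)] =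
    \bigcap_(i in [set i | (i < 2 ^ p)%N]) (coordinate_inc j p i @^-1` A i).
  by apply/seteqP; split=> x /= xA i ip; exact: xA.
apply: fin_bigcap_measurable; first exact: finite_II.
by move=> i ip; rewrite -[X in measurable X]setTI; apply: (measurable_coordinate_inc T_gt0 j ip).
Qed.

(** On boxes both sides are the same product of Gaussian probabilities, and boxes
    form a pi-system. *)
Lemma coordinate_law_eq j j' p (B : set (nat -> R)) :
  measurable (B : set (vectors (2 ^ p))) ->
  L (fine_increments j p @^-1` B) = L (fine_increments j' p @^-1` B).
Proof.
move=> mB.
pose m1 := image_measure L (@measurable_fine_increments j p).
pose m2 := image_measure L (@measurable_fine_increments j' p).
suff : forall E, <<s boxes (2 ^ p) >> E -> m1 E = m2 E by apply.
apply: (@g_sigma_algebra_measure_unique _ R (vectors (2 ^ p)) (boxes (2 ^ p)) _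
  (fun=> setT)) => //.
- exact: sub_sigma_algebra.
- move=> _; exists (fun=> setT) => //.
  by apply/seteqP.
- by apply/seteqP; split => // v _; exists 0%N.
- move=> _ _ [A mA ->] [A' mA' ->]; exists (fun i => A i `&` A' i).
    by move=> i; exact: measurableI.
  apply/seteqP; split=> v /= => [[vA vA'] i ip|vA].
    by split; [exact: vA|exact: vA'].
  by split=> i ip; case: (vA i ip).
- move=> _ [A mA ->].
  by rewrite -[LHS]/(L (fine_increments j p @^-1` _)) -[RHS]/(L (fine_increments j' p @^-1` _)) !fine_increments_box.
- move=> _; apply: le_lt_trans (probability_le1 L _) _; last exact: ltry.
  by rewrite -[X in measurable X]setTI; exact: measurable_fine_increments.
Qed.

Let measurable_entry n l : (l < n)%N ->
  measurable_fun setT ((fun v => v l) : vectors n -> R).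
Proof.
move=> ln _ A mA; rewrite setTI; apply: sub_sigma_algebra.
exists (fun i => if i == l then A else setT); first by move=> i; case: ifP.
apply/seteqP; split=> v /= vA => [i _|]; first by case: eqP => // ->.
by have := vA l ln; rewrite eqxx.
Qed.

(** A dyadic interval of level at most [P] and a sign. *)
Definition code_index (P : nat) : finType := {p : 'I_P.+1 & ('I_(2 ^ p) * bool)%type}.

(** The increment in units of [delta] standard deviations, rounded towards [0]; of the
    two signs only one gives a nonzero symbol. *)
Definition symbol (delta : nat -> R) (j : 'I_d) P (x : C) (i : code_index P) : nat :=
  Num.truncn ((-1) ^+ (tagged i).2 * (coordinate_inc j (tag i) (tagged i).1 x /
    (std (tag i) * delta (tag i)))).

(** A coarse increment is a sum of increments of level [P], so the whole code is
    a function of these. *)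
Let symbol_of (delta : nat -> R) P (v : nat -> R) (i : code_index P) : nat :=
  Num.truncn ((-1) ^+ (tagged i).2 *
    ((\sum_(k < 2 ^ (P - tag i)) v ((tagged i).1 * 2 ^ (P - tag i) + k)%N) /
    (std (tag i) * delta (tag i)))).

Let symbolE delta j P x (i : code_index P) :
  symbol delta j x i = symbol_of delta (fine_increments j P x) i.
Proof.
rewrite /symbol /symbol_of; congr (Num.truncn (_ * (_ / _))).
have h : (tag i <= P)%N by rewrite -ltnS.
rewrite /coordinate_inc (dyadic_inc_sum _ _ h) summxE; exact: eq_bigr.
Qed.

Let measurable_symbol_of delta P (i : code_index P) m :
  measurable ([set v | symbol_of delta v i = m] : set (vectors (2 ^ P))).
Proof.
apply: (@measurable_truncn _ (vectors (2 ^ P)) R).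
apply: measurable_funM => //; apply: measurable_funM => //.
apply: measurable_sum => k; apply: measurable_entry.
have h : (tag i <= P)%N by rewrite -ltnS.
exact: block_lt.
Qed.

Lemma measurable_symbol delta j P (i : code_index P) m :
  measurable ([set x | symbol delta j x i = m] : set (borel C)).
Proof.
have -> : [set x | symbol delta j x i = m] =
    setT `&` fine_increments j P @^-1` [set v | symbol_of delta v i = m].
  by rewrite setTI; apply/seteqP; split=> x /=; rewrite symbolE.
exact: measurable_fine_increments.
Qed.

Lemma symbol_law_eq delta j j' P k :
  L (cell (symbol delta j (P := P) : borel C -> _) k) =
  L (cell (symbol delta j' (P := P) : borel C -> _) k).
Proof.
have E (i : 'I_d) : cell (symbol delta i (P := P) : borel C -> _) k =
    fine_increments i P @^-1` (cell (symbol_of delta (P := P) : vectors (2 ^ P) -> _) k).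
  by apply/seteqP; split=> x /= xk l; have := xk l; rewrite symbolE.
rewrite !E; apply: coordinate_law_eq; apply: measurable_cell => l m.
exact: measurable_symbol_of.
Qed.

End CoordinateLaws.

(** * Large deviations of the rounded increments *)

(** Capping every entry at [K] keeps the sum above [K] and leaves finitely many
    possibilities. *)
Lemma truncated_sum n K (u : 'I_n -> nat) : (K <= \sum_l u l)%N ->
  exists2 k : {ffun 'I_n -> 'I_K.+1}, (K <= \sum_l k l)%N & forall l, (k l <= u l)%N.
Proof.
move=> Ku; pose k := [ffun l => inord (minn K (u l)) : 'I_K.+1].
have kE l : k l = minn K (u l) :> nat by rewrite ffunE inordK// ltnS geq_minl.
exists k => [|l]; last by rewrite kE geq_minr.
rewrite (eq_bigr _ (fun l _ => kE l)).
have [/existsP[l Kl]|] := boolP [exists l, (K <= u l)%N].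
  by rewrite (bigD1 l)//= (minn_idPl Kl) leq_addr.
rewrite negb_exists => /forallP uK; rewrite (leq_trans Ku)// leq_sum// => l _.
by rewrite leq_min leqnn andbT ltnW// ltnNge uK.
Qed.

Section LevelTail.
Context {R : realType} {T : R} {d : nat} {alpha : exponent R}.
Hypothesis T_gt0 : 0 < T.
Local Notation C := (holder0 T d alpha).
Variable L : probability (borel C) R.
Hypothesis hL : is_brownian_law L.
Local Notation std := (@increment_std R T).

Definition rounded (g : R) (j : 'I_d) p l (x : C) : nat :=
  Num.truncn (`|coordinate_inc j p l x| / (std p * g)).

(** A bound for the probability that a rounded increment is at least [b]. *)
Let tail (g : R) (b : nat) : R := if b is 0%N then 1 else 2 * expR (- (b%:R * g) ^+ 2 / 4).

Let tail_ge0 g b : 0 <= tail g b.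
Proof. by case: b => //= b; rewrite mulr_ge0 ?expR_ge0. Qed.

Let normal_tail_le (g : R) p b : 0 < g ->
  (normal_prob 0 (std p) [set y | (b <= Num.truncn (`|y| / (std p * g)))%N] <= (tail g b)%:E)%E.
Proof.
move=> g0; case: b => [|b]; first by rewrite (_ : [set _ | _] = setT) ?probability_setT//; exact/seteqP.
have s0 := increment_std_gt0 T_gt0 p.
have -> : [set y : R | (b.+1 <= Num.truncn (`|y| / (std p * g)))%N] =
    [set y : R | b.+1%:R * g * std p <= `|y|].
  have z0 (y : R) : 0 <= `|y| / (std p * g) by rewrite divr_ge0 ?mulr_ge0 ?(ltW s0) ?(ltW g0).
  apply/seteqP; split=> y /=; rewrite (truncn_ge_nat _ (z0 y));
    by rewrite ler_pdivlMr ?mulr_gt0// mulrA mulrAC.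
by apply: normal_tail => //; rewrite mulr_ge0// ltW.
Qed.

Let weighted_tail_le g b : 0 < g -> expR b.+1%:R * tail g b.+1 <= 2 * expR (1 - g ^+ 2 / 4) ^+ b.+1.
Proof.
move=> g0; rewrite /tail mulrCA -expRD -expRM_natl; apply: ler_wpM2l => //.
rewrite ler_expR mulrBr mulr1 mulNr lerD2l lerN2 mulrA ler_wpM2r//.
rewrite exprMn; apply: ler_wpM2r; first exact: sqr_ge0.
by rewrite expr2 -natrM ler_nat leq_pmulr.
Qed.

Let sum_weighted_tail_le g B : 0 < g -> expR (1 - g ^+ 2 / 4) <= 1 / 2 ->
  \sum_(b < B) expR b%:R * tail g b <= 1 + 4 * expR (1 - g ^+ 2 / 4).
Proof.
move=> g0; set h := expR (1 - _) => h2; have h0 : 0 < h by exact: expR_gt0.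
case: B => [|B]; first by rewrite big_ord0 addr_ge0// mulr_ge0// ltW.
rewrite big_ord_recl/= expR0 mulr1 lerD2l.
apply: (@le_trans _ _ (\sum_(b < B) 2 * h * h ^+ b)).
  apply: ler_sum => b _; rewrite -mulrA -exprS; exact: weighted_tail_le.
rewrite -mulr_sumr; have h1 : 0 <= h < 1 by rewrite (ltW h0)/=; lra.
apply: (le_trans (ler_wpM2l _ (geometric_sum_le B h1))); first by rewrite mulr_ge0// ltW.
have : (1 - h)^-1 <= 2 by rewrite -[leRHS]invrK lef_pV2 ?posrE; lra.
nra.
Qed.

Lemma measurable_rounded g j p l m : (l < 2 ^ p)%N ->
  measurable ([set x | rounded g j p l x = m] : set (borel C)).
Proof.
move=> lp; apply: (@measurable_truncn _ (borel C) R).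
apply: measurable_funM => //; apply: measurableT_comp => //.
exact: (measurable_coordinate_inc T_gt0 j lp).
Qed.

Lemma measurable_sum_rounded g j p K :
  measurable ([set x | (K <= \sum_(l < 2 ^ p) rounded g j p l x)%N] : set (borel C)).
Proof.
have mr l m : (l < 2 ^ p)%N -> measurable ([set x | (m <= rounded g j p l x)%N] : set (borel C)).
  move=> lp; have -> : [set x | (m <= rounded g j p l x)%N] =
      \bigcup_(k in [set k | (m <= k)%N]) [set x | rounded g j p l x = k].
    by apply/seteqP; split=> x /= => [h|[k mk ->]//]; exists (rounded g j p l x).
  by apply: bigcup_measurable => k _; exact: measurable_rounded.
have -> : [set x | (K <= \sum_(l < 2 ^ p) rounded g j p l x)%N] =
    \bigcup_(k : {ffun 'I_(2 ^ p) -> 'I_K.+1})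
      (if (K <= \sum_l k l)%N then
        \bigcap_(l in [set: 'I_(2 ^ p)]) [set x | (k l <= rounded g j p l x)%N] else set0).
  apply/seteqP; split=> x /= => [/truncated_sum[k Kk ku]|[k _]].
    by exists k => //; rewrite Kk => l _; exact: ku.
  case: ifP => // Kk ku; apply: (leq_trans Kk); apply: leq_sum => l _.
  exact: ku.
apply: fin_bigcup_measurable; first exact: finite_finset.
move=> k _; case: ifP => // _; apply: fin_bigcap_measurable; first exact: finite_finset.
by move=> l _; exact: mr.
Qed.

(** A Chernoff bound.  The event is covered by boxes prescribing lower bounds [k l] of
    sum at least [K]; their probabilities factor, and the weights [exp (k l)],
    whose product is at least [exp K], turn the sum over all boxes into the
    [2 ^ p]-th power of one convergent series. *)
Lemma rounded_sum_tail g j p K : 0 < g -> expR (1 - g ^+ 2 / 4) <= 1 / 2 ->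
  (L [set x | (K <= \sum_(l < 2 ^ p) rounded g j p l x)%N] <=
    (expR (- K%:R + 4 * expR (1 - g ^+ 2 / 4) * 2 ^+ p))%:E)%E.
Proof.
move=> g0 h2; set h := expR (1 - _) in h2 *; have h0 : 0 < h by exact: expR_gt0.
pose F (k : {ffun 'I_(2 ^ p) -> 'I_K.+1}) : set (borel C) :=
  if (K <= \sum_l k l)%N then
    [set x : borel C | forall l, (k l <= rounded g j p l x)%N] else set0.
have FE (k : {ffun 'I_(2 ^ p) -> 'I_K.+1}) :
   [set x : borel C | forall l, (k l <= rounded g j p l x)%N] =
   [set x : borel C | forall l, [set y | (k l <= Num.truncn (`|y| / (std p * g)))%N]
     (coordinate_inc j p l x)] by [].
have mA (b : nat) : measurable [set y : R | (b <= Num.truncn (`|y| / (std p * g)))%N].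
  have -> : [set y : R | (b <= Num.truncn (`|y| / (std p * g)))%N] =
      \bigcup_(k in [set k | (b <= k)%N]) [set y | Num.truncn (`|y| / (std p * g)) = k].
    by apply/seteqP; split=> y /= => [?|[k mk ->]//]; exists (Num.truncn (`|y| / (std p * g))).
  apply: bigcup_measurable => k _; apply: measurable_truncn.
  by apply: measurable_funM => //; exact: measurableT_comp.
have mF k : measurable (F k).
  rewrite /F; case: ifP => // _.
  have -> : [set x : borel C | forall l, (k l <= rounded g j p l x)%N] =
      \bigcap_(l in [set: 'I_(2 ^ p)]) (setT `&` coordinate_inc j p l @^-1`
        [set y | (k l <= Num.truncn (`|y| / (std p * g)))%N]).
    apply/seteqP; split=> x /= xk l; first by move=> _; split => //; exact: xk.
    by have [] := xk l I.
  apply: fin_bigcap_measurable; first exact: finite_finset.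
  by move=> l _; apply: (measurable_coordinate_inc T_gt0 j (ltn_ord l)).
have PF k : (L (F k) <= (expR (- K%:R) * \prod_l (expR (k l)%:R * tail g (k l)))%:E)%E.
  have rhs0 : 0 <= expR (- K%:R) * \prod_l (expR (k l)%:R * tail g (k l)).
    by rewrite mulr_ge0 ?expR_ge0// prodr_ge0// => l _; rewrite mulr_ge0 ?expR_ge0.
  rewrite /F; case: ifP => [Kk|_]; last by rewrite measure0 lee_fin.
  rewrite FE (box_law T_gt0 hL j (fun l => mA (k l))).
  apply: (le_trans (lee_prod_fin (g := fun l => tail g (k l)) _ _)).
  - by move=> l; exact: measure_ge0.
  - by move=> l; exact: normal_tail_le.
  rewrite lee_fin big_split/= mulrA -expR_sum -expRD.
  rewrite ler_peMl ?prodr_ge0// -[leLHS]expR0 ler_expR addrC subr_ge0.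
  by rewrite -natr_sum ler_nat.
have mE := measurable_sum_rounded g j p K.
apply: (le_trans (finite_union_bound L mE mF _)).
  by move=> x /= /truncated_sum[k Kk ku]; exists k => //; rewrite /F Kk.
apply: (le_trans (lee_sum _ (fun k _ => PF k))).
rewrite sumEFin lee_fin -mulr_sumr expRD; apply: ler_wpM2l; first exact: expR_ge0.
rewrite -(bigA_distr_bigA (fun l (b : 'I_K.+1) => expR b%:R * tail g b)).
rewrite prodr_const card_ord.
apply: (@le_trans _ _ ((1 + 4 * h) ^+ (2 ^ p))).
  apply: lerXn2r; rewrite ?nnegrE ?sum_weighted_tail_le//.
    by apply: sumr_ge0 => b _; rewrite mulr_ge0 ?expR_ge0.
  by rewrite addr_ge0// mulr_ge0// ltW.
rewrite -natrX expRM_natr; apply: lerXn2r; rewrite ?nnegrE ?expR_ge0//.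
  by rewrite addr_ge0// mulr_ge0// ltW.
exact: expR_ge1Dx.
Qed.

End LevelTail.

(** * The meshes *)

Section Mesh.
Context {R : realType}.

Lemma truncn_normr (a : R) : (Num.truncn a + Num.truncn (- a))%N = Num.truncn `|a|.
Proof.
have t0 (b : R) : b <= 0 -> Num.truncn b = 0%N.
  by move=> b0; apply/eqP; rewrite -leqn0 truncn_le_nat; lra.
have [a0|/ltW a0] := leP 0 a.
  by rewrite (t0 (- a)) ?addn0 ?oppr_le0// ger0_norm.
by rewrite (t0 a)// ler0_norm.
Qed.

(** The absolute difference of the two levels: one of the truncated differences is
    [0]. *)
Definition gap (p0 p : nat) : nat := ((p - p0) + (p0 - p))%N.

Lemma sum_gap_le (q : R) p0 n : 0 < q < 1 -> \sum_(p < n) q ^+ gap p0 p <= 2 / (1 - q).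
Proof.
move=> /andP[q0 q1]; have q1' : 0 < 1 - q by rewrite subr_gt0.
rewrite ler_pdivlMr//.
suff : (\sum_(p < n) q ^+ gap p0 p) * (1 - q) <=
    q ^+ (p0.+1 - n) + 1 - q ^+ (n - p0.+1).
  move=> /le_trans; apply.
  have h1 : q ^+ (p0.+1 - n) <= 1 by apply: exprn_ile1; exact: ltW.
  have h2 : 0 <= q ^+ (n - p0.+1) by rewrite exprn_ge0// ltW.
  lra.
elim: n => [|n IH].
  by rewrite big_ord0 mul0r sub0n expr0 addrK exprn_ge0// ltW.
rewrite big_ord_recr/= mulrDl; apply: (le_trans (lerD IH (lexx _))).
have [np|pn] := leqP n p0.
  have -> : (n - p0.+1 = 0)%N by lia.
  have -> : (n.+1 - p0.+1 = 0)%N by lia.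
  have -> : gap p0 n = (p0 - n)%N by rewrite /gap; lia.
  have -> : (p0.+1 - n = (p0 - n).+1)%N by lia.
  by rewrite subSS exprS; lra.
have -> : (p0.+1 - n = 0)%N by lia.
have -> : (p0.+1 - n.+1 = 0)%N by lia.
have -> : gap p0 n = (n - p0.+1).+1 by rewrite /gap; lia.
have -> : (n.+1 - p0.+1 = (n - p0.+1).+1)%N by lia.
have z0 : 0 <= q ^+ (n - p0.+1) by rewrite exprn_ge0// ltW.
have h : 0 <= q ^+ (n - p0.+1) * (1 - q) * (1 - q) by rewrite !mulr_ge0// ltW.
rewrite exprS; lra.
Qed.

Lemma expr_ge1Mn (x : R) n : 0 <= x -> 1 + n%:R * x <= (1 + x) ^+ n.
Proof.
move=> x0; elim: n => [|n IH]; first by rewrite mul0r addr0 expr0.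
rewrite exprS; apply: (@le_trans _ _ ((1 + x) * (1 + n%:R * x))).
  rewrite -natr1; have : 0 <= n%:R * x * x by rewrite !mulr_ge0.
  nra.
by apply: ler_wpM2l => //; rewrite addr_ge0.
Qed.

Variable alpha : exponent R.
Local Notation decay := (decay alpha).

Lemma decay_sqr : 1 / 2 < decay ^+ 2 < 1.
Proof.
have /andP[a0 _] := exponent_valP alpha; have /andP[d0 d1] := decay_itv alpha.
rewrite expr_lt1// ?(ltW d0)// d1 andbT -powR_mulrn ?powR_ge0// -powRrM.
have e : 2 `^ (- 1) = 1 / 2 :> R by rewrite powR_inv1// div1r.
rewrite -[ltLHS]e.
rewrite /powR pnatr_eq0/= ltr_expR ltr_pM2r ?ln_gt0 ?ltr1n//. lra.
Qed.

Lemma decay_ge : 2 / 3 <= decay.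
Proof.
have /andP[d0 d1] := decay_itv alpha; have /andP[h _] := decay_sqr.
by rewrite leNgt; apply/negP => h'; move: h; rewrite expr2; nra.
Qed.

(** Large enough for the tail of a Gaussian variable beyond [grid] to beat the number
    of increments of its level: with [12] Bernoulli's inequality gives exactly
    the growth used in [grid_tail]. *)
Definition mesh0 : R := Num.sqrt (12 / (decay ^- 2 - 1)).

(** The rounding mesh, in standard deviations.  It grows with the level in such a
    way that the rounding error, a multiple of
    [ratio ^ p * decay ^ p * mesh p0 p], is [decay ^ p0] times the Hölder scale
    on every level. *)
Definition mesh (p0 p : nat) : R := mesh0 * decay ^+ p0 / decay ^+ p.

(** The mesh, kept from becoming finer below level [p0], where the large deviation
    bound requires tails smaller than a constant. *)
Definition grid (p0 p : nat) : R := mesh0 / decay ^+ (p - p0).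

Let decayV_itv : 0 < decay ^- 2 - 1 < 1.
Proof.
have /andP[h1 h2] := decay_sqr; have h0 : 0 < decay ^+ 2 by lra.
rewrite subr_gt0 invf_gt1// h2/= ltrBlDr.
have : decay ^- 2 < (1 / 2)^-1 by rewrite ltf_pV2 ?posrE.
by rewrite div1r invrK; lra.
Qed.

Lemma mesh0_gt0 : 0 < mesh0.
Proof. by have /andP[h _] := decayV_itv; rewrite sqrtr_gt0 divr_gt0. Qed.

Lemma mesh_gt0 p0 p : 0 < mesh p0 p.
Proof.
have /andP[d0 _] := decay_itv alpha.
by rewrite divr_gt0 ?mulr_gt0 ?exprn_gt0 ?mesh0_gt0.
Qed.

Lemma grid_gt0 p0 p : 0 < grid p0 p.
Proof.
have /andP[d0 _] := decay_itv alpha.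
by rewrite divr_gt0 ?exprn_gt0 ?mesh0_gt0.
Qed.

(** The square of the grid grows geometrically beyond [p0], hence at least linearly. *)
Lemma grid_tail p0 p : expR (1 - grid p0 p ^+ 2 / 4) <= 4 ^- (p - p0).+1.
Proof.
set j := (p - p0)%N; have /andP[x0 x1] := decayV_itv.
have /andP[d0 _] := decay_itv alpha.
have g2 : 4 * (1 + 2 * j.+1%:R) <= grid p0 p ^+ 2.
  rewrite /grid expr_div_n sqr_sqrtr; last by rewrite divr_ge0// ltW.
  rewrite -/j -exprM mulnC exprM -(exprVn _ j).
  set x := decay ^- 2 - 1 in x0 x1 *.
  have -> : decay ^- 2 = 1 + x by rewrite /x; ring.
  apply: (@le_trans _ _ (12 / x * (1 + j%:R * x))); last first.
    apply: ler_wpM2l; first by rewrite divr_ge0 ?ltW.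
    by apply: expr_ge1Mn; exact: ltW.
  have -> : 12 / x * (1 + j%:R * x) = 12 / x + 12 * j%:R by field; rewrite gt_eqF.
  have : 12 <= 12 / x by rewrite ler_pdivlMr//; lra.
  by rewrite -natr1; have : 0 <= j%:R :> R by []; lra.
apply: (@le_trans _ _ (expR (- (2 * j.+1)%:R))).
  by rewrite ler_expR natrM; lra.
rewrite expRN lef_pV2 ?posrE ?exprn_gt0 ?expR_gt0//.
have -> : 4 = 2 ^+ 2 :> R by rewrite -natrX.
by rewrite -exprM expRn_ge2n.
Qed.

Lemma grid_tail_half p0 p : expR (1 - grid p0 p ^+ 2 / 4) <= 1 / 2.
Proof.
apply: (le_trans (grid_tail p0 p)); rewrite exprS invfM.
have : (4 ^+ (p - p0))^-1 <= 1 :> R.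
  by rewrite invf_le1 ?exprn_gt0// exprn_ege1// ler1n.
lra.
Qed.

(** Below [p0] the number of increments is small; beyond it the Gaussian tail, of order
    [4 ^- (p - p0)], wins over their number. *)
Lemma level_mass p0 p : 4 * expR (1 - grid p0 p ^+ 2 / 4) * 2 ^+ p <=
  2 ^+ p0 * (3 / 5) ^+ gap p0 p.
Proof.
apply: (@le_trans _ _ (2 ^+ p0 * (1 / 2) ^+ gap p0 p)); last first.
  apply: ler_wpM2l; first exact: exprn_ge0.
  by apply: lerXn2r; rewrite ?nnegrE; lra.
apply: (@le_trans _ _ (4 ^- (p - p0) * 2 ^+ p)).
  apply: ler_wpM2r; first exact: exprn_ge0.
  apply: (le_trans (ler_wpM2l _ (grid_tail p0 p))); first exact: ler0n.
  by rewrite exprS invfM mulrA mulfV ?mul1r.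
rewrite /gap; have [pp|/ltnW pp] := leqP p p0.
  rewrite (eqP (pp : (p - p0 == 0)%N)) expr0 invr1 mul1r add0n.
  rewrite -{1}(subnKC pp) exprD -mulrA div1r exprVn mulfV ?mulr1//.
rewrite (eqP (pp : (p0 - p == 0)%N)) addn0 -{2}(subnKC pp) exprD.
have -> : 4 = 2 * 2 :> R by rewrite -natrM.
rewrite exprMn div1r exprVn le_eqVlt; apply/orP; left; apply/eqP; field.
by rewrite expf_neq0.
Qed.

End Mesh.

(** * Most paths have a neighbourhood of non-negligible mass *)

Lemma inv_one_sub_le (R : realType) (z : R) : 0 <= z -> z <= 1 / 2 ->
  (1 - z)^-1 <= expR (2 * z).
Proof.
move=> z0 z2; apply: le_trans (expR_ge1Dx _).
by rewrite -[leLHS]div1r ler_pdivrMr; [nra|lra].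
Qed.

Lemma gap_le p0 p : (p <= 2 * p0)%N -> (gap p0 p <= p0)%N.
Proof. rewrite /gap; lia. Qed.

Lemma failure_exponent (R : realType) (E M a b k : R) :
  E <= M * a -> 2 * M * a < k + 1 -> b <= M * a -> - k + E <= 1 - b.
Proof. lra. Qed.

Section SmallBalls.
Context {R : realType} {T : R} {d : nat} {alpha : exponent R}.
Hypothesis T_gt0 : 0 < T.
Local Notation C := (holder0 T d alpha).
Variable L : probability (borel C) R.
Hypothesis hL : is_brownian_law L.
Local Notation std := (@increment_std R T).
Local Notation decay := (decay alpha).
Local Notation dmesh := (@mesh R alpha).
Local Notation dgrid := (@grid R alpha).

(** A symbol [b] of level [p] is given the weight [exp (- symbol_cost p0 p * b)].  The
    cost grows beyond [p0] for the [2 ^ p] weights of a level to have a summable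
    total. *)
Definition symbol_cost (p0 p : nat) : nat := (2 * (p - p0)).+1.

(** Below [p0], going from the grid to the finer mesh multiplies the symbols by
    at most [(3 / 2) ^ (p0 - p)], up to one unit for each of the few
    increments.  Beyond [p0] grid and mesh agree, and the cost of a symbol grows
    less than [(3 / 2) ^ (p - p0)].  In both cases the factor [3 / 5] absorbs
    the growth and leaves [9 / 10]. *)
Lemma level_cost p0 p (j : 'I_d) (x : C) :
  (\sum_(l < 2 ^ p) rounded (dgrid p0 p) j p l x)%:R <=
    2 * 2 ^+ p0 * (3 / 5) ^+ gap p0 p :> R ->
  (symbol_cost p0 p)%:R * (\sum_(l < 2 ^ p) rounded (dmesh p0 p) j p l x)%:R <=
    8 * 2 ^+ p0 * (9 / 10) ^+ gap p0 p :> R.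
Proof.
have /andP[d0 d1] := decay_itv alpha; have d23 := decay_ge alpha.
have s0 := increment_std_gt0 T_gt0 p; have g0 := grid_gt0 alpha p0 p.
have M0 : 0 < 2 ^+ p0 :> R by rewrite exprn_gt0.
rewrite /gap; have [pp|pp] := leqP p0 p.
  have e0 : (p0 - p = 0)%N by apply/eqP.
  rewrite e0 addn0; set j' := (p - p0)%N.
  have -> : dmesh p0 p = dgrid p0 p.
    rewrite /mesh /grid -{1}(subnKC pp) exprD.
    by field; rewrite !expf_neq0// gt_eqF.
  move=> h; rewrite /symbol_cost -/j'.
  have c32 : (2 * j').+1%:R <= 4 * (3 / 2) ^+ j' :> R.
    apply: (@le_trans _ _ (4 * (1 + 1 / 2) ^+ j')).
      have h2 : 0 <= 1 / 2 :> R by lra.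
      have := expr_ge1Mn j' h2; rewrite -[(2 * j').+1%:R]natr1 natrM; lra.
    by rewrite (_ : 1 + 1 / 2 = 3 / 2)//; field.
  apply: (le_trans (ler_pM _ _ c32 h)) => //.
  rewrite (_ : 9 / 10 = 3 / 2 * (3 / 5)); last by field.
  by rewrite [(3 / 2 * (3 / 5)) ^+ j']exprMn le_eqVlt; apply/orP; left; apply/eqP; ring.
have e0 : (p - p0 = 0)%N by apply/eqP; rewrite subn_eq0 ltnW.
rewrite e0 add0n /symbol_cost e0 muln0 mul1r; set i := (p0 - p)%N => h.
have di : 0 < decay ^+ i by rewrite exprn_gt0.
have meshE : dmesh p0 p = dgrid p0 p * decay ^+ i.
  rewrite /mesh /grid e0 expr0 divr1 -{1}(subnKC (ltnW pp)) exprD.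
  by field; rewrite expf_neq0// gt_eqF.
have each l : (rounded (dmesh p0 p) j p l x)%:R <=
    ((rounded (dgrid p0 p) j p l x)%:R + 1) / decay ^+ i :> R.
  have z0 : 0 <= `|coordinate_inc j p l x| / (std p * dmesh p0 p).
    by apply: divr_ge0 => //; apply: mulr_ge0; apply: ltW => //; exact: mesh_gt0.
  have /andP[h1 _] := truncn_itv z0; apply: (le_trans h1).
  rewrite meshE mulrA invfM mulrA ler_pM2r ?invr_gt0//.
  by rewrite natr1 ltW// truncnS_gt.
rewrite natr_sum; apply: (le_trans (ler_sum _ (fun l _ => each (nat_of_ord l)))).
rewrite -mulr_suml big_split/= -natr_sum sumr_const card_ord -[_ *+ _]mulr_natl mulr1.
rewrite ler_pdivrMr// natrX.
have p2 : 2 ^+ p <= 2 ^+ p0 * (3 / 5) ^+ i :> R.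
  apply: (@le_trans _ _ (2 ^+ p0 * (1 / 2) ^+ i)).
    rewrite -{1}(subnKC (ltnW pp)) exprD -mulrA div1r exprVn mulfV ?mulr1//.
  by apply: ler_wpM2l; [exact: ltW|apply: lerXn2r; rewrite ?nnegrE; lra].
apply: (le_trans (lerD h p2)); rewrite -mulrDl.
have -> : 2 * 2 ^+ p0 + 2 ^+ p0 = 3 * 2 ^+ p0 :> R by ring.
rewrite -[leRHS]mulrA -exprMn; apply: ler_pM.
- by rewrite mulr_ge0 ?ltW.
- by rewrite exprn_ge0//; lra.
- by apply: ler_wpM2r; [exact: ltW|rewrite ler_nat].
- by apply: lerXn2r; rewrite ?nnegrE; lra.
Qed.

Lemma level_weight p0 p : 2 ^+ p * expR (- (symbol_cost p0 p)%:R) <=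
  2 ^+ p0 * (9 / 10) ^+ gap p0 p :> R.
Proof.
apply: (@le_trans _ _ (2 ^+ p0 * (1 / 2) ^+ gap p0 p)); last first.
  apply: ler_wpM2l; first exact: exprn_ge0.
  by apply: lerXn2r; rewrite ?nnegrE; lra.
rewrite /gap /symbol_cost; have [pp|/ltnW pp] := leqP p p0.
  have -> : (p - p0 = 0)%N by apply/eqP.
  rewrite muln0 add0n -{1}(subnKC pp) exprD -mulrA div1r exprVn mulfV ?expf_neq0//.
  by rewrite mulr1 ler_piMr ?exprn_ge0// expR_le1 oppr_le0.
have -> : (p0 - p = 0)%N by apply/eqP.
rewrite addn0; set j := (p - p0)%N.
apply: (@le_trans _ _ (2 ^+ p * (1 / 4) ^+ j)).
  apply: ler_wpM2l; first exact: exprn_ge0.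
  rewrite expRN div1r exprVn lef_pV2 ?posrE ?exprn_gt0 ?expR_gt0//.
  apply: le_trans (expRn_ge2n _); rewrite exprS (_ : 4 = 2 ^+ 2 :> R); last by rewrite -natrX.
  by rewrite -exprM ler_peMl ?exprn_ge0// ler1n.
rewrite -{1}(subnKC pp) exprD -/j -mulrA; apply: ler_wpM2l; first exact: exprn_ge0.
by rewrite -exprMn (_ : 2 * (1 / 4) = 1 / 2)//; field.
Qed.

Lemma sum_code_index P (F : code_index P -> R) :
  \sum_i F i = \sum_(p < P.+1) \sum_(l < 2 ^ p)
    (F (Tagged (fun p : 'I_P.+1 => ('I_(2 ^ p) * bool)%type) (l, true)) +
     F (Tagged (fun p : 'I_P.+1 => ('I_(2 ^ p) * bool)%type) (l, false))).
Proof.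
pose J (p : 'I_P.+1) : finType := ('I_(2 ^ p) * bool)%type.
transitivity (\sum_(p < P.+1) \sum_(ls : J p) F (Tagged J ls)).
  rewrite (sig_big_dep (J := J) xpredT (fun _ => xpredT) (fun p ls => F (Tagged J ls))).
  by apply: eq_bigr => -[p ls].
apply: eq_bigr => p _.
transitivity (\sum_(l < 2 ^ p) \sum_(s : bool) F (Tagged J (l, s))); last first.
  by apply: eq_bigr => l _; rewrite big_bool.
by rewrite pair_bigA; apply: eq_bigr => -[l s].
Qed.

(** The increments of coordinate [j0] of the path in the set are compared with those
    of coordinate [j] of [x]. *)
Definition close_paths (j0 j : 'I_d) p0 P (x : C) : set (borel C) :=
  [set y : borel C | forall p l, (p <= P)%N -> (l < 2 ^ p)%N ->
     `|coordinate_inc j0 p l y - coordinate_inc j p l x| <= 2 * (std p * dmesh p0 p)].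

Lemma measurable_close_paths j0 j p0 P x : measurable (close_paths j0 j p0 P x).
Proof.
have -> : close_paths j0 j p0 P x =
  \bigcap_(p in [set p | (p < P.+1)%N]) \bigcap_(l in [set l | (l < 2 ^ p)%N])
    (setT `&` (fun y : borel C => `|coordinate_inc j0 p l y - coordinate_inc j p l x|) @^-1`
       `]-oo, 2 * (std p * dmesh p0 p)]).
  apply/seteqP; split=> y /= yx p.
    by move=> pP l lp; split=> //=; rewrite in_itv/=; exact: yx.
  by move=> l pP lp; have [_] := yx p pP l lp; rewrite /= in_itv.
apply: fin_bigcap_measurable; first exact: finite_II.
move=> p _; apply: fin_bigcap_measurable; first exact: finite_II.
move=> l lp; have mc := measurable_coordinate_inc T_gt0 j0 lp (alpha := alpha).
have mf : measurable_fun setT (fun y : borel C => `|coordinate_inc j0 p l y - coordinate_inc j p l x|).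
  by apply: measurableT_comp => //; apply: measurable_funB.
exact: mf.
Qed.

(** The weights of all codes sum to at most [exp (80 * 2 ^ p0)], so with
    [theta = exp (- 160 * 2 ^ p0)] the rare codes have probability at most
    [exp (- 80 * 2 ^ p0)].  On each level the rounded increments exceed twice
    their typical size with a very small probability; otherwise the total cost
    of the code is at most [160 * 2 ^ p0], and its cell has probability at least
    [theta * exp (- 160 * 2 ^ p0)]. *)
Lemma small_ball (j0 j : 'I_d) p0 P : (P <= 2 * p0)%N ->
  exists U : set (borel C), [/\ measurable U,
    (L U <= (expR (- (80 * 2 ^+ p0)) + P.+1%:R * expR (1 - (6 / 5) ^+ p0))%:E)%E &
    forall x : C, ~ U x -> ((expR (- (320 * 2 ^+ p0)))%:E <=
      L (close_paths j0 j p0 P x))%E].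
Proof.
move=> Pp0; pose M0 : R := 2 ^+ p0; have M00 : 0 < M0 by rewrite exprn_gt0.
pose cost p : R := (symbol_cost p0 p)%:R.
pose z (i : code_index P) : R := expR (- cost (tag i)).
have z01 i : 0 <= z i < 1.
  by rewrite expR_ge0 expR_lt1 oppr_lt0 ltr0n.
pose theta := expR (- (160 * M0)).
pose B := (Num.truncn (160 * M0)).+1.
have [U1 [mU1 LU1 hU1]] := rare_codes
  (code := symbol (dmesh p0) j0 (P := P) : borel C -> _)
  (fun i m => measurable_symbol T_gt0 (dmesh p0) j i m)
  (fun k => symbol_law_eq T_gt0 hL (dmesh p0) j0 j k) B z01 (expR_ge0 _ : 0 <= theta).
(* Twice the bound of [level_mass]; beyond it the large deviation bound
   applies. *)
pose K p : nat := Num.truncn (2 * M0 * (3 / 5 : R) ^+ gap p0 p).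
pose H p : set (borel C) :=
  [set x | (K p <= \sum_(l < 2 ^ p) rounded (dgrid p0 p) j p l x)%N].
have mH p : measurable (H p) by exact: measurable_sum_rounded.
pose U2 : set (borel C) := \bigcup_(p : 'I_P.+1) H p.
have mU2 : measurable U2 by apply: fin_bigcup_measurable => //; exact: finite_finset.
exists (U1 `|` U2); split; first exact: measurableU.
- apply: (le_trans (measureU2 L mU1 mU2)); rewrite EFinD; apply: leeD.
    apply: (le_trans LU1); rewrite lee_fin.
    have -> : - (80 * 2 ^+ p0) = - (160 * M0) + 80 * M0 :> R by rewrite /M0; ring.
    rewrite expRD; apply: ler_wpM2l; first exact: expR_ge0.
    apply: (@le_trans _ _ (\prod_(i : code_index P) expR (2 * z i))).
      apply: ler_prod => i _; have /andP[z0 z1] := z01 i.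
      rewrite invr_ge0 subr_ge0 ltW//=; apply: inv_one_sub_le => //.
      have z2 : z i <= 1 / 2.
        have h1 : expR (-1) <= 1 / 2 :> R.
          by rewrite expRN div1r lef_pV2 ?posrE ?expR_gt0// expR1_ge2.
        by apply: le_trans h1; rewrite ler_expR lerN2 ler1n.
      exact: z2.
    rewrite -expR_sum ler_expR sum_code_index.
    apply: (@le_trans _ _ (\sum_(p < P.+1) 4 * M0 * (9 / 10) ^+ gap p0 p)).
      apply: ler_sum => p _; rewrite /z /=.
      rewrite sumr_const card_ord -[_ *+ (2 ^ p)]mulr_natl natrX.
      have := level_weight p0 p; rewrite -/M0 /cost; move: (expR _) => e.
      by move: (_ ^+ gap p0 p) (2 ^+ p) => u v; lra.
    rewrite -mulr_sumr; apply: (le_trans (ler_wpM2l _ (sum_gap_le p0 P.+1 _))).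
    - by rewrite mulr_ge0 ?(ltW M00).
    - by lra.
    - by rewrite (_ : 2 / (1 - 9 / 10) = 20); [lra|field].
  apply: (le_trans (finite_union_bound L mU2 (fun p : 'I_P.+1 => mH p) (@subset_refl _ _))).
  apply: (@le_trans _ _ (\sum_(p < P.+1) (expR (1 - (6 / 5) ^+ p0))%:E)%E).
    apply: lee_sum => p _.
    apply: (le_trans (rounded_sum_tail T_gt0 hL j p (K p) (grid_gt0 alpha p0 p)
      (grid_tail_half alpha p0 p))).
    rewrite lee_fin ler_expR.
    have := level_mass alpha p0 p; set E := 4 * _ * _ => hE.
    have k0 : 0 <= 2 * M0 * (3 / 5) ^+ gap p0 p.
      by rewrite !mulr_ge0 ?exprn_ge0// ?(ltW M00)//; lra.
    have /andP[_ hK] := truncn_itv k0; rewrite -/(K p) -[(K p).+1%:R]natr1 in hK.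
    have hM : (6 / 5) ^+ p0 <= M0 * (3 / 5) ^+ gap p0 p.
      have -> : 6 / 5 = 2 * (3 / 5) :> R by field.
      rewrite exprMn; apply: ler_wpM2l; first exact: ltW.
      apply: ler_wiXn2l; [lra|lra|rewrite /gap].
      by apply: gap_le; apply: leq_trans Pp0; rewrite -ltnS.
    exact: failure_exponent hE hK hM.
  by rewrite sumEFin sumr_const card_ord -[_ *+ _]mulr_natl.
- move=> x Ux.
  have Hx p : (p <= P)%N -> (\sum_(l < 2 ^ p) rounded (dgrid p0 p) j p l x < K p)%N.
    move=> pP; rewrite ltnNge; apply/negP => h; apply: Ux; right.
    by exists (Ordinal (pP : (p < P.+1)%N)).
  have total : \sum_(i : code_index P) cost (tag i) * (symbol (dmesh p0) j x i)%:R <= 160 * M0.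
    rewrite sum_code_index; apply: (@le_trans _ _ (\sum_(p < P.+1) 8 * M0 * (9 / 10) ^+ gap p0 p)).
      apply: ler_sum => p _; rewrite /=.
      have kx : (\sum_(l < 2 ^ p) rounded (dgrid p0 p) j p l x)%:R <=
          2 * 2 ^+ p0 * (3 / 5) ^+ gap p0 p :> R.
        have := Hx p (ltn_ord p); rewrite /K => /ltnW; rewrite truncn_ge_nat//.
        by rewrite !mulr_ge0 ?exprn_ge0// ?(ltW M00)//; lra.
      apply: le_trans (level_cost kx); rewrite natr_sum mulr_sumr; apply: ler_sum => l _.
      rewrite -mulrDr -natrD; apply: ler_wpM2l; first exact: ler0n.
      rewrite ler_nat /symbol/= expr0 expr1 mul1r mulN1r addnC truncn_normr.
      rewrite /rounded normrM [`|_^-1|]ger0_norm// invr_ge0.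
      by rewrite mulr_ge0// ltW ?increment_std_gt0 ?mesh_gt0.
    rewrite -mulr_sumr; apply: (le_trans (ler_wpM2l _ (sum_gap_le p0 P.+1 _))).
    - by rewrite mulr_ge0 ?(ltW M00).
    - by lra.
    - by rewrite (_ : 2 / (1 - 9 / 10) = 20); [lra|field].
  have symB (i : code_index P) : (symbol (dmesh p0) j x i < B)%N.
    rewrite -(ltr_nat R); apply: le_lt_trans (truncnS_gt _).
    apply: le_trans total; rewrite (bigD1 i)//= ler_wpDr//.
      by apply: sumr_ge0 => k _; rewrite mulr_ge0.
    by rewrite ler_peMl// ler1n.
  have U1x : ~ U1 x by move=> h; apply: Ux; left.
  apply: le_trans (le_trans _ (hU1 x U1x symB)) _.
    rewrite lee_fin /theta (eq_bigr (fun i : code_index P =>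
      expR (- (cost (tag i) * (symbol (dmesh p0) j x i)%:R)))); last first.
      by move=> i _; rewrite /z -expRM_natr mulNr.
    rewrite -expR_sum -expRD ler_expR sumrN -/M0 (_ : 320 = 160 + 160); last by ring.
    by rewrite mulrDl opprD lerD2l lerN2.
  apply: le_measure; rewrite ?inE.
  + by apply: measurable_cell => i m; exact: measurable_symbol.
  + exact: measurable_close_paths.
  + move=> y /= xy p l pP lp.
    pose J (p : 'I_P.+1) : finType := ('I_(2 ^ p) * bool)%type.
    pose i b : code_index P := Tagged J ((Ordinal lp, b) : J (Ordinal (pP : (p < P.+1)%N))).
    have sm : 0 < std p * dmesh p0 p by rewrite mulr_gt0 ?increment_std_gt0 ?mesh_gt0.
    have := xy (i false); have := xy (i true); rewrite /symbol/= expr0 expr1 !mulN1r !mul1r.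
    move=> h1 h2; have := truncn_close h2 h1.
    by rewrite -mulrBl normrM [`|_^-1|]gtr0_norm ?invr_gt0// ler_pdivrMr.
Qed.
End SmallBalls.

(** * Exchanging a code point *)

Section Swap.
Context {R : realType} {E : normedModType R} {d} {Om : measurableType d}.
Variables (P : probability Om R) (Phi : Om -> E).
Hypothesis mPhi : measurable_fun setT (Phi : Om -> borel E).
Variables (n : nat) (c : 'I_n -> E) (S : 'I_n -> set E) (m : R).
Hypotheses (minc : is_mse_minimiser (pushforward P (Phi : Om -> borel E)) c)
  (vorS : is_voronoi c S) (m_ge0 : 0 <= m)
  (Phi_m : (\int[P]_x (`|Phi x| ^+ 2)%:E <= m%:E)%E).

Definition distortion (c' : 'I_n -> E) (y : E) : \bar R :=
  (\big[mine/+oo]_(i < n) (`|y - c' i| ^+ 2)%:E)%E.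

Lemma distortion_le c' y i : (distortion c' y <= (`|y - c' i| ^+ 2)%:E)%E.
Proof. exact: bigmin_le. Qed.

Lemma distortion_ge c' y (u : R) : (forall i, u <= `|y - c' i| ^+ 2) ->
  (u%:E <= distortion c' y)%E.
Proof. by move=> uc; apply: le_bigmin => [|i _]; rewrite ?leey// lee_fin. Qed.

Lemma distortion_ge0 c' y : (0 <= distortion c' y)%E.
Proof. by apply: distortion_ge => i; exact: sqr_ge0. Qed.

Let measurable_dist z : measurable_fun setT (fun x => `|Phi x - z|).
Proof.
have h : continuous (fun y : E => `|y - z|).
  move=> y; apply: (@cvg_norm _ E); apply: (@cvgB _ E) => //; exact: cvg_cst.
exact: (measurableT_comp (continuous_borel_real h) mPhi).
Qed.

Let measurable_distortion c' : measurable_fun setT (distortion c' \o Phi).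
Proof.
rewrite /distortion /comp; elim: (index_enum _) => [|i s IH].
  by under eq_fun do rewrite big_nil; exact: measurable_cst.
under eq_fun do rewrite big_cons; apply: measurable_mine => //.
by apply/measurable_EFinP; apply: measurable_funX.
Qed.

Lemma mean_square_errorE c' : mean_square_error (pushforward P (Phi : Om -> borel E)) c' =
  (\int[P]_x distortion c' (Phi x))%E.
Proof.
rewrite /mean_square_error.
have md : measurable_fun setT (distortion c' : borel E -> \bar R).
  rewrite /distortion; elim: (index_enum _) => [|i s IH].
    by under eq_fun do rewrite big_nil; exact: measurable_cst.
  under eq_fun do rewrite big_cons; apply: measurable_mine => //.
  apply/measurable_EFinP; apply: measurable_funX.
  apply: (@continuous_borel_real _ E) => y.
  by apply: (@cvg_norm _ E); apply: (@cvgB _ E) => //; exact: cvg_cst.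
have := ge0_integral_pushforward mPhi P measurableT md (fun y _ => distortion_ge0 c' y).
by rewrite preimage_setT.
Qed.

Let msqr z : measurable_fun setT (fun x => (`|Phi x - z| ^+ 2)%:E).
Proof. by apply/measurable_EFinP; apply: measurable_funX. Qed.

Let distortion_min c' : (\int[P]_x distortion c (Phi x) <= \int[P]_x distortion c' (Phi x))%E.
Proof. by rewrite -!mean_square_errorE; exact: minc. Qed.

Let sqr_norm_sub (y z : E) : `|y - z| ^+ 2 <= 2 * `|y| ^+ 2 + 2 * `|z| ^+ 2.
Proof.
have h := ler_normB y z; have h0 := normr_ge0 (y - z).
by move: `|y - z| `|y| `|z| h h0 => a b e h h0; have := sqr_ge0 (b - e); nra.
Qed.

Let mean_distortion_le : (0 < n)%N -> (\int[P]_x distortion c (Phi x) <= m%:E)%E.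
Proof.
move=> n0; apply: (le_trans (distortion_min (fun=> 0))); apply: le_trans Phi_m.
apply: ge0_le_integral => //.
- by move=> x _; exact: distortion_ge0.
- exact: measurable_distortion.
- by have := msqr 0; under eq_fun do rewrite subr0.
- by move=> x _; have := distortion_le (fun=> 0) (Phi x) (Ordinal n0); rewrite subr0.
Qed.

(** For the code point nearest to [Phi x], and hence for the one of smallest norm,
    [|c i| ^ 2 <= 2 * |Phi x - c i| ^ 2 + 2 * |Phi x| ^ 2].  Both terms have mean at
    most [2 * m], the first by comparison with a code reduced to [0]. *)
Lemma central_code_point : (0 < n)%N -> exists j0, `|c j0| ^+ 2 <= 4 * m.
Proof.
move=> n0; have [j0 _ hj0] := arg_minP (fun i => `|c i|) (isT : xpredT (Ordinal n0)).
exists j0; rewrite -lee_fin.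
have mN : measurable_fun setT (fun x => (`|Phi x| ^+ 2)%:E).
  by have := msqr 0; under eq_fun do rewrite subr0.
have -> : (`|c j0| ^+ 2)%:E = (\int[P]_x (cst (`|c j0| ^+ 2)%:E x))%E.
  by rewrite integral_cst// [X in (_ * X)%E]probability_setT mule1.
apply: (@le_trans _ _ (\int[P]_x (2%:E * distortion c (Phi x) + 2%:E * (`|Phi x| ^+ 2)%:E))%E).
  apply: ge0_le_integral => //.
  - by move=> x _; rewrite lee_fin sqr_ge0.
  - by apply: emeasurable_funD; apply: emeasurable_funM => //; exact: measurable_distortion.
  - move=> x _ /=; rewrite -EFinM -leeBlDr// -EFinB.
    have h : forall i, (`|c j0| ^+ 2 - 2 * `|Phi x| ^+ 2) / 2 <= `|Phi x - c i| ^+ 2.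
      move=> i; have hi := hj0 i isT.
      have h1 : `|c i| <= `|Phi x| + `|Phi x - c i|.
        by rewrite -[X in `|X| <= _](subKr (Phi x)) ler_normB.
      have h2 := le_trans hi h1; rewrite ler_pdivrMr//.
      move: (`|c j0|) (`|Phi x|) (`|Phi x - c i|) h2 (normr_ge0 (c j0)) => a b e h2 h3.
      by have := sqr_ge0 (b - e); nra.
    have := distortion_ge h; move=> /(lee_wpmul2l (_ : (0 <= 2%:E)%E)).
    by rewrite -EFinM mulrC divfK//; apply; rewrite lee_fin.
rewrite ge0_integralD//; last 3 first.
- by move=> x _; rewrite mule_ge0 ?distortion_ge0.
- by apply: emeasurable_funM => //; exact: measurable_distortion.
- exact: emeasurable_funM.
rewrite !ge0_integralZl//; last 2 first.
- exact: measurable_distortion.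
- by move=> x _; exact: distortion_ge0.
apply: le_trans (leeD (lee_wpmul2l _ (mean_distortion_le n0)) (lee_wpmul2l _ Phi_m)) _ => //.
by rewrite -!EFinM -EFinD lee_fin; lra.
Qed.

(** Sending a whole cell to the central code point costs the mean of
    [|Phi x - c j0| ^ 2] over the cell.  These costs add up to at most [10 * m], so
    one of the [n - 1] other cells costs at most [10 * m / (n - 1)].  Moving its
    code point to [y] improves the distortion in the ball about [y], and the
    minimality of the code bounds the gain by the cost. *)
Lemma distortion_swap (y : E) (rho : R) : (1 < n)%N -> 0 <= rho ->
  (forall i, rho <= `|y - c i|) ->
  ((rho ^+ 2 / 2)%:E * P [set x | (`|Phi x - y| <= rho / 4)%R] <= (10 * m / n.-1%:R)%:E)%E.
Proof.
move=> n1 rho0 rhoc; have [j0 cj0] := central_code_point (ltnW n1).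
case: vorS => mS tS cS nS.
pose h i x := ((`|Phi x - c j0| ^+ 2)%:E * (\1_(Phi @^-1` S i) x)%:E)%E.
have mSi i : measurable (Phi @^-1` S i) by rewrite -[X in measurable X]setTI; exact: mPhi.
have mh i : measurable_fun setT (h i) by apply: emeasurable_funM => //; exact/measurable_EFinP.
have h0 i x : (0 <= h i x)%E by rewrite mule_ge0// lee_fin ?sqr_ge0.
have sumh : (\sum_(i < n) \int[P]_x h i x <= (10 * m)%:E)%E.
  rewrite -ge0_integral_sum//.
  apply: (@le_trans _ _ (\int[P]_x (2%:E * (`|Phi x| ^+ 2)%:E + (8 * m)%:E))%E).
    have mN : measurable_fun setT (fun x => (`|Phi x| ^+ 2)%:E).
      by have := msqr 0; under eq_fun do rewrite subr0.
    apply: ge0_le_integral => //.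
    - by move=> x _; exact: sume_ge0.
    - exact: emeasurable_sum.
    - by apply: emeasurable_funD => //; exact: emeasurable_funM.
    - move=> x _; have [k _ Sk] : (\bigcup_i S i) (Phi x) by rewrite cS.
      rewrite (bigD1 k)//= big1 ?adde0; last first.
        move=> i ik; rewrite /h indicE memNset ?mule0// => Si.
        by move/trivIsetP : tS => /(_ i k I I ik) /seteqP[/(_ (Phi x) (conj Si Sk))].
      rewrite /h indicE mem_set// mule1 -EFinM -EFinD lee_fin.
      by apply: (le_trans (sqr_norm_sub _ _)); rewrite lerD2l; lra.
  have mN : measurable_fun setT (fun x => (`|Phi x| ^+ 2)%:E).
    by have := msqr 0; under eq_fun do rewrite subr0.
  rewrite ge0_integralD//; try by [move=> x _; rewrite mule_ge0|exact: emeasurable_funM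
    |move=> x _; rewrite lee_fin mulr_ge0].
  rewrite ge0_integralZl// integral_cst// [X in (_ + _ * X)%E]probability_setT mule1.
  apply: le_trans (leeD (lee_wpmul2l _ Phi_m) (lexx _)) _ => //.
  by rewrite -EFinM -EFinD lee_fin; lra.
(* The cell whose code point is given up. *)
have [i ij0 hi] : exists2 i, i != j0 & (\int[P]_x h i x <= (10 * m / n.-1%:R)%:E)%E.
  apply: contrapT => no; have n0 : (0 < n.-1)%N by rewrite -ltnS prednK// ltnW.
  have gt i : i != j0 -> ((10 * m / n.-1%:R)%:E < \int[P]_x h i x)%E.
    by move=> ij; rewrite ltNge; apply/negP => hi; apply: no; exists i.
  have [i1 i1j] : exists i1 : 'I_n, i1 != j0.
    have : (0 < #|[pred i : 'I_n | i != j0]|)%N.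
      have := cardC1 j0; rewrite card_ord => e.
      by rewrite (eq_card (B := predC1 j0))// e.
    by move=> /card_gt0P[i1 hi1]; exists i1.
  have : (\sum_(i < n | i != j0) (10 * m / n.-1%:R)%:E < (10 * m)%:E)%E.
    apply: lt_le_trans sumh; rewrite [ltRHS](bigD1 j0)//= -[ltLHS]add0e.
    apply: lee_ltD => //; first exact: integral_ge0.
    rewrite [ltLHS](bigD1 i1)//= [ltRHS](bigD1 i1)//=; apply: lte_leD.
    - by rewrite sumEFin.
    - exact: gt.
    - by apply: lee_sum => i /andP[ij _]; exact/ltW/gt.
  rewrite sumEFin sumr_const (eq_card (B := predC1 j0))// cardC1 card_ord.
  by rewrite -[_ *+ _]mulr_natr divfK ?ltxx// pnatr_eq0 -lt0n.
pose B := [set x | `|Phi x - y| <= rho / 4].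
have mB : measurable B.
  rewrite -[B]setTI (_ : B = (fun x => `|Phi x - y|) @^-1` `]-oo, rho / 4]).
    exact: measurable_dist.
  by apply/seteqP; split=> x /=; rewrite in_itv.
(* The exchanged code. *)
pose c' k := if k == i then y else c k.
have pointwise x : (distortion c' (Phi x) + (rho ^+ 2 / 2)%:E * (\1_B x)%:E <=
    distortion c (Phi x) + h i x)%E.
  have [Bx|nBx] := pselect (B x).
    rewrite indicE mem_set// mule1.
    (* In the ball, [Phi x] is at distance at most [rho / 4] of [y] and at least
       [3 / 4 * rho] of the old code points, and [1 / 16 + 1 / 2 = 9 / 16]. *)
    apply: (@le_trans _ _ ((3 / 4 * rho) ^+ 2)%:E).
      apply: (@le_trans _ _ ((rho / 4) ^+ 2 + rho ^+ 2 / 2)%:E); last first.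
        by rewrite lee_fin; nra.
      rewrite EFinD; apply: leeD => //; apply: (le_trans (distortion_le c' (Phi x) i)).
      by rewrite /c' eqxx lee_fin lerXn2r ?nnegrE ?divr_ge0.
    rewrite -[leLHS]adde0; apply: leeD => //; apply: distortion_ge => k.
    apply: lerXn2r; rewrite ?nnegrE ?mulr_ge0//.
    have h1 : `|y - c k| <= `|Phi x - y| + `|Phi x - c k|.
      by rewrite -[y - c k](subrKA (Phi x)) (le_trans (ler_normD _ _))// [`|y - _|]distrC.
    by have h2 := rhoc k; move: Bx; rewrite /B/= => h3; lra.
  rewrite indicE memNset// mule0 adde0.
  have [k _ Sk] : (\bigcup_i S i) (Phi x) by rewrite cS.
  have [ki|ki] := eqVneq k i.
    rewrite -[leLHS]add0e; apply: leeD; first exact: distortion_ge0.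
    apply: (le_trans (distortion_le c' (Phi x) j0)).
    by rewrite /c' eq_sym (negbTE ij0) /h indicE mem_set ?mule1// -ki.
  rewrite -[leLHS]adde0; apply: leeD => //; apply: (le_trans (distortion_le c' (Phi x) k)).
  rewrite /c' (negbTE ki); apply: distortion_ge => l.
  by apply: lerXn2r; rewrite ?nnegrE//; exact: nS.
have intB : (\int[P]_x ((rho ^+ 2 / 2)%:E * (\1_B x)%:E) = (rho ^+ 2 / 2)%:E * P B)%E.
  rewrite ge0_integralZl//; last by rewrite lee_fin divr_ge0 ?sqr_ge0.
    by rewrite integral_indic// setIT.
  exact/measurable_EFinP.
have step : (\int[P]_x distortion c' (Phi x) + (rho ^+ 2 / 2)%:E * P B <=
    \int[P]_x distortion c (Phi x) + \int[P]_x h i x)%E.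
  have r0 : (0 <= (rho ^+ 2 / 2)%:E)%E by rewrite lee_fin divr_ge0 ?sqr_ge0.
  have mB1 : measurable_fun setT (fun x => (rho ^+ 2 / 2)%:E * (\1_B x)%:E)%E.
    by apply: emeasurable_funM => //; exact/measurable_EFinP.
  have b0 x : (0 <= (rho ^+ 2 / 2)%:E * (\1_B x)%:E)%E by rewrite mule_ge0// lee_fin.
  rewrite -intB -!ge0_integralD//; try by move=> x _; exact: distortion_ge0.
  - apply: ge0_le_integral => //.
    + by move=> x _; rewrite adde_ge0 ?distortion_ge0.
    + by apply: emeasurable_funD => //; exact: measurable_distortion.
    + by apply: emeasurable_funD => //; exact: measurable_distortion.
  - exact: measurable_distortion.
  - exact: measurable_distortion.
have := le_trans step (leeD (distortion_min c') hi).
have i0 : (0 <= \int[P]_x distortion c' (Phi x))%E.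
  by apply: integral_ge0 => x _; exact: distortion_ge0.
have ifin : (\int[P]_x distortion c' (Phi x) < +oo)%E.
  apply: le_lt_trans (_ : (m + 10 * m / n.-1%:R)%:E < _)%E; last exact: ltry.
  rewrite EFinD; apply: le_trans (leeD (mean_distortion_le (ltnW n1)) hi).
  apply: le_trans step; rewrite -[leLHS]adde0; apply: leeD => //.
  by rewrite mule_ge0// lee_fin divr_ge0 ?sqr_ge0.
by rewrite leeD2lE// ge0_fin_numE.
Qed.
End Swap.

(** * Asymptotic comparisons *)

Lemma double_succ_le p : ((2 * p).+1 <= 4 * p.+1)%N.
Proof. lia. Qed.

Lemma succ2_le l : (l.+2 <= 4 * l.+1)%N.
Proof. lia. Qed.

Section Comparison.
Context {R : realType}.

(** The integral of a nonnegative function is the supremum of the integrals of the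
    simple functions below it, and this supremum is monotone for arbitrary
    functions. *)
Lemma ge0_le_integral_any d (Om : measurableType d) (mu : {measure set Om -> \bar R})
    (f g : Om -> \bar R) : (forall x, 0 <= f x)%E -> (forall x, f x <= g x)%E ->
  (\int[mu]_x f x <= \int[mu]_x g x)%E.
Proof.
move=> f0 fg; have g0 x : (0 <= g x)%E := le_trans (f0 x) (fg x).
rewrite !ge0_integralTE//; apply: le_ereal_sup => _ [h hf <-].
by exists h => // x; exact: le_trans (hf x) (fg x).
Qed.

(** A superior limit below [k + 1] bounds the quotients eventually; where [g]
    vanishes the quotient is infinite unless [f] vanishes too. *)
Lemma lesssim_near (f g : nat -> R) : (forall n, 0 <= f n) -> (forall n, 0 <= g n) ->
  lesssim (fun n => (f n)%:E) (fun n => (g n)%:E) ->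
  exists2 k : R, 0 < k & \forall n \near \oo, f n <= k * g n.
Proof.
move=> f0 g0 [k [k0 hk]]; exists (k + 1); first by rewrite addr_gt0.
have : (limn_esup (fun n => (f n)%:E / (g n)%:E) < (k + 1)%:E)%E.
  by apply: (le_lt_trans hk); rewrite lte_fin ltrDl.
move=> /ereal_inf_lt[_ [V FV <-] ltV]; apply: filterS FV => n Vn.
have : ((f n)%:E / (g n)%:E < (k + 1)%:E)%E.
  by apply: le_lt_trans ltV; apply: ereal_sup_ubound; exists n.
have [gn0|gn0] := eqVneq (g n) 0.
  rewrite gn0 mulr0 inve0; have [->//|fn0] := eqVneq (f n) 0.
  rewrite gt0_muley; last by rewrite lte_fin lt_def fn0 f0.
  by rewrite ltNge leey.
rewrite inver (negbTE gn0) -EFinM lte_fin => /ltW.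
by rewrite ler_pdivrMr// lt_def gn0 g0.
Qed.

Lemma near_lesssim (f : nat -> \bar R) (g : nat -> R) (k : R) : 0 < k ->
  (\forall n \near \oo, 0 < g n /\ (f n <= (k * g n)%:E)%E) ->
  lesssim f (fun n => (g n)%:E).
Proof.
move=> k0 fg; exists k; split=> //.
apply: (@le_trans _ _ (ereal_sup ((fun n => f n / (g n)%:E)%E @`
    [set n | 0 < g n /\ (f n <= (k * g n)%:E)%E]))).
  by apply: ereal_inf_lbound; exists [set n | 0 < g n /\ (f n <= (k * g n)%:E)%E].
apply: ge_ereal_sup => _ [n [gn fn] <-].
rewrite inver gt_eqF// lee_pdivrMr// -EFinM//.
Qed.

(** By Bernoulli's inequality [q ^- 2] has powers growing at least linearly. *)
Lemma exp_sqrt_bound (q : R) : 0 < q < 1 ->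
  exists2 D : R, 0 < D & forall p, q ^+ p * Num.sqrt p.+1%:R <= D.
Proof.
move=> /andP[q0 q1]; have q2 : 0 < q ^+ 2 < 1 by rewrite exprn_gt0//= expr_lt1// ltW.
have /andP[q20 q21] := q2; pose x := (q ^+ 2)^-1 - 1.
have x0 : 0 < x by rewrite subr_gt0 invf_gt1.
have D0 : 0 < 1 + x^-1 by rewrite addr_gt0 ?invr_gt0.
exists (Num.sqrt (1 + x^-1)); first by rewrite sqrtr_gt0.
move=> p; rewrite -[q ^+ p]ger0_norm ?exprn_ge0 ?(ltW q0)// -sqrtr_sqr -sqrtrM ?sqr_ge0//.
apply: ler_wsqrtr; rewrite -exprM mulnC exprM.
rewrite mulrC -ler_pdivlMr ?exprn_gt0// -exprVn.
have -> : (q ^+ 2)^-1 = 1 + x by rewrite /x; ring.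
apply: (@le_trans _ _ ((1 + x^-1) * (1 + p%:R * x))).
  have -> : (1 + x^-1) * (1 + p%:R * x) = p.+1%:R + x^-1 + p%:R * x.
    by rewrite -natr1; field; rewrite gt_eqF.
  by rewrite -addrA lerDl addr_ge0 ?invr_ge0 ?mulr_ge0// ltW.
by apply: ler_wpM2l; [exact: ltW|apply: expr_ge1Mn; exact: ltW].
Qed.

Lemma sqrt_natD_le (a b : nat) : (0 < a)%N ->
  Num.sqrt (a + b)%:R <= Num.sqrt a%:R * Num.sqrt b.+1%:R :> R.
Proof.
move=> a0; rewrite -sqrtrM ?ler0n//; apply: ler_wsqrtr; rewrite -natrM ler_nat.
by rewrite mulnS leq_add2l leq_pmull.
Qed.

Lemma sqrt_nat_le4 (a b : nat) : (a <= 4 * b)%N ->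
  Num.sqrt a%:R <= 2 * Num.sqrt b%:R :> R.
Proof.
move=> ab; have e2 : 2 = Num.sqrt (2 ^+ 2) :> R by rewrite sqrtr_sqr ger0_norm.
by rewrite e2 -sqrtrM ?sqr_ge0//; apply: ler_wsqrtr; rewrite -natrX -natrM ler_nat.
Qed.

Lemma tail_level_bound (q D : R) N p : 0 < q < 1 ->
  (forall p, q ^+ p * Num.sqrt p.+1%:R <= D) -> (0 < N)%N -> (N < p)%N ->
  q ^+ p * Num.sqrt p.+1%:R <= 2 * D * (Num.sqrt N%:R * q ^+ N).
Proof.
move=> /andP[q0 q1] qD N0 Np; rewrite -{1 2}(subnKC (ltnW Np)); set l := (p - N)%N.
rewrite exprD -addnS.
apply: (le_trans (ler_wpM2l _ (sqrt_natD_le l.+1 N0))).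
  by rewrite mulr_ge0 ?exprn_ge0// ltW.
have h2 : Num.sqrt l.+2%:R <= 2 * Num.sqrt l.+1%:R :> R.
  exact: sqrt_nat_le4 (succ2_le l).
have n0 : 0 <= Num.sqrt N%:R * q ^+ N by rewrite mulr_ge0 ?sqrtr_ge0 ?exprn_ge0// ltW.
have hl : q ^+ l * Num.sqrt l.+2%:R <= 2 * D.
  apply: (le_trans (ler_wpM2l (exprn_ge0 l (ltW q0)) h2)).
  by rewrite mulrCA; apply: ler_wpM2l.
rewrite mulrC [leRHS]mulrC; apply: le_trans (ler_wpM2l n0 hl).
by rewrite le_eqVlt; apply/orP; left; apply/eqP; ring.
Qed.

(** If [N >= 2 * p] then [sqrt N * q ^ N] is smaller than [q ^ p] by a factor
    [O(sqrt q ^ p)], which for large [p] contradicts the assumed lower bound. *)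
Lemma truncation_level_le (q k : R) : 0 < q < 1 -> 0 < k ->
  exists p1, forall p N, (p1 <= p)%N -> q ^+ p <= k * (Num.sqrt N%:R * q ^+ N) ->
    (N.+1 <= 2 * p)%N.
Proof.
move=> /[dup] q01 /andP[q0 q1] k0; have [D D0 qD] := exp_sqrt_bound q01.
pose s := Num.sqrt q; have s2 : s ^+ 2 = q by rewrite sqr_sqrtr// ltW.
have s01 : 0 < s < 1.
  rewrite sqrtr_gt0 q0/= -(@expr_lt1 _ 2)// ?s2 ?sqrtr_ge0//.
have [D' D'0 sD] := exp_sqrt_bound s01; have /andP[s0 s1] := s01.
have [||p1 hp1] := @exp_small R s (k * D * (2 * D') + 1)^-1.
- by rewrite ltW.
- by rewrite invr_gt0 addr_gt0 ?mulr_gt0.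
exists p1 => p N pp1 h; rewrite leqNgt; apply/negP => Np.
have Np' : (2 * p <= N)%N by rewrite -ltnS.
have pos : 0 < k * D * (2 * D') by rewrite !mulr_gt0.
have sp : s ^+ p <= (k * D * (2 * D') + 1)^-1.
  apply: le_trans (ltW hp1); apply: ler_wiXn2l => //; exact: ltW.
have qp0 : 0 < q ^+ p by rewrite exprn_gt0.
suff : q ^+ p <= q ^+ p * (k * D * (2 * D') * s ^+ p).
  rewrite -[leLHS]mulr1 ler_pM2l//; apply/negP; rewrite -ltNge.
  apply: (le_lt_trans (ler_wpM2l (ltW pos) sp)).
  by rewrite ltr_pdivrMr ?mul1r ?ltrDl// addr_gt0.
apply: (le_trans h); rewrite -(subnKC Np'); set l := (N - 2 * p)%N.
have e1 : Num.sqrt (2 * p + l)%:R <= Num.sqrt (2 * p).+1%:R * Num.sqrt l.+1%:R :> R.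
  apply: le_trans (sqrt_natD_le l (ltn0Sn (2 * p))).
  by apply: ler_wsqrtr; rewrite ler_nat leq_add2r.
have e2 : Num.sqrt (2 * p).+1%:R <= 2 * Num.sqrt p.+1%:R :> R.
  exact: sqrt_nat_le4 (double_succ_le p).
have e3 : q ^+ (2 * p + l) = q ^+ p * (s ^+ p * s ^+ p) * q ^+ l.
  by rewrite -exprMn -expr2 s2 -exprD addnn -mul2n -exprD.
rewrite e3; have ql0 : 0 <= q ^+ l by rewrite exprn_ge0// ltW.
have sp0 : 0 <= s ^+ p by rewrite exprn_ge0// ltW.
have b1 : s ^+ p * Num.sqrt (2 * p).+1%:R <= 2 * D'.
  apply: (le_trans (ler_wpM2l sp0 e2)); rewrite mulrCA.
  by apply: ler_wpM2l.
have b2 : q ^+ l * Num.sqrt l.+1%:R <= D by exact: qD.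
apply: (@le_trans _ _ (k * q ^+ p * s ^+ p * ((s ^+ p * Num.sqrt (2 * p).+1%:R) *
   (q ^+ l * Num.sqrt l.+1%:R)))).
  rewrite [leRHS](_ : _ = k * (q ^+ p * (s ^+ p * s ^+ p) * q ^+ l) *
    (Num.sqrt (2 * p).+1%:R * Num.sqrt l.+1%:R)); last by ring.
  rewrite [leLHS](_ : _ = k * (q ^+ p * (s ^+ p * s ^+ p) * q ^+ l) *
    Num.sqrt (2 * p + l)%:R); last by ring.
  by apply: ler_wpM2l => //; rewrite !mulr_ge0 ?(ltW k0) ?(ltW qp0).
rewrite [leRHS](_ : _ = k * q ^+ p * s ^+ p * (2 * D' * D)); last by ring.
apply: ler_wpM2l; first by rewrite !mulr_ge0 ?(ltW k0) ?(ltW qp0).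
by apply: ler_pM => //; rewrite mulr_ge0 ?sqrtr_ge0.
Qed.

(** Both terms are exponentially small in a power of [2] or [6 / 5], so they
    decrease faster than any geometric sequence.  This is what makes the
    exceptional sets harmless for every exponent [r]. *)
Lemma failure_decay (q : R) : 0 < q < 1 -> exists2 k : R, 0 < k & forall p,
  expR (- (80 * 2 ^+ p)) + (2 * p).+1%:R * expR (1 - (6 / 5) ^+ p) <= k * q ^+ p.
Proof.
move=> /andP[q0 q1].
(* [K] is such that [(6 / 5) ^ K] exceeds [2 / q]; the spare [2] absorbs the
   factor [2 * p + 1]. *)
have [||K hK] := @exp_small R (5 / 6) (q / 2); [lra|lra|].
exists (2 * (3 * (expR 1 * (K.+1`!)%:R))); first by rewrite !mulr_gt0 ?expR_gt0// ltr0n fact_gt0.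
move=> p; have b1 : 1 <= (6 / 5) ^+ p :> R by apply: exprn_ege1; lra.
have f0 : 0 < (K.+1`!)%:R :> R by rewrite ltr0n fact_gt0.
set y := (6 / 5) ^+ p in b1 *.
have y0 : 0 < y by exact: lt_le_trans b1.
have small : expR (- y) <= (K.+1`!)%:R * (q / 2) ^+ p.
  have yK : 0 < y ^+ K.+1 by rewrite exprn_gt0.
  have h : y ^+ K.+1 / (K.+1`!)%:R <= expR y.
    by apply: le_trans (expR_ge1Dxn K (ltW y0)); rewrite ler_wpDl.
  apply: (@le_trans _ _ ((K.+1`!)%:R / y ^+ K.+1)).
    rewrite expRN -[leRHS]invrK lef_pV2 ?posrE ?expR_gt0//; last first.
      by rewrite invr_gt0 divr_gt0.
    by rewrite invfM invrK mulrC.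
  apply: ler_wpM2l; first exact: ltW.
  rewrite /y -exprM mulnC exprM -exprVn; apply: lerXn2r; rewrite ?nnegrE.
  - by rewrite invr_ge0 exprn_ge0//; lra.
  - by lra.
  - apply: le_trans (ltW hK); rewrite -exprVn invf_div.
    by apply: ler_wiXn2l => //; lra.
have two_p : (2 * p).+1%:R <= 3 * 2 ^+ p :> R.
  have := @expr_ge1Mn R 1 p ler01; rewrite -[(2 * p).+1%:R]natr1 natrM mulr1.
  by rewrite -[1 + 1]/(2 : R); have : 0 <= p%:R :> R by []; lra.
have big : expR (- (80 * 2 ^+ p)) <= expR (- y).
  rewrite ler_expR lerN2 /y; apply: (@le_trans _ _ (2 ^+ p)).
    by apply: lerXn2r; rewrite ?nnegrE; lra.
  by rewrite ler_peMl ?exprn_ge0// ler1n.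
have e1 : 1 <= expR 1 :> R by rewrite -[leLHS]expR0 ler_expR.
have n1 : 1 <= (2 * p).+1%:R :> R by rewrite ler1n.
have ey0 := expR_ge0 (- y).
rewrite expRD; apply: (@le_trans _ _ (2 * ((2 * p).+1%:R * (expR 1 * expR (- y))))).
  set Z := (2 * p).+1%:R * _; have -> : 2 * Z = Z + Z by ring.
  rewrite lerD2r /Z; apply: (le_trans big).
  rewrite mulrA ler_peMl//; apply: (le_trans e1).
  by rewrite ler_peMl// (le_trans ler01).
rewrite -!mulrA; apply: ler_wpM2l => //.
apply: (@le_trans _ _ (3 * 2 ^+ p * (expR 1 * ((K.+1`!)%:R * (q / 2) ^+ p)))).
  apply: ler_pM => //.
  by apply: ler_wpM2l => //; exact: expR_ge0.
rewrite expr_div_n le_eqVlt; apply/orP; left; apply/eqP; field.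
by rewrite expf_neq0.
Qed.

End Comparison.

(** * Moments of the norm and the truncation error *)

Lemma six_mul (R : realType) (a b : R) : 6 * a * b = 3 * (2 * a * b).
Proof. by ring. Qed.

Section PathMoments.
Context {R : realType} {T : R} {d : nat} {alpha : exponent R}.
Hypothesis T_gt0 : 0 < T.
Local Notation C := (holder0 T d alpha).
Variable L : probability (borel C) R.
Hypothesis hL : is_brownian_law L.
Local Notation decay := (decay alpha).
Local Notation CH := (@chaining_const R T alpha).
Local Notation CP := (CH * T `^ (alpha : R)).

Lemma measurable_norm_powR (s : R) :
  measurable_fun setT (fun x : borel C => `|x : C| `^ s).
Proof.
apply: (measurableT_comp (measurable_powR _)) => //.
by apply: (@continuous_borel_real _ C) => x; exact: (@norm_continuous _ C).
Qed.

(** Chaining bounds the norm by the levels from [0] on. *)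
Lemma norm_moment (s : R) : 0 < s ->
  exists2 m : R, 0 <= m & (\int[L]_x (`|x : C| `^ s)%:E <= m%:E)%E.
Proof.
move=> s0; have [k k0 hk] := holder_tail_moment T_gt0 hL s0.
have CH0 := chaining_const_gt0 T_gt0 (alpha := alpha).
have [D D0 hD] := exp_sqrt_bound (decay_itv alpha).
have /andP[d0 _] := decay_itv alpha.
pose m0 := k * ((3 * D) `^ s + (decay `^ s) ^+ 0).
have m00 : 0 <= m0 by rewrite mulr_ge0 ?(ltW k0)// addr_ge0 ?exprn_ge0 ?powR_ge0.
have mN : measurable_fun setT (fun x : borel C => `|x : C| / CH).
  apply: measurable_funM => //.
  by apply: (@continuous_borel_real _ C) => x; exact: (@norm_continuous _ C).
have N0 (x : C) : 0 <= `|x| / CH by rewrite divr_ge0// ltW.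
have hM p : (0 <= p)%N -> decay ^+ p * (3 * Num.sqrt p.+1%:R) <= 3 * D.
  by move=> _; rewrite mulrCA; apply: ler_wpM2l.
have hK (x : C) K : 0 <= K -> (forall p i, (0 <= p)%N -> (i < 2 ^ p)%N ->
    enorm (dyadic_inc x p i) <= K * ratio (alpha := alpha) ^+ p) -> `|x| / CH <= K.
  move=> K0 xK; rewrite ler_pdivrMr// mulrC; apply: chaining => // p i ip.
  exact: xK.
have D30 : 0 <= 3 * D by rewrite mulr_ge0// ltW.
have h := hk 0%N (3 * D) D30 hM (fun x => `|x| / CH) N0 mN hK.
exists (CH `^ s * m0); first by rewrite mulr_ge0 ?powR_ge0.
have -> : (\int[L]_x (`|x : C| `^ s)%:E =
    \int[L]_x ((CH `^ s)%:E * ((`|x : C| / CH) `^ s)%:E))%E.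
  apply: eq_integral => x _; rewrite -EFinM -powRM ?(ltW CH0)//.
  by rewrite mulrC divfK// gt_eqF.
rewrite ge0_integralZl//.
- by rewrite [X in (_ <= X)%E]EFinM; apply: lee_wpmul2l => //; rewrite lee_fin powR_ge0.
- by apply/measurable_EFinP; apply: (measurableT_comp (measurable_powR _)).
- by move=> x _; rewrite lee_fin powR_ge0.
- by rewrite lee_fin powR_ge0.
Qed.

Lemma measurable_sub_proj N : measurable_fun setT
  (fun x : borel C => `|(x : C) - (@schauder_proj R T d alpha N x : C)|).
Proof.
pose proj (x : C) : C := @schauder_proj R T d alpha N x.
have projL (x y : C) : `|proj x - proj y| <= CP * `|x - y|.
  rewrite -[proj x - proj y]/((@schauder_proj R T d alpha N x - schauder_proj y : schauder_space T d alpha N) : C).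
  by rewrite -projB// -schauder_normE; exact: proj_le.
have c1 : continuous (fun x : C => x - proj x).
  apply: (@lipschitz_continuous _ _ _ _ (1 + CP)) => x y.
  by rewrite opprD addrACA -opprD mulrDl mul1r (le_trans (ler_normB _ _))// lerD2l.
have c2 : continuous (fun x : C => `|x - proj x|).
  by move=> x; have h := c1 x; exact: (@cvg_norm _ _ _ _ _ _ _ h).
exact: (continuous_borel_real c2).
Qed.

(** Chaining bounds [x - P_N x] by the levels beyond [N], where the largest normalised
    increments are of order [decay ^ p * sqrt p]. *)
Lemma truncation_error (r : R) : 0 < r -> exists2 k : R, 0 < k &
  forall N, (0 < N)%N ->
    (\int[L]_x (`|(x : C) - (@schauder_proj R T d alpha N x : C)| `^ r)%:E <=
      (k * (Num.sqrt N%:R * decay ^+ N) `^ r)%:E)%E.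
Proof.
move=> r0; have [k k0 hk] := holder_tail_moment T_gt0 hL r0.
have CH0 := chaining_const_gt0 T_gt0 (alpha := alpha).
have [D D0 hD] := exp_sqrt_bound (decay_itv alpha).
have /andP[d0 d1] := decay_itv alpha.
have c0 : 0 < 2 * CH by rewrite mulr_gt0.
exists ((2 * CH) `^ r * (k * ((6 * D) `^ r + 1))).
  by rewrite mulr_gt0 ?powR_gt0// mulr_gt0// ltr_wpDl// powR_ge0.
move=> N N0; set w := Num.sqrt N%:R * decay ^+ N.
have dN0 : 0 <= decay ^+ N by rewrite exprn_ge0// ltW.
have w0 : 0 <= w by rewrite mulr_ge0 ?sqrtr_ge0.
have dw : decay ^+ N <= w.
  by rewrite ler_peMl// -[leLHS]sqrtr1; apply: ler_wsqrtr; rewrite ler1n.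
pose proj (x : C) : C := @schauder_proj R T d alpha N x.
have mD : measurable_fun setT (fun x : borel C => `|(x : C) - proj x| / (2 * CH)).
  by apply: measurable_funM => //; exact: measurable_sub_proj.
have N1 (x : C) : 0 <= `|x - proj x| / (2 * CH) by rewrite divr_ge0// ltW.
have hM p : (N < p)%N -> decay ^+ p * (3 * Num.sqrt p.+1%:R) <= 6 * D * w.
  move=> Np; rewrite mulrCA six_mul.
  by apply: ler_wpM2l => //; exact: (tail_level_bound (decay_itv alpha) hD N0 Np).
have hK (x : C) K : 0 <= K -> (forall p i, (N < p)%N -> (i < 2 ^ p)%N ->
    enorm (dyadic_inc x p i) <= K * ratio (alpha := alpha) ^+ p) ->
    `|x - proj x| / (2 * CH) <= K.
  move=> K0 xK; rewrite ler_pdivrMr// mulrC -mulrA mulrCA; exact: sub_proj_le.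
have M0 : 0 <= 6 * D * w by rewrite !mulr_ge0// ltW.
have h := hk N.+1 (6 * D * w) M0 hM (fun x => `|x - proj x| / (2 * CH)) N1 mD hK.
have -> : (\int[L]_x (`|(x : C) - proj x| `^ r)%:E =
    \int[L]_x (((2 * CH) `^ r)%:E * ((`|(x : C) - proj x| / (2 * CH)) `^ r)%:E))%E.
  apply: eq_integral => x _; rewrite -EFinM -powRM ?(ltW c0)//.
  by rewrite mulrC divfK// gt_eqF.
rewrite ge0_integralZl//; last 3 first.
- by apply/measurable_EFinP; apply: (measurableT_comp (measurable_powR _)).
- by move=> x _; rewrite lee_fin powR_ge0.
- by rewrite lee_fin powR_ge0.
rewrite -mulrA EFinM; apply: lee_wpmul2l; first by rewrite lee_fin powR_ge0.
apply: (le_trans h); rewrite lee_fin -[leRHS]mulrA; apply: ler_wpM2l; first exact: ltW.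
rewrite powRM ?mulr_ge0 ?(ltW D0)// [leRHS]mulrDl mul1r lerD2l.
have q01 : 0 <= decay `^ r <= 1.
  rewrite powR_ge0 /=; have := @ge0_ler_powR R r (ltW r0) decay 1.
  by rewrite powR1; apply; rewrite ?nnegrE ltW.
have /andP[q0 q1] := q01.
rewrite exprS; apply: (@le_trans _ _ ((decay `^ r) ^+ N)).
  by rewrite ler_piMl ?exprn_ge0.
rewrite -powR_exprn ?(ltW d0)//.
by apply: ge0_ler_powR; rewrite ?nnegrE ?(ltW r0).
Qed.

End PathMoments.

(** * The distance of a path to its code point *)

Lemma expRN_le_half_exp (R : realType) p : expR (- (320 * 2 ^+ p)) <= 2 ^- p :> R.
Proof.
rewrite expRN lef_pV2 ?posrE ?expR_gt0 ?exprn_gt0//.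
apply: (le_trans (expRn_ge2n p)); rewrite ler_expR.
apply: (@le_trans _ _ (2 ^+ p)); last by rewrite ler_peMl ?exprn_ge0// ler1n.
by rewrite -natrX ler_nat ltnW// ltn_expl.
Qed.

(** The probability of the ball is the square root of the error allowed by [n], so one
    half of the exponent [640] is left over. *)
Lemma sqr_distance_le (R : realType) (n : nat) (m rho M : R) : (1 < n)%N -> 0 <= m ->
  expR (640 * M) <= n%:R ->
  rho ^+ 2 / 2 * expR (- (320 * M)) <= 10 * m / n.-1%:R ->
  rho ^+ 2 <= 40 * m * expR (- (320 * M)).
Proof.
move=> n1 m0 en h; set E := expR (320 * M).
have E0 : 0 < E by exact: expR_gt0.
have EE : expR (640 * M) = E ^+ 2.
  by rewrite expr2 -expRD; congr expR; ring.
have n0 : 0 < n.-1%:R :> R by rewrite ltr0n; case: n n1 {en h} => [|[]].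
have nn : E ^+ 2 <= 2 * n.-1%:R.
  rewrite -EE; apply: (le_trans en); rewrite -natrM ler_nat.
  by case: n n1 {en h n0} => [|[|n]]// _; rewrite mul2n -addnn addnS ltnS leq_addr.
have h2 : 10 * m / n.-1%:R <= 20 * m / E ^+ 2.
  rewrite ler_pdivrMr// mulrAC ler_pdivlMr ?exprn_gt0//.
  have -> : 20 * m * n.-1%:R = 10 * m * (2 * n.-1%:R) by ring.
  by apply: ler_wpM2l => //; rewrite mulr_ge0.
have {h h2} := le_trans h h2; rewrite expRN -/E => h.
have := ler_wpM2r (ltW (mulr_gt0 (ltr0n R 2) E0)) h.
have -> : rho ^+ 2 / 2 / E * (2 * E) = rho ^+ 2 by field; rewrite gt_eqF.
by have -> : 20 * m / E ^+ 2 * (2 * E) = 40 * m / E by field; rewrite gt_eqF.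
Qed.

Section Event.
Context {R : realType} {T : R} {d : nat} {alpha : exponent R}.
Hypothesis T_gt0 : 0 < T.
Local Notation C := (holder0 T d alpha).
Variable L : probability (borel C) R.
Hypothesis hL : is_brownian_law L.
Local Notation decay := (decay alpha).
Local Notation CH := (@chaining_const R T alpha).
Local Notation CP := (CH * T `^ (alpha : R)).
Local Notation cproj N := (@coord_proj R T alpha d N).

Lemma coord_proj_moment : exists2 m : R, 0 <= m & forall N (j : 'I_d),
  (\int[L]_x (`|cproj N j (x : C)| ^+ 2)%:E <= m%:E)%E.
Proof.
have [m m0 hm] := norm_moment T_gt0 hL (ltr0n R 2).
have CH0 := chaining_const_gt0 T_gt0 (alpha := alpha).
have CP0 : 0 <= CP by rewrite mulr_ge0 ?powR_ge0// ltW.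
exists (CP ^+ 2 * m); first by rewrite mulr_ge0 ?sqr_ge0.
move=> N j; apply: (@le_trans _ _
   (\int[L]_x ((CP ^+ 2)%:E * (`|x : C| `^ 2)%:E))%E).
  apply: ge0_le_integral_any => x; first by rewrite lee_fin sqr_ge0.
  rewrite -EFinM lee_fin powR_mulrn// -exprMn.
  by apply: lerXn2r; rewrite ?nnegrE ?(mulr_ge0 CP0)//; exact: coord_proj_le.
rewrite ge0_integralZl//.
- by rewrite [X in (_ <= X)%E]EFinM; apply: lee_wpmul2l => //; rewrite lee_fin sqr_ge0.
- by apply/measurable_EFinP; exact: measurable_norm_powR.
- by rewrite lee_fin sqr_ge0.
Qed.

(** The rounding error on level [p] is the same multiple of [ratio ^ p] on all
    levels, which is the form that chaining takes. *)
Lemma close_paths_dist N (j0 j : 'I_d) p0 (x x' : C) :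
  close_paths j0 j p0 N.+1 x x' ->
  `|cproj N j0 x' - cproj N j x| <=
     CH * (2 * mesh0 alpha * Num.sqrt T * decay ^+ p0).
Proof.
move=> h; have /andP[d0 _] := decay_itv alpha.
apply: coord_proj_sub_le => //.
  by rewrite !mulr_ge0 ?sqrtr_ge0 ?exprn_ge0 ?(ltW d0)// ltW// mesh0_gt0.
move=> p i pN ip; apply: (le_trans (h p i pN ip)).
rewrite (@increment_stdE _ _ alpha)// /mesh le_eqVlt; apply/orP; left; apply/eqP.
have : decay ^+ p != 0 by rewrite gt_eqF// exprn_gt0.
move: (decay ^+ p) (decay ^+ p0) (ratio ^+ p) (Num.sqrt T) (mesh0 alpha).
by move=> u v w s m u0; field.
Qed.

Hypothesis d_gt0 : (0 < d)%N.
Local Notation j1 := (Ordinal d_gt0).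

(** Either the distance [rho] of the path to the code is of the order of the radius
    reached by [close_paths], or the ball of radius [rho / 4] contains these
    paths, and the exchange inequality bounds [rho].  One constant serves all
    three conclusions. *)
Lemma quantization_event (q : R) : 0 < q < 1 -> exists2 k : R, 0 < k &
  forall (n N p0 : nat) (c : 'I_n -> schauder_space T 1 alpha N) S, (1 < n)%N ->
  (N.+1 <= 2 * p0)%N -> expR (640 * 2 ^+ p0) <= n%:R :> R ->
  is_voronoi c S -> is_mse_minimiser (coordinate_law L N j1) c ->
  (exists i, `|c i| <= k) /\
  exists U : 'I_d -> set (borel C),
    [/\ forall j, measurable (U j), forall j, (L (U j) <= (k * q ^+ p0)%:E)%E &
        forall j x i, ~ U j x -> S i (cproj N j x) ->
          `|cproj N j x - c i| <= k * decay ^+ p0].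
Proof.
move=> q01; have [kf kf0 hf] := failure_decay q01.
have [m m0 hm] := coord_proj_moment.
have CH0 := chaining_const_gt0 T_gt0 (alpha := alpha).
have /andP[d0 d1] := decay_itv alpha.
pose e0 : R := CH * (2 * mesh0 alpha * Num.sqrt T).
have e00 : 0 <= e0.
  by rewrite /e0 mulr_ge0 ?(ltW CH0)// mulr_ge0 ?sqrtr_ge0// mulr_ge0// ltW// mesh0_gt0.
pose s : R := Num.sqrt (40 * m).
have s0 : 0 <= s by exact: sqrtr_ge0.
exists (kf + 4 * e0 + s); first by rewrite -addrA ltr_wpDr// addr_ge0// mulr_ge0.
move=> n N p0 c S n1 Np0 en vorS minc.
have mPhi : measurable_fun setT (cproj N j1 : borel C -> borel (schauder_space T 1 alpha N)).
  have h := @coord_proj_continuous R T T_gt0 alpha d N j1.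
  exact (continuous_borel h).
have minc' : is_mse_minimiser (pushforward L (cproj N j1 : borel C -> borel (schauder_space T 1 alpha N))) c.
  exact: minc.
split.
  have [i hi] := central_code_point mPhi minc' (hm N j1) (ltnW n1).
  exists i; apply: (@le_trans _ _ s); last by rewrite lerDr addr_ge0 ?(ltW kf0)// mulr_ge0.
  rewrite -[leLHS]ger0_norm// -sqrtr_sqr; apply: ler_wsqrtr; apply: (le_trans hi).
  by apply: ler_wpM2r => //; rewrite ler_nat.
have hU (j : 'I_d) := cid (small_ball T_gt0 hL j1 j Np0).
exists (fun j => sval (hU j)); split.
- by move=> j; case: (svalP (hU j)).
- move=> j; case: (svalP (hU j)) => _ + _; move=> /le_trans; apply.
  rewrite lee_fin; apply: (@le_trans _ _ (kf * q ^+ p0)).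
    apply: le_trans (hf p0); rewrite lerD2l; apply: ler_wpM2r; first exact: expR_ge0.
    by rewrite ler_nat ltnS.
  have /andP[q0 _] := q01.
  apply: ler_wpM2r; first by rewrite exprn_ge0// ltW.
  by rewrite -addrA lerDl addr_ge0// mulr_ge0.
move=> j x i Ux Si; case: (svalP (hU j)) => _ _ /(_ x Ux) hball.
set y := cproj N j x in Si *; set rho := `|y - c i|.
have dp0 : 0 <= decay ^+ p0 by rewrite exprn_ge0// ltW.
have [far|near] := leP rho (4 * (e0 * decay ^+ p0)).
  apply: (le_trans far); rewrite mulrA; apply: ler_wpM2r => //.
  by rewrite -addrA addrCA lerDl addr_ge0// ltW.
have rho0 : 0 <= rho by exact: normr_ge0.
have rhoc k : rho <= `|y - c k| by case: vorS => _ _ _; apply.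
have := distortion_swap mPhi minc' vorS m0 (hm N j1) n1 rho0 rhoc.
move=> hswap.
have mB : measurable [set x' : borel C | `|cproj N j1 x' - y| <= rho / 4].
  have h : continuous (fun z : schauder_space T 1 alpha N => `|z - y|).
    apply: (@lipschitz_continuous R (schauder_space T 1 alpha N) R^o (fun z => `|z - y|) 1) => z z'.
    rewrite mul1r (_ : z - z' = (z - y) - (z' - y)); last by rewrite opprB subrKA.
    exact: ler_dist_dist.
  have := measurableT_comp (continuous_borel_real h) mPhi.
  by move=> /(_ measurableT _ (measurable_itv `]-oo, (rho / 4)])); rewrite setTI set_itvE.
have hsub : close_paths j1 j p0 N.+1 x `<=`
    [set x' : borel C | `|cproj N j1 x' - y| <= rho / 4].
  move=> x' /close_paths_dist h /=; apply: (le_trans h).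
  rewrite [leLHS]mulrA -/e0; lra.
have hmass : ((expR (- (320 * 2 ^+ p0)))%:E <=
    L [set x' : borel C | (`|cproj N j1 x' - y| <= rho / 4)%R])%E.
  apply: (le_trans hball); apply: le_measure => //; rewrite inE//.
  exact: measurable_close_paths.
have h : rho ^+ 2 / 2 * expR (- (320 * 2 ^+ p0)) <= 10 * m / n.-1%:R.
  rewrite -lee_fin EFinM; apply: le_trans hswap; apply: lee_wpmul2l => //.
  by rewrite lee_fin divr_ge0// sqr_ge0.
have h2 := sqr_distance_le n1 m0 en h.
apply: (@le_trans _ _ (s * decay ^+ p0)); last first.
  by apply: ler_wpM2r => //; rewrite lerDr addr_ge0 ?(ltW kf0)// mulr_ge0.
rewrite -ler_sqr ?nnegrE ?mulr_ge0// exprMn sqr_sqrtr ?mulr_ge0//.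
apply: (le_trans h2); apply: ler_wpM2l; first by rewrite mulr_ge0.
apply: (le_trans (expRN_le_half_exp R p0)).
rewrite -exprVn -exprM mulnC exprM; apply: lerXn2r; rewrite ?nnegrE ?sqr_ge0//.
by have /andP[] := decay_sqr alpha; rewrite div1r => /ltW.
Qed.

End Event.

(** * Powers of sums and bounds on means *)

Section Bounds.
Context {R : realType}.

Lemma powR_sum_le (r : R) n (F : 'I_n.+1 -> R) : 0 <= r -> (forall i, 0 <= F i) ->
  (\sum_i F i) `^ r <= n.+1%:R `^ r * \sum_i F i `^ r.
Proof.
move=> r0 F0; have [i _ Fi] := arg_maxP F (isT : xpredT (ord0 : 'I_n.+1)).
apply: (@le_trans _ _ ((n.+1%:R * F i) `^ r)).
  apply: ge0_ler_powR; rewrite ?nnegrE ?mulr_ge0 ?sumr_ge0//.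
  apply: (@le_trans _ _ (\sum_(j < n.+1) F i)); first by apply: ler_sum => j _; exact: Fi.
  by rewrite sumr_const card_ord -[_ *+ n.+1]mulr_natl.
rewrite powRM//; apply: ler_wpM2l; first exact: powR_ge0.
by rewrite (bigD1 i)//= lerDl sumr_ge0// => j _; exact: powR_ge0.
Qed.

Lemma powRD_sum_le (r a : R) n (b : 'I_n -> R) : 0 <= r -> 0 <= a -> (forall i, 0 <= b i) ->
  (a + \sum_i b i) `^ r <= n.+1%:R `^ r * (a `^ r + \sum_i b i `^ r).
Proof.
move=> r0 a0 b0; pose F i := oapp b a (unlift ord0 i).
have F0 i : 0 <= F i by rewrite /F; case: unlift => /=.
have eS (g : R -> R) : \sum_i g (F i) = g a + \sum_i g (b i).
  rewrite big_ord_recl /F unlift_none; congr (_ + _).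
  by apply: eq_bigr => i _; rewrite liftK.
by have := powR_sum_le r0 F0; rewrite (eS id) (eS (fun z => z `^ r)).
Qed.

Context {d} {Om : measurableType d} (P : probability Om R).

(** The conditions under which such bounds on means add up. *)
Definition mean_le (f : Om -> R) (k : R) :=
  [/\ forall x, 0 <= f x, measurable_fun setT f & (\int[P]_x (f x)%:E <= k%:E)%E].

Lemma mean_leD f g k l : mean_le f k -> mean_le g l ->
  mean_le (fun x => f x + g x) (k + l).
Proof.
move=> [f0 mf fk] [g0 mg gl]; split; [by move=> x; rewrite addr_ge0|exact: measurable_funD|].
under eq_integral do rewrite EFinD.
rewrite ge0_integralD//; first by rewrite [X in (_ <= X)%E]EFinD; exact: leeD.
- by move=> x _; rewrite lee_fin.
- exact/measurable_EFinP.
- by move=> x _; rewrite lee_fin.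
- exact/measurable_EFinP.
Qed.

Lemma mean_leZ c f k : 0 <= c -> mean_le f k -> mean_le (fun x => c * f x) (c * k).
Proof.
move=> c0 [f0 mf fk]; split; [by move=> x; rewrite mulr_ge0|exact: measurable_funM|].
under eq_integral do rewrite EFinM.
rewrite ge0_integralZl//.
- by rewrite [X in (_ <= X)%E]EFinM; apply: lee_wpmul2l => //; rewrite lee_fin.
- exact/measurable_EFinP.
- by move=> x _; rewrite lee_fin.
Qed.

Lemma mean_le_cst c : 0 <= c -> mean_le (fun=> c) c.
Proof.
by move=> c0; split=> //; rewrite integral_cst// [X in (_ * X)%E]probability_setT mule1.
Qed.

Lemma mean_le_indic A k : measurable A -> (P A <= k%:E)%E -> mean_le \1_A k.
Proof.
by move=> mA Ak; split=> //; rewrite integral_indic// setIT.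
Qed.

Lemma mean_le_sum n (f : 'I_n -> Om -> R) k : (forall i, mean_le (f i) k) ->
  mean_le (fun x => \sum_i f i x) (n%:R * k).
Proof.
move=> fk; have -> : n%:R * k = \sum_(i < n) k.
  by rewrite sumr_const card_ord -[in RHS]mulr_natl.
elim: (index_enum _) => [|i s IH].
  under eq_fun do rewrite big_nil; rewrite big_nil; exact: mean_le_cst.
under eq_fun do rewrite big_cons; rewrite big_cons; exact: mean_leD.
Qed.

End Bounds.

(** * The quantization error at a fixed level *)

Section QuantizationError.
Context {R : realType} {T : R} {d : nat} {alpha : exponent R}.
Hypothesis T_gt0 : 0 < T.
Local Notation C := (holder0 T d alpha).
Variable L : probability (borel C) R.
Hypothesis hL : is_brownian_law L.
Local Notation decay := (decay alpha).
Local Notation CH := (@chaining_const R T alpha).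
Local Notation CP := (CH * T `^ (alpha : R)).
Local Notation cproj N := (@coord_proj R T alpha d N).
Local Notation proj N x := (@schauder_proj R T d alpha N x : C).
Hypothesis d_gt0 : (0 < d)%N.
Local Notation j1 := (Ordinal d_gt0).

(** Replaces the mean of a power over a rare event by the probability of this event
    and the mean of a higher power over the whole space. *)
Lemma le_invD_sqr (e v : R) : 0 < e -> 0 <= v -> v <= e^-1 + e * v ^+ 2.
Proof.
move=> e0 v0; have [h|h] := leP v e^-1.
  by apply: (le_trans h); rewrite lerDl mulr_ge0 ?sqr_ge0// ltW.
apply: (@le_trans _ _ (e * v ^+ 2)); last by rewrite lerDr invr_ge0 ltW.
rewrite expr2 mulrA ler_peMl// -ler_pdivrMl// mulr1; exact: ltW.
Qed.

Lemma quantization_dist (n N : nat) (c : 'I_n -> schauder_space T 1 alpha N) S q (x : C) :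
  is_voronoi c S -> is_quantization c S q ->
  exists k : 'I_d -> 'I_n, (forall j, S (k j) (cproj N j x)) /\
    `|x - (q x : C)| <= `|x - proj N x| + \sum_j `|cproj N j x - c (k j)|.
Proof.
move=> [_ _ Scov _] hq.
have ex j : {k | S k (cproj N j x)}.
  by apply: cid; have : setT (cproj N j x) by []; rewrite -Scov => -[k _ Sk]; exists k.
pose k := [ffun j => sval (ex j)].
have kS j : S (k j) (cproj N j x) by rewrite ffunE; exact: (svalP (ex j)).
exists k; split=> //.
rewrite (hq k x) => [|j]; last exact: kS.
have -> : x - (product_code c k : C) =
    (x - proj N x) + (proj N x - (product_code c k : C)) by rewrite subrKA.
apply: (le_trans (ler_normD _ _)); rewrite lerD2l.
exact: of_coordinates_dist.
Qed.

(** Outside the exceptional sets the distances to the code are [O(decay ^ p0)].  On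
    them the nearest code point is at least as close as the central one, at
    distance [O(1 + |x|)]; the exceptional probability [O(decay ^ (2 * r * p0))] and
    the moment of order [2 * r] of [|x|] are balanced by [le_invD_sqr]. *)
Lemma quantization_error (r : R) : 0 < r -> exists2 k : R, 0 < k &
  forall (n N p0 : nat) (c : 'I_n -> schauder_space T 1 alpha N) S q, (1 < n)%N -> (0 < N)%N ->
  (N.+1 <= 2 * p0)%N -> expR (640 * 2 ^+ p0) <= n%:R :> R ->
  is_voronoi c S -> is_mse_minimiser (coordinate_law L N j1) c -> is_quantization c S q ->
  (\int[L]_x (`|(x : C) - (q x : C)| `^ r)%:E <=
    (k * ((Num.sqrt N%:R * decay ^+ N) `^ r + (decay ^+ p0) `^ r))%:E)%E.
Proof.
move=> r0; have [kT kT0 hT] := truncation_error T_gt0 hL r0.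
have /andP[d0 d1] := decay_itv alpha.
have r20 : 0 < r * 2 by rewrite mulr_gt0.
pose b := decay `^ (r * 2).
have b01 : 0 < b < 1.
  rewrite powR_gt0//=; have := @gt0_ltr_powR R (r * 2) r20 decay 1.
  by rewrite powR1; apply; rewrite ?nnegrE// ltW.
have [kQ kQ0 hQ] := quantization_event T_gt0 hL d_gt0 b01.
have [m2 m20 hm2] := norm_moment T_gt0 hL r20.
have CH0 := chaining_const_gt0 T_gt0 (alpha := alpha).
have CP0 : 0 <= CP by rewrite mulr_ge0 ?powR_ge0// ltW.
pose D := d.+1%:R `^ r : R; have D0 : 0 <= D by exact: powR_ge0.
pose G := 2 `^ (r * 2) : R; have G0 : 0 <= G by exact: powR_ge0.
pose mu := G * (CP `^ (r * 2) * m2 + kQ `^ (r * 2)).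
have mu0 : 0 <= mu by rewrite mulr_ge0// addr_ge0 ?powR_ge0// mulr_ge0 ?powR_ge0.
pose kd := kQ `^ r + kQ + mu.
have kd0 : 0 <= kd by rewrite addr_ge0// addr_ge0 ?powR_ge0// ltW.
exists (D * (kT + d%:R * kd) + 1).
  by rewrite ltr_wpDl// mulr_ge0// addr_ge0 ?mulr_ge0// ltW.
move=> n N p0 c S q n1 N0 Np0 en vorS minc hq.
have [[i0 ci0] [U [mU LU hU]]] := hQ n N p0 c S n1 Np0 en vorS minc.
set w := Num.sqrt N%:R * decay ^+ N; set dl := decay ^+ p0; set e := dl `^ r.
have dl0 : 0 < dl by rewrite exprn_gt0.
have e0 : 0 < e by rewrite powR_gt0.
have be : b ^+ p0 = e ^+ 2.
  by rewrite /b -(powR_exprn _ _ (ltW d0)) powRrM powR_mulrn ?powR_ge0.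
pose u (x : C) := CP * `|x| + kQ.
have u0 x : 0 <= u x by rewrite /u addr_ge0 ?(mulr_ge0 CP0)// ltW.
(* Dominates the [r]-th power of the error; the terms in [j] bound the distances
   to the scalar code points, inside and outside the exceptional sets. *)
pose h (x : borel C) := D * (`|(x : C) - proj N x| `^ r +
  \sum_(j < d) (kQ `^ r * e + (e^-1 * \1_(U j) x +
     e * (G * (CP `^ (r * 2) * (`|x : C| `^ (r * 2)) + kQ `^ (r * 2)))))).
have hh : mean_le L h (D * (kT * w `^ r + d%:R * (kQ `^ r * e + (e^-1 * (kQ * b ^+ p0) + e * mu)))).
  apply: mean_leZ => //; apply: mean_leD.
    split; [by move=> x; exact: powR_ge0| |exact: hT].
    by apply: (measurableT_comp (measurable_powR _)) => //; exact: measurable_sub_proj.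
  apply: mean_le_sum => j; apply: mean_leD.
    by apply: mean_le_cst; rewrite mulr_ge0 ?powR_ge0.
  apply: mean_leD; first by apply: mean_leZ; [rewrite invr_ge0 ltW|exact: mean_le_indic].
  apply: mean_leZ; first exact: ltW.
  apply: mean_leZ => //; apply: mean_leD; last by apply: mean_le_cst; exact: powR_ge0.
  apply: mean_leZ; first exact: powR_ge0.
  by split=> //; exact: measurable_norm_powR.
have [_ _ hle] := hh.
apply: le_trans (le_trans hle _); last first.
  rewrite lee_fin be expr2 [kQ * _]mulrCA mulKf ?gt_eqF//.
  have -> : kQ `^ r * e + (kQ * e + e * mu) = kd * e by rewrite /kd !mulrDl addrA [e * mu]mulrC.
  have w0 : 0 <= w `^ r by exact: powR_ge0.
  apply: (@le_trans _ _ (D * ((kT + d%:R * kd) * (w `^ r + e)))).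
    apply: ler_wpM2l => //; rewrite mulrDr; apply: lerD.
      by apply: ler_wpM2r => //; rewrite lerDl mulr_ge0.
    by rewrite mulrA; apply: ler_wpM2r; [exact: ltW|rewrite lerDr ltW].
  by rewrite mulrA; apply: ler_wpM2r; [rewrite addr_ge0// ltW|rewrite lerDl].
apply: ge0_le_integral_any => x; first by rewrite lee_fin powR_ge0.
rewrite lee_fin; have [k [kS qk]] := quantization_dist x vorS hq.
apply: (@le_trans _ _ ((`|(x : C) - proj N x| + \sum_j `|cproj N j x - c (k j)|) `^ r)).
  by apply: ge0_ler_powR; rewrite ?nnegrE ?(ltW r0)// addr_ge0// sumr_ge0.
apply: (le_trans (powRD_sum_le (ltW r0) _ _)) => //.
apply: ler_wpM2l => //; rewrite lerD2l; apply: ler_sum => j _.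
have e1 : 0 <= e^-1 by rewrite invr_ge0 ltW.
have up : 0 <= G * (CP `^ (r * 2) * (`|x : C| `^ (r * 2)) + kQ `^ (r * 2)).
  by rewrite mulr_ge0// addr_ge0 ?mulr_ge0 ?powR_ge0.
have [Ux|Ux] := pselect (U j x); last first.
  apply: (@le_trans _ _ (kQ `^ r * e)).
    rewrite -powRM ?(ltW kQ0) ?(ltW dl0)//.
    apply: ge0_ler_powR; rewrite ?nnegrE ?(ltW r0)//.
      by rewrite mulr_ge0// ltW.
    exact: hU (kS j).
  by rewrite lerDl addr_ge0// mulr_ge0// ltW.
rewrite indicE mem_set// mulr1.
apply: (@le_trans _ _ (e^-1 + e * (u x `^ r) ^+ 2)).
  apply: le_trans (le_invD_sqr e0 (powR_ge0 (u x) r)).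
  apply: ge0_ler_powR; rewrite ?nnegrE ?(ltW r0)//.
  have vor : `|cproj N j x - c (k j)| <= `|cproj N j x - c i0|.
    by case: vorS => _ _ _; apply; exact: kS.
  apply: (le_trans vor); apply: (le_trans (ler_normB _ _)).
  by apply: lerD => //; exact: coord_proj_le.
rewrite -[leLHS]add0r; apply: lerD; first by rewrite mulr_ge0 ?powR_ge0// ltW.
rewrite lerD2l; apply: ler_wpM2l; first exact: ltW.
rewrite -powR_mulrn ?powR_ge0// -powRrM /u /G.
have := @powRD_sum_le R (r * 2) (CP * `|x : C|) 1 (fun=> kQ) (ltW r20).
rewrite !big_ord1 powRM//; apply => [|_]; [exact: mulr_ge0|exact: ltW].
Qed.

End QuantizationError.

(** * Choice of the level and conclusion *)

Section Levels.
Context {R : realType}.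

Lemma dyadic_level (y : R) : 1 <= y -> exists2 p, 2 ^+ p <= y & y < 2 ^+ p.+1.
Proof.
move=> y1; have y0 : 0 < y by exact: lt_le_trans y1.
have [|p yp py] := @dyadic_scale R y^-1; first by rewrite invr_gt0 y0 invf_le1.
exists p; first by rewrite -lef_pV2 ?posrE ?exprn_gt0.
by rewrite -ltf_pV2 ?posrE ?exprn_gt0.
Qed.

Lemma ln_nat_cvg (M : R) : \forall n \near \oo, M <= ln (n%:R : R).
Proof.
near=> n; rewrite -ler_expR lnK; last by rewrite posrE ltr0n; near: n; exists 1%N.
apply: (le_trans (ltW (truncnS_gt _))); rewrite ler_nat; near: n.
by exists (Num.truncn (expR M)).+1.
Unshelve. all: by end_near. Qed.

Variable alpha : exponent R.

Lemma decay_le_powR (y k : R) p : 0 < y -> 0 < k -> y <= k * 2 ^+ p ->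
  decay alpha ^+ p <= k `^ (1 / 2 - (alpha : R)) * y `^ ((alpha : R) - 1 / 2).
Proof.
move=> y0 k0 yk; have /andP[_ a2] := exponent_valP alpha.
have c0 : 0 <= 1 / 2 - (alpha : R) by lra.
have -> : (alpha : R) - 1 / 2 = - (1 / 2 - (alpha : R)) by rewrite opprB.
rewrite powRN ler_pdivlMr ?powR_gt0//.
have p0 : 0 <= 2 ^+ p :> R by rewrite exprn_ge0.
apply: (@le_trans _ _ (decay alpha ^+ p * (k `^ (1 / 2 - (alpha : R)) *
    (2 ^+ p) `^ (1 / 2 - (alpha : R))))).
  apply: ler_wpM2l; first by rewrite exprn_ge0 ?powR_ge0.
  rewrite -powRM// ?(ltW k0)//; apply: ge0_ler_powR; rewrite ?nnegrE// ?mulr_ge0//; exact: ltW.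
rewrite powR_exprn// mulrCA -exprMn /decay -powRD; last by rewrite pnatr_eq0 implybT.
by rewrite -[_ - 1 / 2]opprB addNr powRr0 expr1n mulr1.
Qed.

Lemma decayXE N : 2 `^ (((alpha : R) - 1 / 2) * N%:R) = decay alpha ^+ N.
Proof. by rewrite powRrM powR_mulrn ?powR_ge0. Qed.

End Levels.

Theorem proposition3p8 (R : realType) (T : R) (d : nat) (alpha : exponent R)
  (T_gt0 : 0 < T) (d_gt0 : (0 < d)%N)
  (L : probability (borel (holder0 T d alpha)) R) (hL : is_brownian_law L)
  (N : nat -> nat)
  (N_lambert : asymp (fun n => ((N n)%:R : R)%:E)
    (fun n => let a : R := ln (2 `^ (2 * (alpha : R) - 1)) in
      (lambertWm1 (a * ln n%:R `^ (2 * (alpha : R) - 1)) / a)%:E))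
  (N_amounts : asymp
    (fun n => (Num.sqrt (N n)%:R * 2 `^ (((alpha : R) - 1 / 2) * (N n)%:R))%:E)
    (fun n => (ln n%:R `^ ((alpha : R) - 1 / 2))%:E))
  (c : forall n, 'I_n -> schauder_space T 1 alpha (N n))
  (S : forall n, 'I_n -> set (schauder_space T 1 alpha (N n)))
  (c_stationary : forall n, (0 < n)%N ->
    is_stationary (coordinate_law L (N n) (Ordinal d_gt0)) (c n) (S n))
  (c_minimiser : forall n, (0 < n)%N ->
    is_mse_minimiser (coordinate_law L (N n) (Ordinal d_gt0)) (c n))
  (q : forall n, holder0 T d alpha -> schauder_space T d alpha (N n))
  (hq : forall n, (0 < n)%N -> is_quantization (c n) (S n) (q n))
  (r : R) (r_gt1 : 1 < r) :
  lesssim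
    (fun n => ((\int[L]_x
      (`|(x : holder0 T d alpha) - (q n x : holder0 T d alpha)| `^ r)%:E) `^ r^-1)%E)
    (fun n => (d%:R * ln n%:R `^ ((alpha : R) - 1 / 2))%:E).
Proof.
have r0 : 0 < r by exact: lt_trans r_gt1.
have [k k0 hk] := quantization_error T_gt0 hL d_gt0 r0.
have /andP[d0 d1] := decay_itv alpha.
pose w n : R := Num.sqrt (N n)%:R * decay alpha ^+ N n.
pose l n : R := ln n%:R `^ ((alpha : R) - 1 / 2).
have w0 n : 0 <= w n by rewrite mulr_ge0 ?sqrtr_ge0 ?exprn_ge0// ltW.
have l0 n : 0 <= l n by exact: powR_ge0.
have wE : (fun n => (Num.sqrt (N n)%:R * 2 `^ (((alpha : R) - 1 / 2) * (N n)%:R))%:E) =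
    (fun n => (w n)%:E) by apply/funext => n; rewrite decayXE.
move: N_amounts; rewrite /asymp wE => -[/(lesssim_near w0 l0)[k1 k10 wl]].
move=> /(lesssim_near l0 w0)[k2 k20 lw].
(* [p0] is the level with [640 * 2 ^ p0 <= ln n < 640 * 2 ^ (p0 + 1)]. *)
pose k3 : R := (640 * 2) `^ (1 / 2 - (alpha : R)).
have h640 : 0 < 640 :> R by rewrite ltr0n.
have h1280 : 0 < 640 * 2 :> R := mulr_gt0 h640 (ltr0n R 2).
have k30 : 0 < k3 := powR_gt0 _ h1280.
have [p1 hp1] := truncation_level_le (decay_itv alpha) (mulr_gt0 k30 k20).
pose K := (2 * k) `^ r^-1 * (k1 + k3).
apply: (@near_lesssim _ _ _ K).
  by rewrite mulr_gt0 ?powR_gt0 ?mulr_gt0// addr_gt0.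
near=> n.
have n1 : (1 < n)%N by near: n; exists 2.
have ln1 : 640 * 2 ^+ p1 <= ln (n%:R : R) by near: n; exact: ln_nat_cvg.
have lnpos : 0 < ln (n%:R : R).
  exact: lt_le_trans (mulr_gt0 h640 (exprn_gt0 _ (ltr0n R 2))) ln1.
have lpos : 0 < l n by exact: powR_gt0.
have dl0 : 0 < d%:R * l n by rewrite mulr_gt0// ltr0n.
split=> //.
have wln : w n <= k1 * l n by near: n.
have lwn : l n <= k2 * w n by near: n.
have [|p0 lp0 lp1] := @dyadic_level R (ln n%:R / 640).
  rewrite (ler_pdivlMr _ _ h640) mul1r; apply: le_trans ln1.
  by rewrite (ler_peMr (ltW h640)) ?exprn_ege1 ?ler1n.
have p10 : (p1 <= p0)%N.
  rewrite -ltnS -(@ltr_eXn2l R 2) ?ltr1n//; apply: le_lt_trans lp1.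
  by rewrite (ler_pdivlMr _ _ h640) mulrC.
have dln : decay alpha ^+ p0 <= k3 * l n.
  apply: (decay_le_powR _ lnpos h1280).
  by rewrite -mulrA -exprS mulrC -(ler_pdivrMr _ _ h640) ltW.
have Np0 : ((N n).+1 <= 2 * p0)%N.
  apply: hp1 => //; apply: (le_trans dln); rewrite -mulrA.
  by apply: ler_wpM2l; [exact: ltW|exact: lwn].
have en : expR (640 * 2 ^+ p0) <= n%:R :> R.
  by rewrite -[leRHS]lnK ?posrE ?ltr0n ?(ltnW n1)// ler_expR mulrC -(ler_pdivlMr _ _ h640).
have Nn0 : (0 < N n)%N.
  rewrite lt0n; apply/eqP => N0; move: lwn; rewrite /w N0 sqrtr0 mul0r mulr0.
  by rewrite leNgt lpos.
have n0 := ltnW n1; have [_ vorS _] := c_stationary n n0.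
have := hk n (N n) p0 (c n) (S n) (q n) n1 Nn0 Np0 en vorS (c_minimiser n n0) (hq n n0).
rewrite -/(w n); set I := (\int[L]_x _)%E; set dl := decay alpha ^+ p0 => hI.
have dl_ge0 : 0 <= dl by rewrite exprn_ge0// ltW.
have s0 : 0 <= w n + dl by rewrite addr_ge0.
have h2 : (I <= (2 * k * (w n + dl) `^ r)%:E)%E.
  apply: (le_trans hI); rewrite lee_fin [2 * k]mulrC -mulrA; apply: ler_wpM2l; first exact: ltW.
  rewrite mulr_natl mulr2n; apply: lerD; apply: ge0_ler_powR; rewrite ?nnegrE ?(ltW r0)//.
    by rewrite lerDl.
  by rewrite lerDr.
have I0 : (0 <= I)%E by apply: integral_ge0 => x _; rewrite lee_fin powR_ge0.
apply: (@le_trans _ _ ((2 * k * (w n + dl) `^ r)%:E `^ r^-1)%E).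
  by apply: gt0_ler_poweR; rewrite ?in_itv/= ?leey ?andbT ?lee_fin ?mulr_ge0 ?powR_ge0 ?invr_ge0// ltW.
rewrite poweR_EFin lee_fin powRM ?mulr_ge0 ?powR_ge0 ?(ltW k0)//.
rewrite -powRrM mulfV ?gt_eqF// powRr1// /K -mulrA.
apply: ler_wpM2l; first exact: powR_ge0.
apply: (@le_trans _ _ ((k1 + k3) * l n)); first by rewrite mulrDl lerD.
apply: ler_wpM2l; first by rewrite addr_ge0// ltW.
by rewrite ler_peMl// ler1n.
Unshelve. all: by end_near. Qed.
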